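(* Let $C_p(E,Q)$ denote the $C$-polynomial of the twist knot $K_p$, $p\in\mathbb Z$. (a) For all $p\ge0$, $$C_{p+2}(E,Q)=(Q-Q^2+E+Q^2E)\,C_{p+1}(E,Q)-Q^2E^2\,C_p(E,Q),$$ with initial conditions $C_0(E,Q)=1$, $C_1(E,Q)=Q+E$. For all $p\le0$, $$C_{p-2}(E,Q)=(Q-Q^2+E+Q^2E)\,Q^{-2}\,C_{p-1}(E,Q)-E^2Q^{-2}\,C_p(E,Q),$$ with initial conditions $C_0(E,Q)=1$, $C_{-1}(E,Q)=-1+E$. (b) For all $p\in\mathbb Z$, $$C_p^{\mathrm{op}}(M-2+M^{-1},1)=\Delta_p(M),$$ where $\Delta_p$ is the Alexander polynomial of $K_p$.
   Context: **Operators.** A discrete function is a map $f:\mathbb N=\{0,1,2,\dots\}\to\mathbb Q(q)$. Operators act by $(Ef)(n)=f(n+1)$, $(Qf)(n)=q^nf(n)$, so $EQ=qQE$. Let $\mathcal A=\mathbb Q(q)\langle Q,E\rangle/(EQ-qQE)$ and $\mathcal A_{\mathrm{loc}}=\mathbb Q(q,Q)\langle E\rangle/(E\alpha(Q,q)-\alpha(qQ,q)E\mid\alpha\in\mathbb Q(Q,q))$, a (left) principal ideal domain. For a discrete function $f$ let $I_f=\{P\in\mathcal A\mid Pf=0\}$. The characteristic polynomial of $f$ is a generator $P_f(E,Q,q)$ of the left ideal of $\mathcal A_{\mathrm{loc}}$ generated by $I_f$ (unique up to left multiplication by a nonzero element of $\mathbb Q(q,Q)$). **$C$-polynomial.** For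 a knot $K$, $J_K(n)\in\mathbb Z[q^{\pm1}]$ ($n\ge1$) is the colored Jones function (color: the $n$-dimensional irreducible representation of $\mathfrak{sl}_2$; value $1$ on the unknot). The cyclotomic function $\hat J_K:\mathbb N\to\mathbb Z[q^{\pm1}]$ is determined by $J_K(n)=\sum_{k\ge0}C(n,k)\hat J_K(k)$ for $n\ge1$, with $C(n,k)=\{n-k\}\cdots\{n-1\}\{n+1\}\cdots\{n+k\}$, $\{a\}=q^{a/2}-q^{-a/2}$. The non-commutative $C$-polynomial $C_K(E,Q,q)$ is the characteristic polynomial of $\hat J_K$, and the $C$-polynomial is $C_K(E,Q)=C_K(E,Q,1)$. For twist knots the non-commutative $C$-polynomial is normalized to be monic in $E$; it then has coefficients in $\mathbb Z[Q^{\pm1},q^{\pm1}]$. **Twist knots.** $K_p$ ($p\in\mathbb Z$) is the twist knot with $p$ full twists and a negative clasp; $K_0$ is the unknot, $K_1=3_1$, $K_2=5_2$, $K_{-1}=4_1$, $K_{-2}=6_1$. It is known (Masbaum) that its cyclotomic function is $$\hat J_p(n)=\sum_{k=0}^{n}q^{n(n+3)/2+pk(k+1)+k(k-1)/2}(-1)^{n+k+1}\frac{(q^{2k+1}-1)(q;q)_n}{(q;q)_{n+k+1}(q;q)_{n-k}},$$ with $(q;q)_m=(1-q)\cdots(1-q^m)$ and $(q;q)_0=1$. **Other notation.** For a polynomial $P(E,Q)$ in $E$, $P^{\mathrm{op}}(E,Q)=E^{\deg_EP}P(E^{-1},Q)$. The Alexander polynomial $\Delta_K(t)\in\mathbb Z[t^{\pm1}]$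 is normalized by $\Delta_K(t)=\Delta_K(t^{-1})$ and $\Delta_{\mathrm{unknot}}(t)=1$ (so that $\Delta_K(1)=1$). *)

(* Defs.v *)
From HB Require Import structures.
From mathcomp Require Import all_boot all_order all_algebra.
From mathcomp Require Import boolp classical_sets.

Set Implicit Arguments.
Unset Strict Implicit.
Unset Printing Implicit Defensive.

Import Order.TTheory GRing.Theory Num.Theory.
Local Open Scope ring_scope.

(* F(x), the field of rational functions in one variable over F *)
Notation ratfun F := {fraction {poly F}}.

Definition var (F : fieldType) : ratfun F := tofrac 'X.

Definition const (F : fieldType) (a : F) : ratfun F := tofrac a%:P.

(* The value at [a] of a rational function that is regular at [a]; the default
   value 0 is only returned at a pole. *)
Definition ratfun_at (F : fieldType) (a : F) (x : ratfun F) : F :=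
  xget 0 [set y | exists n d : {poly F},
    [/\ d.[a] != 0, x = tofrac n / tofrac d & y = n.[a] / d.[a]]]%classic.

(* Q(q), and Q(q,Q) presented as Q(q)(Q) *)
Notation Kq := (ratfun rat).
Notation KqQ := (ratfun Kq).

Definition qv : Kq := var rat.

(** * Operators on discrete functions and characteristic polynomials *)

(* Everything is done over an arbitrary field F with a distinguished element q;
   it is applied to F = Q(q). *)

Definition opE (F : fieldType) (f : nat -> F) : nat -> F := fun n => f n.+1.

Definition opQ (F : fieldType) (q : F) (f : nat -> F) : nat -> F :=
  fun n => q ^+ n * f n.

(* The algebra A = F<Q,E>/(EQ - qQE) has the basis Q^i E^j over F; the element
   sum_(i,j) c_ij Q^i E^j is represented by the polynomial [P] in E over F[Q]
   with P`_j`_i = c_ij (coefficients on the left). *)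
Definition act (F : fieldType) (q : F) (P : {poly {poly F}}) (f : nat -> F) :
    nat -> F := fun n =>
  \sum_(j < size P) \sum_(i < size P`_j)
    P`_j`_i * iter i (opQ q) (iter j (@opE F) f) n.

Definition annihilates (F : fieldType) (q : F) (P : {poly {poly F}})
    (f : nat -> F) : Prop :=
  forall n, act q P f n = 0.

(* The endomorphism alpha(Q) |-> alpha(qQ) of F(Q), q != 0. It is computed on
   the fraction chosen by [repr]; [dilate_div] shows that the choice is
   immaterial. *)
Definition dilate (F : fieldType) (q : F) (x : ratfun F) : ratfun F :=
  tofrac (\n_(repr x) \Po (q *: 'X)) / tofrac (\d_(repr x) \Po (q *: 'X)).

(* Elements sum_j alpha_j(Q) E^j of A_loc, coefficients on the left. The
   commutative product of {poly (ratfun F)} is not the product of A_loc, which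
   is [skew_mul], determined by E alpha(Q) = alpha(qQ) E. *)
Notation Aloc F := {poly (ratfun F)}.

Definition skew_mul (F : fieldType) (q : F) (P R : Aloc F) : Aloc F :=
  \sum_(i < size P) \sum_(j < size R)
    (P`_i * iter i (dilate q) R`_j) *: 'X^(i + j).

Definition A_to_Aloc (F : fieldType) (P : {poly {poly F}}) : Aloc F :=
  map_poly (@tofrac {poly F}) P.

(* the left ideal of A_loc generated by the annihilator of f in A *)
Definition in_ann_ideal (F : fieldType) (q : F) (f : nat -> F) (R : Aloc F) :
    Prop :=
  exists2 s : seq (Aloc F * {poly {poly F}}),
    (forall x, x \in s -> annihilates q x.2 f) &
    R = \sum_(x <- s) skew_mul q x.1 (A_to_Aloc x.2).

Definition is_char_poly (F : fieldType) (q : F) (f : nat -> F) (P : Aloc F) :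
    Prop :=
  forall R : Aloc F, in_ann_ideal q f R <-> exists S : Aloc F, R = skew_mul q S P.

(** * The C-polynomial *)

(* [x] is the Laurent polynomial L(Q,q) / (Q^a q^b) in Z[Q^+-1, q^+-1], and [y]
   in Q(Q) is its specialization at q = 1. [L] is a polynomial in Q over Z[q]. *)
Definition laurent_at_q1 (x : KqQ) (y : ratfun rat) : Prop :=
  exists (L : {poly {poly int}}) (a b : nat),
    x = tofrac (map_poly (fun c : {poly int} =>
                            tofrac (map_poly (fun z => z%:~R : rat) c)) L)
          / (var Kq ^+ a * const qv ^+ b)
    /\ y = tofrac (map_poly (fun c : {poly int} => (c.[1])%:~R) L)
             / var rat ^+ a.

(* [C] = P(E,Q,1) for the characteristic polynomial P of f that is monic in E,
   which is required to have coefficients in Z[Q^+-1, q^+-1]. *)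
Definition is_C_poly (f : nat -> Kq) (C : {poly (ratfun rat)}) : Prop :=
  exists P : Aloc Kq,
    [/\ is_char_poly qv f P, P \is monic & forall j, laurent_at_q1 P`_j C`_j].

(* (q;q)_m *)
Definition qpoch (m : nat) : Kq := \prod_(i < m) (1 - qv ^+ i.+1).

(* Masbaum's formula for the cyclotomic function of the twist knot K_p *)
Definition Jhat (p : int) (n : nat) : Kq :=
  \sum_(k < n.+1)
    qv ^ (((n * (n + 3))./2)%:Z + p * (k * k.+1)%:Z + ((k * k.-1)./2)%:Z)
    * (-1) ^+ (n + k + 1)
    * ((qv ^+ (2 * k + 1) - 1) * qpoch n / (qpoch (n + k + 1) * qpoch (n - k))).

(* C_p(E,Q), a polynomial in E over Q(Q); 0 if there were no polynomial as in
   [is_C_poly]. *)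
Definition C_twist (p : int) : {poly (ratfun rat)} :=
  xget 0 [set C | is_C_poly (Jhat p) C]%classic.

(* E^deg P(E^-1) *)
Definition op_poly (R : nzRingType) (P : {poly R}) : {poly R} :=
  \sum_(j < size P) P`_j *: 'X^((size P).-1 - j).

(** * Knot diagrams and the Alexander polynomial *)

(* Signed Gauss code of an oriented knot diagram with crossings 0, ..., n-1:
   the passages met when travelling once along the knot, (c, true) being the
   over-passage and (c, false) the under-passage at the crossing c, together
   with the signs of the crossings. *)
Record diagram := Diagram {
  crossings : nat;
  gauss : seq (nat * bool);
  positive : nat -> bool }.

(* The arcs are numbered along the knot from the starting point, arc 0 being
   the one containing it; a new arc begins after each under-passage. *)
Definition arc (D : diagram) (i : nat) : nat :=
  (count (fun x : nat * bool => ~~ x.2) (take i (gauss D)) %% crossings D)%N.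

(* Alexander matrix of the Wirtinger presentation: at a positive crossing with
   over-arc x, incoming under-arc a and outgoing under-arc b the relation is
   x b = a x, and at a negative crossing it is b x = x a; the Fox derivatives
   are then abelianized by sending every generator to t = 'X. *)
Definition alexander_entry (D : diagram) (c j : nat) : {poly int} :=
  let x := arc D (index (c, true) (gauss D)) in
  let a := arc D (index (c, false) (gauss D)) in
  let b := (a.+1 %% crossings D)%N in
  (1 - 'X) *+ (j == x)
  + (if positive D c then 'X else -1) *+ (j == b)
  + (if positive D c then -1 else 'X) *+ (j == a).

Definition alexander_minor (D : diagram) : {poly int} :=
  \det (\matrix_(i < (crossings D).-1, j < (crossings D).-1)
          alexander_entry D i j).

Definition eval_int (F : fieldType) (d : {poly int}) (x : F) : F :=
  (map_poly (fun z : int => z%:~R : F) d).[x].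

(* Delta is t^m d(t) for d the first minor of the Alexander matrix up to sign,
   normalized by Delta(t^-1) = Delta(t) and Delta(1) = 1. *)
Definition is_alexander_poly (D : diagram) (Delta : ratfun rat) : Prop :=
  let t := var rat in
  exists (e : bool) (m : int),
    let d := (-1) ^+ e * alexander_minor D in
    [/\ Delta = t ^ m * eval_int d t,
        t^-1 ^ m * eval_int d t^-1 = Delta
      & d.[1] = 1].

(* The standard diagram of K_p. Crossings 0, ..., N-1, N = 2|p|, form the twist
   region, in which the two strands are antiparallel; all of them are negative
   for p > 0 and positive for p < 0. Crossings N and N+1 form the negative
   clasp. The knot runs through the twist region along one strand, makes the
   first half of the clasp, runs back through the twist region along the other
   strand and makes the second half of the clasp. The diagram is alternating
   iff p <= 0. *)
Definition twist_knot (p : int) : diagram :=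
  let N := (2 * `|p|)%N in
  let pos := p <= 0 in
  let over i := odd i (+) pos in
  Diagram N.+2
    ([seq (i, over i) | i <- iota 0 N]
       ++ [:: (N, true); (N.+1, false)]
       ++ [seq (i, ~~ over i) | i <- rev (iota 0 N)]
       ++ [:: (N.+1, true); (N, false)])
    (fun i => pos && (i < N)%N).

(** * Sanity checks *)

Lemma opEQ (F : fieldType) (q : F) f n : opE (opQ q f) n = q * opQ q (opE f) n.
Proof. by rewrite /opE /opQ exprS mulrA. Qed.

Lemma repr_fracE (R : idomainType) (x : {fraction R}) :
  x = tofrac \n_(repr x) / tofrac \d_(repr x).
Proof.
have d0 := denom_ratioP (repr x).
have d0' : tofrac \d_(repr x) != 0 :> {fraction R} by rewrite tofrac_eq0.
apply: (canRL (mulfK d0')); rewrite -{1}[x]reprK.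
unlock FracField.tofrac; rewrite -[LHS]FracField.pi_mul.
apply/eqP; rewrite FracField.equivf_def /FracField.mulf.
rewrite !numden_Ratio ?mulf_neq0 ?oner_neq0 //.
by rewrite !mulr1 mulrC.
Qed.

Section Dilate.
Variables (F : fieldType) (q : F).
Hypothesis q0 : q != 0.

Lemma comp_qX_neq0 (d : {poly F}) : d != 0 -> d \Po (q *: 'X) != 0.
Proof.
move=> d0; rewrite -size_poly_eq0 size_comp_poly2 ?size_poly_eq0 //.
by rewrite size_scale ?size_polyX.
Qed.

Lemma dilate_div (n d : {poly F}) : d != 0 ->
  dilate q (tofrac n / tofrac d) =
  tofrac (n \Po (q *: 'X)) / tofrac (d \Po (q *: 'X)).
Proof.
move=> d0; rewrite /dilate; set x := tofrac n / _.
have d1 := denom_ratioP (repr x).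
have := repr_fracE x; rewrite {1}/x => /eqP.
rewrite !eqr_div ?tofrac_eq0 // -!tofracM tofrac_eq => /eqP E.
apply/eqP; rewrite eqr_div ?tofrac_eq0 ?comp_qX_neq0 // -!tofracM tofrac_eq.
by rewrite -!comp_polyM -E mulrC.
Qed.

Lemma dilate0 : dilate q 0 = 0.
Proof.
rewrite -[0 in LHS](mul0r (tofrac 1)^-1) -tofrac0 dilate_div ?oner_neq0 //.
by rewrite comp_poly0 tofrac0 mul0r.
Qed.

Lemma dilate_const (c : F) : dilate q (const c) = const c.
Proof.
rewrite -[const c in LHS]divr1 -tofrac1 dilate_div ?oner_neq0 //.
by rewrite !comp_polyC tofrac1 divr1.
Qed.

Lemma dilate_var : dilate q (var F) = const q * var F.
Proof.
rewrite -[var F in LHS]divr1 -tofrac1 dilate_div ?oner_neq0 //.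
by rewrite comp_polyX comp_polyC tofrac1 divr1 -mul_polyC tofracM.
Qed.

Lemma skew_mulXC (a : ratfun F) : skew_mul q 'X a%:P = (dilate q a)%:P * 'X.
Proof.
rewrite /skew_mul size_polyX !big_ord_recl big_ord0 addr0 /= !coefX /=.
rewrite big1 ?add0r => [|j _]; last by rewrite mul0r scale0r.
rewrite size_polyC; have [->|a0] := eqVneq a 0.
  by rewrite big_ord0 dilate0 mul0r.
by rewrite big_ord1 coefC /= mul1r mul_polyC.
Qed.

End Dilate.

(* Main.v *)
From HB Require Import structures.
Require Import Defs.
From mathcomp Require Import all_boot all_order all_algebra.
From mathcomp Require Import perm polyXY algC.
From mathcomp Require Import zify ring lra.

(** Why the theorem holds.

    For j in Z let b_j(n) be Masbaum's sum with the factor (q^(2k+1) - 1) / q^k,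
    which is qx - 1/x for x = q^k, replaced by (qx)^j - x^-j; so b_1 is the
    cyclotomic function of K_p and b_0 = 0. Two relations hold. By [bsum_rec],
    b_(j+1)(n + 1) is a combination of b_j(n + 1), b_j(n) and b_(j-1)(n + 1);
    this does not involve p and lets one write b_j as an operator in E and Q
    applied to b_1. By [bsum_relation], whose terms telescope, there is a linear
    relation between b_(p+1)(n), b_p(n) and b_(p-1)(n). Substituting the first
    in the second gives an operator of order |p| that kills b_1. Its leading
    coefficient is a common factor times a monomial, and the quotient [monic_op]
    has Laurent polynomials as coefficients. At q = 1, where E and Q commute,
    the first recurrence has constant coefficients, and this is the recurrence
    of part (a) ([Cpol_rec_pos], [Cpol_rec_neg]).

    It remains to see that [monic_op] is the characteristic polynomial. As b_1
    has infinite support ([bsum1_not_finite]), no operator of order 0 kills it,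
    so it is enough that [monic_op] has no proper right factor in A_loc. Gauss's
    lemma at the place q = 1 of Q(q,Q) ([gauss_skewp]) turns a factorization in
    A_loc into a factorization of [monic_op] at q = 1, with factors of the same
    degrees, over Q(Q). That polynomial is irreducible ([Cpol_factor]): as a
    polynomial in Q over Q[E], up to a power of Q, its leading coefficient is a
    power of E - 1, its constant coefficient is a monomial in E, and both have
    almost full degree in E; so one of two factors would have full degree in E
    at both ends, which forces it to be constant in Q and to divide powers of E
    and of E - 1 ([irreducible_criterion]).

    For (b), the recurrence at Q = 1 has the double root E, so that C_p is
    E^|p| + p E^(|p|-1) and its reverse is 1 + p E ([Phi_at1]). On the other hand the
    relations of the Alexander matrix in the twist region have a solution that
    is affine along the two strands; the minor is, up to a unit, the amount by
    which this solution fails the relation of the clasp, t + p (1 - t)^2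
    ([alexander_minor_twist], [residualE]).

    For p = 0 the function b_1 is supported at 0, and both sides are trivial. *)

Set Implicit Arguments.
Unset Strict Implicit.
Unset Printing Implicit Defensive.

Import Order.TTheory GRing.Theory Num.Theory.
Local Open Scope ring_scope.

(** * Skew polynomials *)
Section Skew.
Variables (K : fieldType) (sigma : {rmorphism K -> K}).

(** Left multiplication by E in the ring of skew polynomials over K, where
    E a = sigma(a) E and coefficients are written on the left. *)
Definition shiftl (R : {poly K}) : {poly K} := 'X * map_poly sigma R.

(** The product of this ring; it is carried by the same type as the commutative
    polynomials, which keeps degrees and coefficients available. *)
Definition skewp (S R : {poly K}) : {poly K} :=
  \sum_(i < size S) S`_i *: iter i shiftl R.

Lemma shiftlD R1 R2 : shiftl (R1 + R2) = shiftl R1 + shiftl R2.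
Proof. by rewrite /shiftl rmorphD mulrDr. Qed.

Lemma shiftl0 : shiftl 0 = 0.
Proof. by rewrite /shiftl rmorph0 mulr0. Qed.

Lemma shiftl_sum I (r : seq I) (F : I -> {poly K}) :
  shiftl (\sum_(i <- r) F i) = \sum_(i <- r) shiftl (F i).
Proof. by rewrite /shiftl rmorph_sum mulr_sumr. Qed.

Lemma shiftlZ a R : shiftl (a *: R) = sigma a *: shiftl R.
Proof. by rewrite /shiftl map_polyZ scalerAr. Qed.

Lemma coef_shiftl R i : (shiftl R)`_i = if i is j.+1 then sigma R`_j else 0.
Proof. by rewrite /shiftl coefXM; case: i => //= i; rewrite coef_map. Qed.

Lemma size_shiftl (R : {poly K}) : R != 0 -> size (shiftl R) = (size R).+1.
Proof.
move=> R0; rewrite /shiftl mulrC size_mulX ?size_map_poly //.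
by rewrite map_poly_eq0.
Qed.

Lemma shiftl_neq0 R : R != 0 -> shiftl R != 0.
Proof. by move=> R0; rewrite -size_poly_eq0 size_shiftl. Qed.

Lemma iter_shiftl0 i : iter i shiftl 0 = 0.
Proof. by elim: i => //= i ->; rewrite shiftl0. Qed.

Lemma iter_shiftl_neq0 i R : R != 0 -> iter i shiftl R != 0.
Proof. by move=> R0; elim: i => //= i; apply: shiftl_neq0. Qed.

Lemma size_iter_shiftl i (R : {poly K}) : R != 0 -> size (iter i shiftl R) = (i + size R)%N.
Proof.
by move=> R0; elim: i => //= i IH; rewrite size_shiftl ?IH ?iter_shiftl_neq0.
Qed.

Lemma skewp_widen n (S R : {poly K}) : (size S <= n)%N ->
  skewp S R = \sum_(i < n) S`_i *: iter i shiftl R.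
Proof.
move=> le_Sn; rewrite /skewp -!(big_mkord xpredT (fun i => S`_i *: iter i shiftl R)).
rewrite [RHS](@big_cat_nat _ _ _ (size S)) //= [X in _ = _ + X]big1_seq ?addr0 //.
move=> i /andP[_]; rewrite mem_index_iota => /andP[le_Si _].
by rewrite nth_default // scale0r.
Qed.

Lemma skewpDl S1 S2 R : skewp (S1 + S2) R = skewp S1 R + skewp S2 R.
Proof.
set n := maxn (size S1) (size S2).
rewrite (skewp_widen (n := n)) ?size_polyD //.
rewrite (@skewp_widen n S1) ?leq_maxl // (@skewp_widen n S2) ?leq_maxr //.
by rewrite -big_split; apply: eq_bigr => i _; rewrite coefD scalerDl.
Qed.

Lemma skewpZl a S R : skewp (a *: S) R = a *: skewp S R.
Proof.
rewrite (@skewp_widen (size S)) ?size_scale_leq // /skewp scaler_sumr.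
by apply: eq_bigr => i _; rewrite coefZ scalerA.
Qed.

Lemma skewp0l R : skewp 0 R = 0.
Proof. by rewrite /skewp size_poly0 big_ord0. Qed.

Lemma skewp0r S : skewp S 0 = 0.
Proof. by rewrite /skewp big1 // => i _; rewrite iter_shiftl0 scaler0. Qed.

Lemma skewp_suml I (r : seq I) (F : I -> {poly K}) R :
  skewp (\sum_(i <- r) F i) R = \sum_(i <- r) skewp (F i) R.
Proof. exact: (big_morph (skewp^~ R) (fun _ _ => skewpDl _ _ R) (skewp0l R)). Qed.

Lemma skewpCl a R : skewp a%:P R = a *: R.
Proof. by rewrite (@skewp_widen 1) ?size_polyC_leq1 // big_ord1 coefC. Qed.

(** With bilinearity this gives associativity: E (S R) = (E S) R, and every skew
    polynomial is a combination of powers of E. *)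
Lemma skewp_shiftl S R : skewp (shiftl S) R = shiftl (skewp S R).
Proof.
have [->|S0] := eqVneq S 0; first by rewrite shiftl0 !skewp0l shiftl0.
rewrite /skewp size_shiftl // big_ord_recl coef_shiftl scale0r add0r.
by rewrite shiftl_sum; apply: eq_bigr => i _; rewrite shiftlZ coef_shiftl.
Qed.

Lemma skewp_iter_shiftl i S R : skewp (iter i shiftl S) R = iter i shiftl (skewp S R).
Proof. by elim: i => //= i IH; rewrite skewp_shiftl IH. Qed.

Lemma skewpA S R U : skewp (skewp S R) U = skewp S (skewp R U).
Proof.
rewrite {2}/skewp skewp_suml; apply: eq_bigr => i _.
by rewrite skewpZl skewp_iter_shiftl.
Qed.

Lemma skewpXn n R : skewp 'X^n R = iter n shiftl R.
Proof.
rewrite /skewp size_polyXn big_ord_recr /= big1 => [|i _]; last first.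
  by rewrite coefXn ltn_eqF ?scale0r.
by rewrite add0r coefXn eqxx scale1r.
Qed.

(** Leading coefficients multiply up to a twist by sigma, which is injective;
    hence degrees add and there are no zero divisors. *)
Lemma coef_skewp_top (S R : {poly K}) : S != 0 -> R != 0 ->
  (size (skewp S R) <= (size S + size R).-1)%N /\
  (skewp S R)`_(size S + size R).-2 != 0.
Proof.
move=> S0 R0; have: (0 < size S)%N by rewrite size_poly_gt0.
have: lead_coef S != 0 by rewrite lead_coef_eq0.
rewrite lead_coefE /skewp; case: (size S) => // n Sn _.
have szn: size (iter n shiftl R) = (n + size R)%N by apply: size_iter_shiftl.
have Rgt0 : (0 < size R)%N by rewrite size_poly_gt0.
have szl : (size (\sum_(i < n) S`_i *: iter i shiftl R)%R < n + size R)%N.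
  apply: leq_ltn_trans (size_sum _ _ _) _.
  case: (size R) Rgt0 (fun i => size_iter_shiftl i R0) => // r _ sz.
  rewrite addnS ltnS; apply/bigmax_leqP => i _.
  apply: leq_trans (size_scale_leq _ _) _.
  by rewrite sz addnS -addSn leq_add2r.
rewrite big_ord_recr /=; split.
  apply: leq_trans (size_polyD _ _) _; rewrite geq_max ltnW //=.
  by rewrite size_scale // szn.
rewrite coefD nth_default ?add0r; last first.
  by rewrite -ltnS prednK ?addn_gt0 ?Rgt0 ?orbT.
rewrite coefZ mulf_neq0 // -szn -lead_coefE lead_coef_eq0.
exact: iter_shiftl_neq0.
Qed.

Lemma size_skewp (S R : {poly K}) : S != 0 -> R != 0 ->
  size (skewp S R) = (size S + size R).-1.
Proof.
move=> S0 R0; have [le1 nz] := coef_skewp_top S0 R0; apply/eqP.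
rewrite eqn_leq le1 /=.
have : (0 < size S)%N by rewrite size_poly_gt0.
case: (size S) nz => // n; rewrite addSn /= => nz _.
have Rgt0 : (0 < size R)%N by rewrite size_poly_gt0.
rewrite leqNgt; apply/negP => lt; case/negP: nz; apply/eqP.
by rewrite nth_default // -ltnS prednK // addn_gt0 Rgt0 orbT.
Qed.

(** Right division, as for ordinary polynomials: a left multiple a E^i R of R
    has the same leading term as B. *)
Lemma skewp_div (B R : {poly K}) : R != 0 ->
  exists S U : {poly K}, B = skewp S R + U /\ (size U < size R)%N.
Proof.
move=> R0; have [n] := ubnP (size B); elim: n B => // n IH B leBn.
have [ltBR|leRB] := ltnP (size B) (size R).
  by exists 0, B; rewrite skewp0l add0r.
have Rgt0 : (0 < size R)%N by rewrite size_poly_gt0.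
have B0 : B != 0 by rewrite -size_poly_gt0 (leq_trans Rgt0).
pose i := (size B - size R)%N; pose R' := iter i shiftl R.
have R'0 : R' != 0 by apply: iter_shiftl_neq0.
have szR' : size R' = size B by rewrite size_iter_shiftl // subnK.
pose a := lead_coef B / lead_coef R'.
have a0 : a != 0 by rewrite mulf_neq0 ?invr_eq0 ?lead_coef_eq0.
have lt1 : (size (B - a *: R')%R < size B)%N.
  have le1: (size (B - a *: R')%R <= size B)%N.
    by apply: leq_trans (size_polyD _ _) _; rewrite size_polyN size_scale // szR' maxnn.
  rewrite ltn_neqAle le1 andbT; apply/eqP => E1.
  have: lead_coef (B - a *: R') = 0.
    rewrite lead_coefE E1 coefB coefZ -lead_coefE -szR' -lead_coefE.
    by rewrite /a divfK ?subrr ?lead_coef_eq0.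
  move/eqP; rewrite lead_coef_eq0 -size_poly_eq0 E1 size_poly_eq0.
  by rewrite (negPf B0).
have [|S [U [E2 ltU]]] := IH (B - a *: R'); first by rewrite (leq_trans lt1).
exists (S + a *: 'X^i), U; split=> //.
by rewrite skewpDl skewpZl skewpXn -/R' addrAC -E2 subrK.
Qed.

End Skew.

(** * The dilatation is a field endomorphism *)
Lemma fracP (R : idomainType) (x : {fraction R}) : exists n d : R,
  d != 0 /\ x = tofrac n / tofrac d.
Proof.
by exists \n_(repr x), \d_(repr x); rewrite denom_ratioP; split=> //; apply: repr_fracE.
Qed.

Lemma var_neq0 (F : fieldType) : var F != 0.
Proof. by rewrite /var tofrac_eq0 polyX_eq0. Qed.

Section DilateMorphism.
Variables (F : fieldType) (q : F).
Hypothesis q0 : q != 0.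

Lemma tofrac_cross (n1 d1 n2 d2 : {poly F}) :
  tofrac (n1 * d2 - n2 * d1) = tofrac n1 * tofrac d2 - tofrac n2 * tofrac d1
    :> ratfun F.
Proof. by rewrite tofracB !tofracM. Qed.

Let comp_neq0 := comp_qX_neq0 q0.

Lemma dilate_is_additive : zmod_morphism (dilate q).
Proof.
move=> x y; have [n1 [d1 [d10 ->]]] := fracP x.
have [n2 [d2 [d20 ->]]] := fracP y.
have nz1 : tofrac d1 != 0 by rewrite tofrac_eq0.
have nz2 : tofrac d2 != 0 by rewrite tofrac_eq0.
have subE (K : fieldType) (a b c e : K) : b != 0 -> e != 0 ->
    a / b - c / e = (a * e - c * b) / (b * e).
  by move=> b0 e0; rewrite -mulNr addf_div // mulNr.
rewrite (subE _ _ _ _ _ nz1 nz2) -tofrac_cross -tofracM !dilate_div ?mulf_neq0 //.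
rewrite subE ?tofrac_eq0 ?comp_neq0 //.
by rewrite !(comp_polyM, comp_polyB) tofracM tofracB !tofracM.
Qed.

Lemma dilate_is_multiplicative : monoid_morphism (dilate q).
Proof.
split=> [|x y]; first have c1 : const (1 : F) = 1 by rewrite /const tofrac1.
  by rewrite -c1 dilate_const.
have [n1 [d1 [d10 ->]]] := fracP x; have [n2 [d2 [d20 ->]]] := fracP y.
rewrite mulf_div -!tofracM !dilate_div ?mulf_neq0 // !comp_polyM !tofracM.
by rewrite mulf_div.
Qed.

(* A copy of dilate that carries the proof of q != 0, so that the ring morphism
   structure can be attached to it. *)
Definition dilatation_fun of q != 0 := dilate q.
HB.instance Definition _ :=
  GRing.isZmodMorphism.Build _ _ (dilatation_fun q0) dilate_is_additive.
HB.instance Definition _ :=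
  GRing.isMonoidMorphism.Build _ _ (dilatation_fun q0) dilate_is_multiplicative.

Definition dilatation : {rmorphism ratfun F -> ratfun F} := dilatation_fun q0.

Lemma dilatationE x : dilatation x = dilate q x. Proof. by []. Qed.

Lemma skew_mulE S R : skew_mul q S R = skewp dilatation S R.
Proof.
rewrite /skew_mul /skewp; apply: eq_bigr => i _.
have iterE n (P : {poly ratfun F}) : iter n (shiftl dilatation) P =
    \sum_(j < size P) iter n (dilate q) P`_j *: 'X^(n + j).
  elim: n => [|n IH] /=.
    by rewrite -[LHS]coefK poly_def; apply: eq_bigr => j _; rewrite add0n.
  rewrite IH shiftl_sum; apply: eq_bigr => j _.
  by rewrite shiftlZ /shiftl map_polyXn -exprS.
by rewrite iterE scaler_sumr; apply: eq_bigr => j _; rewrite scalerA.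
Qed.

End DilateMorphism.

(** * The action on discrete functions *)
Section Action.
Variables (F : fieldType) (q : F).
Hypothesis q0 : q != 0.
Local Notation sigma := (dilatation q0).
Local Notation E := (shiftl sigma).
Implicit Types (B : {poly {poly F}}) (R : {poly ratfun F}) (f g : nat -> F).

Lemma iter_opQ i g n : iter i (opQ q) g n = (q ^+ n) ^+ i * g n.
Proof.
elim: i => [|i IH] /=; first by rewrite expr0 mul1r.
by rewrite /opQ -/(opQ q) IH exprS mulrA.
Qed.

Lemma iter_opE i f n : iter i (@opE F) f n = f (n + i)%N.
Proof. by elim: i n => [|i IH] n /=; rewrite ?addn0 // /opE IH addnS. Qed.

Lemma actE N B f n : (size B <= N)%N ->
  act q B f n = \sum_(j < N) (B`_j).[q ^+ n] * f (n + j)%N.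
Proof.
move=> leBN; rewrite /act.
rewrite -!(big_mkord xpredT (fun j => (B`_j).[q ^+ n] * f (n + j)%N)).
rewrite (@big_cat_nat _ _ _ (size B)) //= [X in _ = _ + X]big1_seq ?addr0.
  rewrite big_mkord; apply: eq_bigr => j _.
  rewrite horner_coef big_distrl /=; apply: eq_bigr => i _.
  by rewrite iter_opQ iter_opE mulrA.
move=> j /andP[_]; rewrite mem_index_iota => /andP[leBj _].
by rewrite nth_default // horner0 mul0r.
Qed.

(** An element of A_loc does not act on functions N -> F, because a denominator
    may vanish at some q^n. R f = g is therefore expressed by an element B = c R
    of A with B f = c g; such relations can be added and multiplied on the left
    by rational functions and by E. *)
Definition applies R f g := exists B (c : {poly F}),
  [/\ c != 0, A_to_Aloc B = tofrac c *: R
    & forall n, act q B f n = c.[q ^+ n] * g n].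

Lemma A_to_AlocZ c B : A_to_Aloc (c *: B) = tofrac c *: A_to_Aloc B.
Proof. exact: map_polyZ. Qed.

Lemma A_to_AlocD B1 B2 : A_to_Aloc (B1 + B2) = A_to_Aloc B1 + A_to_Aloc B2.
Proof. exact: rmorphD. Qed.

(** The coefficients in Q act on the left, by evaluation at q^n. *)
Lemma actZ c B f n : act q (c *: B) f n = c.[q ^+ n] * act q B f n.
Proof.
rewrite (@actE (size B)) ?size_scale_leq // (@actE (size B) B) // big_distrr /=.
by apply: eq_bigr => j _; rewrite coefZ hornerM mulrA.
Qed.

Lemma actD B1 B2 f n : act q (B1 + B2) f n = act q B1 f n + act q B2 f n.
Proof.
set N := maxn (size B1) (size B2).
rewrite (@actE N) ?size_polyD // (@actE N B1) ?leq_maxl // (@actE N B2) ?leq_maxr //.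
by rewrite -big_split; apply: eq_bigr => j _ /=; rewrite coefD hornerD mulrDl.
Qed.

Lemma applies1 f : applies 1 f f.
Proof.
exists 1, 1; split; rewrite ?oner_neq0 //.
  by rewrite scale1r /A_to_Aloc rmorph1.
move=> n; rewrite (@actE 1) ?size_poly1 // big_ord1 coefC /= addn0.
by rewrite !hornerC.
Qed.

Lemma applies0 f : applies 0 f (fun=> 0).
Proof.
exists 0, 1; split; rewrite ?oner_neq0 //; first by rewrite scaler0 /A_to_Aloc rmorph0.
by move=> n; rewrite /act size_poly0 big_ord0 mulr0.
Qed.

Lemma applies_ext R f g g' : (forall n, g n = g' n) -> applies R f g -> applies R f g'.
Proof. by move=> eg [B [c [c0 EB Bf]]]; exists B, c; split=> // n; rewrite Bf eg. Qed.

Lemma appliesD R1 R2 f g1 g2 : applies R1 f g1 -> applies R2 f g2 ->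
  applies (R1 + R2) f (fun n => g1 n + g2 n).
Proof.
move=> [B1 [c1 [c10 EB1 Bf1]]] [B2 [c2 [c20 EB2 Bf2]]].
exists (c2 *: B1 + c1 *: B2), (c1 * c2); split; first by rewrite mulf_neq0.
  rewrite A_to_AlocD !A_to_AlocZ EB1 EB2 !scalerA -tofracM (mulrC c2 c1) -tofracM.
  by rewrite scalerDr.
move=> n; rewrite actD !actZ Bf1 Bf2 !hornerM mulrDr !mulrA.
by congr (_ * _ + _); rewrite mulrC.
Qed.

Lemma appliesZ u v R f g g' : v != 0 ->
  (forall n, v.[q ^+ n] * g' n = u.[q ^+ n] * g n) ->
  applies R f g -> applies ((tofrac u / tofrac v) *: R) f g'.
Proof.
move=> v0 eg [B [c [c0 EB Bf]]].
exists (u *: B), (c * v); split; first by rewrite mulf_neq0.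
  rewrite A_to_AlocZ EB !scalerA tofracM; congr (_ *: R).
  have v0' : (tofrac v : ratfun F) != 0 by rewrite tofrac_eq0.
  by rewrite -mulrA [tofrac v * _]mulrC divfK // mulrC.
by move=> n; rewrite actZ Bf hornerM -mulrA eg mulrCA.
Qed.

(** The denominator c(Q) becomes c(qQ), since E c(Q) = c(qQ) E. *)
Lemma appliesE R f g : applies R f g -> applies (E R) f (fun n => g n.+1).
Proof.
move=> [B [c [c0 EB Bf]]]; pose s (p : {poly F}) := p \Po (q *: 'X).
have sq p n : (s p).[q ^+ n] = p.[q ^+ n.+1].
  by rewrite horner_comp hornerZ hornerX exprS.
have sS p : tofrac (s p) = sigma (tofrac p) :> ratfun F.
  rewrite dilatationE -[tofrac p]divr1 -tofrac1 dilate_div ?oner_neq0 //.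
  by rewrite comp_polyC tofrac1 divr1.
have s0 : s 0 = 0 by rewrite /s comp_poly0.
exists ('X * map_poly s B), (s c); split; first by apply: comp_qX_neq0.
  apply/polyP => i; rewrite /A_to_Aloc coef_map coefXM coefZ coef_shiftl.
  case: i => [|i] /=; first by rewrite tofrac0 mulr0.
  rewrite coef_map_id0 // sS; have e : tofrac B`_i = tofrac c * R`_i.
    by have /polyP/(_ i) := EB; rewrite /A_to_Aloc coef_map coefZ.
  by rewrite [RHS](_ : _ = sigma (tofrac B`_i)) ?sS // e rmorphM.
move=> n; rewrite sq -Bf; rewrite (@actE (size B).+1); last first.
  rewrite mulrC; apply: leq_trans (size_polyMleq _ _) _.
  by rewrite size_polyX addn2 ltnS size_poly.
rewrite big_ord_recl coefXM horner0 mul0r add0r (@actE (size B)) //.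
apply: eq_bigr => i _; rewrite coefXM /= coef_map_id0 // sq.
by congr (_ * f _); rewrite /bump /= add1n addnS addSn.
Qed.

Definition kills R f := applies R f (fun=> 0).

Lemma killsD R1 R2 f : kills R1 f -> kills R2 f -> kills (R1 + R2) f.
Proof.
by move=> k1 k2; apply: applies_ext (appliesD k1 k2) => n; rewrite addr0.
Qed.

Lemma killsZ a R f : kills R f -> kills (a *: R) f.
Proof.
have [u [v [v0 ->]]] := fracP a; move=> k.
by apply: appliesZ k => // n; rewrite !mulr0.
Qed.

Lemma kills_skewp S R f : kills R f -> kills (skewp sigma S R) f.
Proof.
move=> k; rewrite /skewp; elim/big_rec: _ => [|i T _]; first exact: applies0.
apply: killsD; apply: killsZ; elim: {+}(i : nat) => //= {}i.
exact: appliesE.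
Qed.

Lemma kills_annihilates B f : annihilates q B f -> kills (A_to_Aloc B) f.
Proof.
move=> Bf; exists B, 1; split; rewrite ?oner_neq0 ?tofrac1 ?scale1r // => n.
by rewrite Bf mulr0.
Qed.

(** By definition of [applies], the operators that kill f are the elements of
    the ideal of A_loc generated by the annihilator of f. *)
Lemma kills_annihilator R f : kills R f ->
  exists (B : {poly {poly F}}) (c : {poly F}),
    [/\ c != 0, A_to_Aloc B = tofrac c *: R & annihilates q B f].
Proof.
by move=> [B [c [c0 EB Bf]]]; exists B, c; split=> // n; rewrite Bf mulr0.
Qed.

End Action.

(** * Recognizing characteristic polynomials *)
Section CharPoly.
Variables (F : fieldType) (q : F).
Hypothesis q0 : q != 0.
Local Notation sigma := (dilatation q0).
Implicit Types (R P : {poly ratfun F}) (f : nat -> F).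

(** A_loc is left principal: dividing an element of the ideal by an element P of
    least degree leaves a remainder in the ideal, which must be 0. *)
Lemma is_char_poly_minimal f P : P != 0 -> kills q P f ->
  (forall R, R != 0 -> kills q R f -> (size P <= size R)%N) ->
  is_char_poly q f P.
Proof.
move=> P0 kP minP R; split=> [[s sf ->]|[S ->]].
  set R' := \sum_(x <- s) _.
  have kR' : kills q R' f.
    rewrite /R' big_seq; elim/big_rec: _ => [|x T xs kT]; first exact: applies0.
    apply: killsD kT; rewrite skew_mulE; apply: kills_skewp.
    exact/kills_annihilates/sf.
  have [S [U [ER' ltU]]] := skewp_div sigma R' P0.
  exists S; rewrite skew_mulE ER'; have [->|U0] := eqVneq U 0; first by rewrite addr0.
  suff /(minP _ U0) : kills q U f by rewrite leqNgt ltU.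
  have -> : U = R' + (-1) *: skewp sigma S P by rewrite ER' scaleN1r addrC addKr.
  by apply: killsD kR' _; apply: killsZ; apply: kills_skewp.
have [B [c [c0 EB Bf]]] := kills_annihilator kP.
exists [:: (skewp sigma S (tofrac c)^-1%:P, B)].
  by move=> x; rewrite inE => /eqP->.
rewrite big_seq1 !(skew_mulE q0) /= skewpA skewpCl EB scalerA mulVf ?scale1r //.
by rewrite tofrac_eq0.
Qed.

(** The killing operator R of least degree divides P on the right, so that it is
    a unit or of the degree of P. *)
Lemma minimal_of_irreducible f P : kills q P f -> ~ kills q 1 f ->
  (forall S R, P = skewp sigma S R -> (1 < size R)%N -> (size P <= size R)%N) ->
  forall R, R != 0 -> kills q R f -> (size P <= size R)%N.
Proof.
move=> kP k1 irrP R; have [n] := ubnP (size R); elim: n R => // n IH R leRn R0 kR.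
have [S [U [EP ltU]]] := skewp_div sigma P R0.
have kU : kills q U f.
  have -> : U = P + (-1) *: skewp sigma S R by rewrite EP scaleN1r addrC addKr.
  by apply: killsD kP _; apply: killsZ; apply: kills_skewp.
have [U0|U0] := eqVneq U 0; last first.
  by have := IH U (leq_trans ltU leRn) U0 kU => /leq_trans->//; apply: ltnW.
rewrite U0 addr0 in EP; have [ltR1|gtR1] := leqP (size R) 1; last exact: irrP EP gtR1.
case: k1; have /size_poly1P[c c0 ER] : size R == 1.
  by rewrite eqn_leq ltR1 size_poly_gt0.
have := killsZ c^-1 kR.
by rewrite ER -mul_polyC -polyCM mulVf.
Qed.

(** Two generators divide each other, hence differ by a rational function. *)
Lemma is_char_poly_uniq f P1 P2 : P1 \is monic -> P2 \is monic ->
  is_char_poly q f P1 -> is_char_poly q f P2 -> P1 = P2.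
Proof.
move=> m1 m2 h1 h2; have nz1 := monic_neq0 m1; have nz2 := monic_neq0 m2.
have self (P : {poly ratfun F}) : P = skew_mul q 1 P.
  by rewrite (skew_mulE q0) -polyC1 skewpCl scale1r.
have /h1/h2[S1] : exists S, P1 = skew_mul q S P1 by exists 1; apply: self.
have /h2/h1[S2] : exists S, P2 = skew_mul q S P2 by exists 1; apply: self.
rewrite !(skew_mulE q0) => E2 E1.
have S10 : S1 != 0 by apply: contraNneq nz1 => S10; rewrite E1 S10 skewp0l.
have S20 : S2 != 0 by apply: contraNneq nz2 => S20; rewrite E2 S20 skewp0l.
have sz1 := congr1 (fun P : {poly ratfun F} => size P) E1; rewrite size_skewp // in sz1.
have sz2 := congr1 (fun P : {poly ratfun F} => size P) E2; rewrite size_skewp // in sz2.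
have [g1 g2] : (0 < size S1)%N /\ (0 < size S2)%N by rewrite !size_poly_gt0.
have /size_poly1P[c c0 ES] : size S1 == 1.
  apply/eqP; move: g1 g2 sz1 sz2 => /=.
  by move: (size S1) (size S2) (size P1) (size P2) => *; lia.
rewrite ES skewpCl in E1; suff c1 : c = 1 by rewrite E1 c1 scale1r.
have := congr1 lead_coef E1.
by rewrite lead_coefZ (monicP m1) (monicP m2) mulr1.
Qed.

End CharPoly.

(** * Places and Gauss's lemma for skew polynomials *)

(** [sp x y] is read as: x is finite with value y. Relations are used rather
    than partial functions, so that a specialization given by an explicit form
    of x as a fraction needs no choice of this form. *)
Record ring_relation (K k : fieldType) (sp : K -> k -> Prop) : Prop := RingRelation {
  rel1 : sp 1 1;
  relN1 : sp (-1) (-1);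
  relD : forall x x' y y', sp x y -> sp x' y' -> sp (x + x') (y + y');
  relM : forall x x' y y', sp x y -> sp x' y' -> sp (x * x') (y * y') }.

(** A place with residue field k: the valuation ring is the domain of sp and x
    is infinite when 1/x is in the maximal ideal. *)
Record is_place (K k : fieldType) (sp : K -> k -> Prop) : Prop := IsPlace {
  place_rel : ring_relation sp;
  place_fun : forall x y y', sp x y -> sp x y' -> y = y';
  place_dich : forall x, (exists y, sp x y) \/ sp x^-1 0 }.

Section Relation.
Variables (K k : fieldType) (sp : K -> k -> Prop).
Hypothesis Rsp : ring_relation sp.

Lemma rel0 : sp 0 0.
Proof. by have := relD Rsp (rel1 Rsp) (relN1 Rsp); rewrite !subrr. Qed.

Lemma relN x y : sp x y -> sp (- x) (- y).
Proof. by move=> h; rewrite -mulN1r -[- y]mulN1r; apply: (relM Rsp) (relN1 Rsp) h. Qed.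

Lemma relB x x' y y' : sp x y -> sp x' y' -> sp (x - x') (y - y').
Proof. by move=> h h'; apply: (relD Rsp) h (relN h'). Qed.

Lemma relX n x y : sp x y -> sp (x ^+ n) (y ^+ n).
Proof.
move=> h; elim: n => [|n IH]; first by rewrite !expr0; apply: (rel1 Rsp).
by rewrite !exprS; apply: (relM Rsp).
Qed.

Definition specializes (P : {poly K}) (C : {poly k}) := forall i, sp P`_i C`_i.

Lemma specializes0 : specializes 0 0.
Proof. by move=> i; rewrite !coef0; apply: rel0. Qed.

Lemma specializesD P P' C C' : specializes P C -> specializes P' C' ->
  specializes (P + P') (C + C').
Proof. by move=> h h' i; rewrite !coefD; apply: (relD Rsp). Qed.

Lemma specializesZ a b P C : sp a b -> specializes P C ->
  specializes (a *: P) (b *: C).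
Proof. by move=> h h' i; rewrite !coefZ; apply: (relM Rsp). Qed.

Lemma specializesB P P' C C' : specializes P C -> specializes P' C' ->
  specializes (P - P') (C - C').
Proof. by move=> h h' i; rewrite !coefB; apply: relB. Qed.

Lemma specializesC a b : sp a b -> specializes a%:P b%:P.
Proof. by move=> h i; rewrite !coefC; case: ifP => // _; apply: rel0. Qed.

Lemma specializesXn n : specializes 'X^n 'X^n.
Proof. by move=> i; rewrite !coefXn; case: (_ == _); [apply: (rel1 Rsp) | apply: rel0]. Qed.

Lemma specializesMX P C : specializes P C -> specializes (P * 'X) (C * 'X).
Proof. by move=> h i; rewrite !coefMX; case: i => [|i] //=; apply: rel0. Qed.

Section Shift.
Variables (sigma : {rmorphism K -> K}) (tau : {rmorphism k -> k}).
Hypothesis sigma_sp : forall x y, sp x y -> sp (sigma x) (tau y).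

Lemma specializes_shiftl P C : specializes P C ->
  specializes (shiftl sigma P) (shiftl tau C).
Proof.
by move=> h i; rewrite !coef_shiftl; case: i => [|i] /=; [apply: rel0 | apply: sigma_sp].
Qed.
End Shift.
End Relation.

Section Place.
Variables (K k : fieldType) (sp : K -> k -> Prop).
Hypothesis Psp : is_place sp.
Let Rsp := place_rel Psp.
Local Notation specializes := (specializes sp).

(** An element with nonzero residue is a unit of the valuation ring. *)
Lemma placeV x y : y != 0 -> sp x y -> sp x^-1 y^-1.
Proof.
move=> y0 xy; have x0 : x != 0.
  by apply: contraNneq y0 => x0; rewrite x0 in xy; apply/eqP/(place_fun Psp xy (rel0 Rsp)).
have [[z xz]|] := place_dich Psp x^-1.
  have := relM Rsp xy xz; rewrite divff // => /(place_fun Psp (rel1 Rsp)) E.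
  by rewrite -[y^-1]mulr1 E mulKf.
by rewrite invrK => /(place_fun Psp xy) E; rewrite E eqxx in y0.
Qed.

Lemma specializes_size P C : specializes P C -> (size C <= size P)%N.
Proof.
move=> h; apply/leq_sizeP => j /(nth_default 0) Pj.
by have := h j; rewrite Pj => /(place_fun Psp (rel0 Rsp)).
Qed.

Lemma specializes_fun P C C' : specializes P C -> specializes P C' -> C = C'.
Proof. by move=> h h'; apply/polyP => i; apply: place_fun (h i) (h' i). Qed.

(** Dividing by a coefficient of least valuation makes all the coefficients
    finite and this one equal to 1. The coefficients are treated one by one: if
    the scaled constant coefficient a c is infinite, then scaling by 1/c makes
    the others vanish at the place. *)
Lemma specializes_normalize P : P != 0 -> exists a C,
  [/\ a != 0, C != 0 & specializes (a *: P) C].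
Proof.
elim/poly_ind: P => [|P c IH]; first by rewrite eqxx.
move=> nz; have [P0|P0] := eqVneq P 0.
  rewrite P0 mul0r add0r polyC_eq0 in nz *; exists c^-1, 1.
  split; rewrite ?invr_eq0 ?oner_neq0 // -mul_polyC -polyCM mulVf // -polyC1.
  by apply: (specializesC Rsp); apply: (rel1 Rsp).
have [a [C [a0 C0 aP]]] := IH P0.
have acE b y : specializes (b *: P) y -> forall z, sp (b * c) z ->
    specializes (b *: (P * 'X + c%:P)) (y * 'X + z%:P).
  move=> h z h'; rewrite scalerDr scalerAl -[b *: c%:P]mul_polyC -polyCM.
  apply: (specializesD Rsp) (specializesC Rsp h').
  exact: specializesMX.
have [c0|c0] := eqVneq c 0.
  exists a, (C * 'X + 0%:P); split=> //; first by rewrite addr0 mulf_neq0 ?polyX_eq0.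
  by apply: acE; rewrite ?c0 ?mulr0 //; exact: (rel0 Rsp).
have [[z acz]|acz] := place_dich Psp (a * c).
  exists a, (C * 'X + z%:P); split=> //; last exact: acE.
  by rewrite -lead_coef_eq0 lead_coefDl ?lead_coefMX ?lead_coef_eq0 // size_mulX //
     (leq_ltn_trans (size_polyC_leq1 _)) // ltnS size_poly_gt0.
exists c^-1, (0 * 'X + 1%:P); split; rewrite ?invr_eq0 //.
  by rewrite mul0r add0r oner_neq0.
apply: acE; last by rewrite mulVf //; apply: (rel1 Rsp).
have := specializesZ Rsp acz aP.
by rewrite scale0r scalerA invfM mulrC mulrA mulfV // mul1r.
Qed.

Variable sigma : {rmorphism K -> K}.
Hypothesis sigma_sp : forall x y, sp x y -> sp (sigma x) y.

(** As sigma is trivial on residues, the skew product becomes the commutative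
    one. *)
Lemma specializes_skewp S S1 R R1 : specializes S S1 -> specializes R R1 ->
  specializes (skewp sigma S R) (S1 * R1).
Proof.
move=> hS hR; rewrite (skewp_widen _ _ (leqnn _)).
have le := specializes_size hS.
have -> : S1 * R1 = \sum_(i < size S) S1`_i *: ('X^i * R1).
  rewrite -{1}[S1](coefK) poly_def big_distrl /=.
  under eq_bigr do rewrite -scalerAl.
  rewrite -!(big_mkord xpredT (fun i => S1`_i *: ('X^i * R1))).
  rewrite [RHS](@big_cat_nat _ _ _ (size S1)) //= [X in _ = _ + X]big1_seq ?addr0 //.
  move=> i /andP[_]; rewrite mem_index_iota => /andP[le_Si _].
  by rewrite nth_default // scale0r.
elim/big_rec2: _ => [|i U T _ IH]; first exact: specializes0 Rsp.
apply: (specializesD Rsp) IH; apply: (specializesZ Rsp) => //.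
elim: {+}(i : nat) => [|j IHj] /=; first by rewrite expr0 mul1r.
rewrite exprS -mulrA (_ : 'X * _ = shiftl (idfun : {rmorphism k -> k}) ('X^j * R1)).
  exact: (specializes_shiftl Rsp (tau := idfun)).
by rewrite /shiftl map_poly_id.
Qed.

(** Gauss's lemma. Normalize the left factor and the right factor separately, so
    that both have nonzero reductions; their product then has a nonzero
    reduction S1 R1 and it is b P for some scalar b. Comparison with the
    reduction C of P, also nonzero, shows that b is finite with a nonzero
    residue z, and C is S1 R1 / z. *)
Lemma gauss_skewp P S R C : P = skewp sigma S R -> specializes P C -> C != 0 ->
  exists S1 R1, [/\ C = S1 * R1, (size S1 <= size S)%N & (size R1 <= size R)%N].
Proof.
move=> EP PC C0; have P0 : P != 0.
  apply: contraNneq C0 => P0; rewrite P0 in PC.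
  exact/eqP/(specializes_fun PC (specializes0 Rsp)).
have S0 : S != 0 by apply: contraNneq P0 => S0; rewrite EP S0 skewp0l.
have R0 : R != 0 by apply: contraNneq P0 => R0; rewrite EP R0 skewp0r.
have [a [R1 [a0 R10 aR]]] := specializes_normalize R0.
(* the scalar moved to the left factor acts through the powers of sigma *)
pose S' := skewp sigma S a^-1%:P.
have ca0 : (a^-1)%:P != 0 by rewrite polyC_eq0 invr_eq0.
have szS' : size S' = size S.
  by rewrite size_skewp // size_polyC invr_eq0 a0 addn1.
have S'0 : S' != 0 by rewrite -size_poly_eq0 szS' size_poly_eq0.
have [b [S1 [b0 S10 bS]]] := specializes_normalize S'0.
have EP' : P = skewp sigma S' (a *: R).
  by rewrite /S' skewpA skewpCl scalerA mulVf // scale1r.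
have bP : specializes (b *: P) (S1 * R1).
  by rewrite EP' -skewpZl; apply: specializes_skewp.
have SR0 : S1 * R1 != 0 by rewrite mulf_neq0.
have [[z bz]|bz] := place_dich Psp b; last first.
  have := specializesZ Rsp bz bP; rewrite scalerA mulVf // !scale1r scale0r.
  by move=> /(specializes_fun PC) /eqP; rewrite (negPf C0).
have EC := specializes_fun (specializesZ Rsp bz PC) bP.
have z0 : z != 0 by apply: contraNneq SR0 => z0; rewrite -EC z0 scale0r.
exists (z^-1 *: S1), R1; split.
- by rewrite -scalerAl -EC scalerA mulVf // scale1r.
- by rewrite (leq_trans (size_scale_leq _ _)) // -szS'
    (leq_trans (specializes_size bS)) ?size_scale_leq.
- by rewrite (leq_trans (specializes_size aR)) ?size_scale_leq.
Qed.

End Place.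

(** * Clearing denominators *)
Lemma clear_denominators (R : idomainType) (p : {poly {fraction R}}) :
  exists (c : R) (L : {poly R}), c != 0 /\ map_poly (@tofrac R) L = tofrac c *: p.
Proof.
elim/poly_ind: p => [|p x [c [L [c0 EL]]]].
  by exists 1, 0; rewrite oner_neq0 rmorph0 scaler0.
have [n [d [d0 ->]]] := fracP x; exists (d * c), ((d *: L) * 'X + (c * n)%:P).
rewrite mulf_neq0 //; split=> //.
have : (tofrac d : {fraction R}) != 0 by rewrite tofrac_eq0.
rewrite rmorphD rmorphM /= map_polyX map_polyZ EL map_polyC /= scalerDr.
move=> nz; rewrite !tofracM; congr (_ + _); first by rewrite scalerA -scalerAl.
rewrite -[RHS]mul_polyC -polyCM; congr _%:P; move: (tofrac c) (tofrac n) (tofrac d) nz => c' n' d' d0'.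
rewrite [RHS](_ : _ = c' * (n' / d' * d')); last by rewrite -[LHS]mulrA [LHS]mulrC -[LHS]mulrA.
by rewrite divfK.
Qed.

Lemma map_tofrac_inj (R : idomainType) :
  injective (map_poly (@tofrac R) : {poly R} -> {poly {fraction R}}).
Proof.
move=> p1 p2 /polyP E; apply/polyP => i; have := E i; rewrite !coef_map /=.
by move/eqP; rewrite tofrac_eq => /eqP.
Qed.

(** * The place q = 1 of F(q,Q) *)
Section PlaceAtOne.
Variable F : fieldType.
Local Notation q := (var F).
Implicit Types L n d : {poly {poly F}}.

(** Polynomials in Q over F[q] play the role of local integers: every element of
    F(q)(Q) is a quotient of two of them, and evaluation at q = 1 is defined on
    them. *)
Definition embed L : ratfun (ratfun F) := tofrac (map_poly (@tofrac {poly F}) L).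
Definition at_q1 L : {poly F} := map_poly (horner_eval 1) L.

Lemma embedD L1 L2 : embed (L1 + L2) = embed L1 + embed L2.
Proof. by rewrite /embed rmorphD tofracD. Qed.
Lemma embedM L1 L2 : embed (L1 * L2) = embed L1 * embed L2.
Proof. by rewrite /embed rmorphM tofracM. Qed.
Lemma embed1 : embed 1 = 1.
Proof. by rewrite /embed rmorph1 tofrac1. Qed.
Lemma embedN L : embed (- L) = - embed L.
Proof. by rewrite /embed rmorphN tofracN. Qed.
Lemma embedXn L (n : nat) : embed (L ^+ n) = embed L ^+ n.
Proof. by elim: n => [|n IH]; rewrite ?embed1 // !exprS embedM IH. Qed.
Lemma embed_inj : injective embed.
Proof. by move=> L1 L2 /eqP; rewrite tofrac_eq => /eqP/map_tofrac_inj. Qed.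
Lemma embed0 : embed 0 = 0.
Proof. by rewrite /embed rmorph0 tofrac0. Qed.
Lemma embed_eq0 L : (embed L == 0) = (L == 0).
Proof. by rewrite -embed0 (inj_eq embed_inj). Qed.
Lemma embedX : embed 'X = var (ratfun F).
Proof. by rewrite /embed map_polyX. Qed.
Lemma embedC c : embed c%:P = const (tofrac c).
Proof. by rewrite /embed map_polyC. Qed.

Lemma at_q1D L1 L2 : at_q1 (L1 + L2) = at_q1 L1 + at_q1 L2.
Proof. exact: rmorphD. Qed.
Lemma at_q1M L1 L2 : at_q1 (L1 * L2) = at_q1 L1 * at_q1 L2.
Proof. exact: rmorphM. Qed.
Lemma at_q1_1 : at_q1 1 = 1.
Proof. exact: rmorph1. Qed.
Lemma at_q1N L : at_q1 (- L) = - at_q1 L.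
Proof. exact: rmorphN. Qed.
Lemma at_q1_0 : at_q1 0 = 0.
Proof. exact: rmorph0. Qed.
Lemma at_q1X : at_q1 'X = 'X.
Proof. exact: map_polyX. Qed.
Lemma at_q1C c : at_q1 c%:P = (c.[1])%:P.
Proof. exact: map_polyC. Qed.

Let cancel2 (K : fieldType) (a b x y : K) : a != 0 -> b != 0 -> y != 0 ->
  x / y = (b * (a * x)) / (a * (b * y)).
Proof. by move=> a0 b0 y0; field; rewrite a0 b0 y0. Qed.

Let cancel1 (K : fieldType) (a b x y : K) : a != 0 -> y != 0 ->
  (a * b * x) / (a * y) = (b * x) / y.
Proof. by move=> a0 y0; field; rewrite a0 y0. Qed.

Lemma embed_frac x : exists n d, d != 0 /\ x = embed n / embed d.
Proof.
have [n [d [d0 ->]]] := fracP x.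
have [c1 [L1 [c10 E1]]] := clear_denominators n.
have [c2 [L2 [c20 E2]]] := clear_denominators d.
have nz (c : {poly F}) : c != 0 -> (tofrac c : ratfun F) != 0 by rewrite tofrac_eq0.
have cE (c : {poly F}) L m : map_poly (@tofrac _) L = tofrac c *: m -> c != 0 ->
    embed L = tofrac (tofrac c)%:P * tofrac m.
  by move=> E c0; rewrite /embed E -mul_polyC tofracM.
have nz2 (c : {poly F}) : c != 0 -> tofrac (tofrac c : ratfun F)%:P != 0.
  by move=> c0; rewrite tofrac_eq0 polyC_eq0 nz.
exists (c2%:P * L1), (c1%:P * L2); split.
  rewrite mulf_neq0 ?polyC_eq0 //; apply: contraNneq d0 => L20.
  move: E2; rewrite L20 rmorph0 => /esym/eqP.
  by rewrite scaler_eq0 (negPf (nz _ c20)).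
rewrite !embedM !embedC (cE _ _ _ E1) // (cE _ _ _ E2) // /const.
apply: cancel2 => //; rewrite ?nz2 ?tofrac_eq0 //.
Qed.

Lemma embed_cancel a b u v : embed a != 0 -> embed v != 0 ->
  embed (a * b * u) / embed (a * v) = embed (b * u) / embed v.
Proof.
move=> a0 v0; rewrite (embedM (a * b) u) (embedM a b) (embedM a v) (embedM b u).
by refine (@cancel1 _ (embed a) (embed b) (embed u) (embed v) a0 v0).
Qed.

(** The multiplicity of the factor q - 1 of L; q is made the outer variable for
    the purpose of dividing by q - 1. *)
Lemma at_q1_separated L : L != 0 ->
  exists k L', at_q1 L' != 0 /\ L = ('X - 1)%:P ^+ k * L'.
Proof.
move=> L0; have [m [L1 nr E]] := multiplicity_XsubC (swapXY L) 1%:P.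
move: nr; rewrite swapXY_eq0 L0 /= => nr.
exists m, (swapXY L1); split; last first.
  rewrite -[LHS]swapXYK E rmorphM rmorphXn /= mulrC; congr (_ ^+ _ * _).
  rewrite raddfB /= swapXY_X swapXY_polyC map_polyC.
  rewrite [RHS]polyCB.
  reflexivity.
apply: contraNneq nr => e0; rewrite /root -[L1]swapXYK horner_swapXY.
by rewrite -/(at_q1 _) e0.
Qed.

Definition residue_q1 (x : ratfun (ratfun F)) (y : ratfun F) := exists n d,
  [/\ at_q1 d != 0, x = embed n / embed d & y = tofrac (at_q1 n) / tofrac (at_q1 d)].

Lemma embed_at_q1_neq0 d : at_q1 d != 0 -> embed d != 0.
Proof. by apply: contraNneq => /eqP; rewrite embed_eq0 => /eqP->; rewrite at_q1_0. Qed.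

Lemma residue_embed n : residue_q1 (embed n) (tofrac (at_q1 n)).
Proof.
by exists n, 1; rewrite embed1 at_q1_1 tofrac1 !divr1 oner_neq0.
Qed.

(** This is the place of the valuation attached to the prime q - 1 of F[q,Q];
    its residue field is F(Q). *)
Lemma residue_q1_place : is_place residue_q1.
Proof.
split; first split.
- by have := residue_embed 1; rewrite embed1 at_q1_1 tofrac1.
- by have := residue_embed (- 1); rewrite embedN embed1 at_q1N at_q1_1 tofracN tofrac1.
- move=> _ _ _ _ [n [d [d0 -> ->]]] [n' [d' [d'0 -> ->]]].
  exists (n * d' + n' * d), (d * d'); rewrite at_q1M mulf_neq0 //; split=> //.
    by rewrite addf_div ?embed_at_q1_neq0 // embedD !embedM.
  by rewrite addf_div ?tofrac_eq0 // at_q1D !at_q1M tofracD !tofracM.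
- move=> _ _ _ _ [n [d [d0 -> ->]]] [n' [d' [d'0 -> ->]]].
  exists (n * n'), (d * d'); rewrite at_q1M mulf_neq0 //; split=> //.
    by rewrite mulf_div !embedM.
  by rewrite mulf_div at_q1M !tofracM.
- move=> x _ _ [n [d [d0 -> ->]]] [n' [d' [d'0 E ->]]].
  move/eqP: E; rewrite eqr_div ?embed_at_q1_neq0 // -!embedM => /eqP/embed_inj E.
  apply/eqP; rewrite eqr_div ?tofrac_eq0 //.
  by rewrite -!tofracM -!at_q1M E.
move=> x; have [n [d [d0 ->]]] := embed_frac x.
have [n0|n0] := eqVneq n 0.
  left; exists 0; rewrite n0 embed0 mul0r; have := residue_embed 0.
  by rewrite embed0 at_q1_0 tofrac0.
have [i [n' [n'0 ->]]] := at_q1_separated n0.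
have [j [d' [d'0 ->]]] := at_q1_separated d0.
set pi := ('X - 1)%:P; have pi1 : at_q1 pi = 0.
  by rewrite at_q1C hornerD hornerX hornerN hornerC subrr.
have pi0 : embed pi != 0 by rewrite embed_eq0 polyC_eq0 polyXsubC_eq0.
have pin0 k : embed (pi ^+ k) != 0 by rewrite embedXn expf_neq0.
case: (leqP j i) => [le_ji|lt_ij]; [left|right].
  rewrite -(subnKC le_ji) exprD embed_cancel ?pin0 ?embed_at_q1_neq0 //.
  by eexists; exists (pi ^+ (i - j) * n'), d'; split.
rewrite invf_div -(subnKC (ltnW lt_ij)) exprD embed_cancel ?pin0 ?embed_at_q1_neq0 //.
exists (pi ^+ (j - i) * d'), n'; split=> //; rewrite at_q1M.
have -> : at_q1 (pi ^+ (j - i)) = 0.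
  by rewrite -(subnSK lt_ij) exprS at_q1M pi1 mul0r.
by rewrite mul0r tofrac0 mul0r.
Qed.

Lemma residue_var : residue_q1 (var (ratfun F)) (var F).
Proof. by have := residue_embed 'X; rewrite embedX at_q1X. Qed.

Lemma residue_q : residue_q1 (const q) 1.
Proof. by have := residue_embed 'X%:P; rewrite embedC at_q1C hornerX tofrac1. Qed.

Lemma residue_rel : ring_relation residue_q1.
Proof. exact: place_rel residue_q1_place. Qed.

Lemma residue_qvar : residue_q1 (const q * var (ratfun F)) (var F).
Proof. by rewrite -[var F in X in residue_q1 _ X]mul1r; refine (relM residue_rel residue_q residue_var). Qed.

Section Dilation.
Variable s : {rmorphism ratfun (ratfun F) -> ratfun (ratfun F)}.
Hypothesis s_var : s (var (ratfun F)) = const q * var (ratfun F).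
Hypothesis s_const : forall c, s (const c) = const c.

(** Q |-> qQ is trivial at q = 1. *)
Lemma residue_dilation x y : residue_q1 x y -> residue_q1 (s x) y.
Proof.
have step L : residue_q1 (s (embed L)) (tofrac (at_q1 L)).
  elim/poly_ind: L => [|L c IH].
    by rewrite embed0 (rmorph0 s) at_q1_0 tofrac0; exact: (rel0 residue_rel).
  rewrite embedD embedM embedX embedC (rmorphD s) (rmorphM s) s_var s_const.
  rewrite at_q1D at_q1M at_q1X tofracD tofracM -(embedC c).
  refine (relD residue_rel _ (residue_embed _)).
  refine (relM residue_rel IH _).
  exact residue_qvar.
move=> [n [d [d0 -> ->]]]; rewrite (fmorph_div s).
refine (relM residue_rel (step n) (placeV residue_q1_place _ (step d))).
by rewrite tofrac_eq0.
Qed.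
End Dilation.

Lemma residue_dilate x y : residue_q1 x y -> residue_q1 (dilatation (var_neq0 F) x) y.
Proof.
apply: residue_dilation => [|c]; rewrite dilatationE.
  exact: (dilate_var (var_neq0 F)).
exact: (dilate_const (var_neq0 F)).
Qed.

End PlaceAtOne.

(** * Laurent polynomials and their specialization at q = 1 *)
(** [e] and [e1] are the two ways to read an element of Z[q][Q]: in F(q)(Q), and
    at q = 1 in F(Q). They are kept abstract, with X and t standing for Q and q:
    all that matters is that X and t are inverted and that t becomes 1. *)
Section LocalizedSpecialization.
Variables (R : comNzRingType) (K k : fieldType).
Variables (e : {rmorphism R -> K}) (e1 : {rmorphism R -> k}) (X t : R).
Variables (u v : K) (w : k).
Hypotheses (eX : e X = u) (et : e t = v) (e1X : e1 X = w) (e1t : e1 t = 1).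
Hypotheses (u0 : u != 0) (v0 : v != 0) (w0 : w != 0).

Definition laurent (x : K) (y : k) := exists L (a b : nat),
  x = e L / (u ^+ a * v ^+ b) /\ y = e1 L / w ^+ a.

Lemma laurent_image L : laurent (e L) (e1 L).
Proof. by exists L, 0, 0; rewrite !expr0 mulr1 !divr1. Qed.

Lemma laurent_uV : laurent u^-1 w^-1.
Proof. by exists 1, 1, 0; rewrite !rmorph1 !expr1 expr0 mulr1 !mul1r. Qed.

Lemma laurent_vV : laurent v^-1 1.
Proof. by exists 1, 0, 1; rewrite !rmorph1 !expr1 !expr0 !mul1r invr1. Qed.

Lemma laurent_add x y x' y' : laurent x y -> laurent x' y' ->
  laurent (x + x') (y + y').
Proof.
move=> [L [a [b [-> ->]]]] [L' [a' [b' [-> ->]]]].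
exists (L * (X ^+ a' * t ^+ b') + L' * (X ^+ a * t ^+ b)).
exists (a + a')%N, (b + b')%N.
rewrite !rmorphD !rmorphM !rmorphXn /= eX et e1X e1t !expr1n !exprD !mulr1.
have nz c := expf_neq0 c u0; have nz' c := expf_neq0 c v0.
have nz1 c := expf_neq0 c w0; split.
  move: (u ^+ a) (u ^+ a') (v ^+ b) (v ^+ b') (e L) (e L') (nz a) (nz a') (nz' b) (nz' b').
  by move=> *; field; apply/and4P.
move: (w ^+ a) (w ^+ a') (nz1 a) (nz1 a') => *; field; exact/andP.
Qed.

Lemma laurent_mul x y x' y' : laurent x y -> laurent x' y' ->
  laurent (x * x') (y * y').
Proof.
move=> [L [a [b [-> ->]]]] [L' [a' [b' [-> ->]]]].
exists (L * L'), (a + a')%N, (b + b')%N; rewrite !rmorphM /= !exprD !mulf_div.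
by rewrite [u ^+ a * _ * _]mulrACA.
Qed.

Lemma laurent_rel : ring_relation laurent.
Proof.
split=> [||x x' y y'|x x' y y'].
- by have := laurent_image 1; rewrite !rmorph1.
- by have := laurent_image (-1); rewrite !rmorphN1.
- exact: laurent_add.
exact: laurent_mul.
Qed.

Lemma laurent_morph (s : {rmorphism K -> K}) : s u = v * u ->
  s v = v -> (forall L, laurent (s (e L)) (e1 L)) ->
  forall x y, laurent x y -> laurent (s x) y.
Proof.
move=> su sv sL x y [L [a [b [-> ->]]]]; rewrite fmorph_div rmorphM !rmorphXn su sv /=.
have [L' [a' [b' [-> ->]]]] := sL L.
exists L', (a + a')%N, (b' + (a + b))%N; split.
  by rewrite !exprD exprMn -!mulrA -invfM; congr (_ / _); ring.
by rewrite exprD -mulrA -invfM [w ^+ a' * _]mulrC.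
Qed.

Lemma laurent_place (sp : K -> k -> Prop) : is_place sp ->
  (forall L, sp (e L) (e1 L)) -> forall x y, laurent x y -> sp x y.
Proof.
move=> Psp spe x y [L [a [b [-> ->]]]]; have Rsp := place_rel Psp.
apply: (relM Rsp) (spe L) _; apply: (placeV Psp); first by rewrite expf_neq0.
rewrite -[X in sp _ X]mulr1; apply: (relM Rsp).
  by rewrite -eX -e1X; apply: (relX Rsp).
by rewrite -(expr1n k b) -e1t -et; apply: (relX Rsp).
Qed.

End LocalizedSpecialization.

Section Laurent.
Variable F : fieldType.
Local Notation Kq := (ratfun F).
Local Notation KqQ := (ratfun Kq).
Local Notation qv := (var F).
Implicit Types L : {poly {poly int}}.

Definition ratpoly L : {poly {poly F}} := map_poly (map_poly (intr : int -> F)) L.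
(** The numerators of the two fractions in [laurent_at_q1], over any field F. *)
Definition lembed L : KqQ := tofrac (map_poly (fun c : {poly int} =>
  tofrac (map_poly (fun z => z%:~R : F) c)) L).
Definition lembed1 L : ratfun F :=
  tofrac (map_poly (fun c : {poly int} => (c.[1])%:~R) L).

Lemma lembedE L : lembed L = embed (ratpoly L).
Proof.
rewrite /lembed /embed /ratpoly; congr tofrac; apply/polyP => i.
rewrite !coef_map /= [LHS]coef_map_id0 // map_polyE /= (_ : Poly _ = 0) ?tofrac0 //.
by rewrite polyseq0.
Qed.

Lemma lembed1E L : lembed1 L = tofrac (at_q1 (ratpoly L)).
Proof.
rewrite /lembed1 /at_q1 /ratpoly; congr tofrac; apply/polyP => i.
rewrite !coef_map /= [LHS]coef_map_id0 ?horner0 // /horner_eval.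
by rewrite -[1 in RHS](rmorph1 intr) horner_map.
Qed.

Lemma lembedD L1 L2 : lembed (L1 + L2) = lembed L1 + lembed L2.
Proof. by rewrite !lembedE /ratpoly rmorphD embedD. Qed.
Lemma lembedM L1 L2 : lembed (L1 * L2) = lembed L1 * lembed L2.
Proof. by rewrite !lembedE /ratpoly rmorphM embedM. Qed.
Lemma lembed0 : lembed 0 = 0.
Proof. by rewrite !lembedE /ratpoly rmorph0 embed0. Qed.
Lemma lembedE1 : lembed 1 = 1.
Proof. by rewrite !lembedE /ratpoly rmorph1 embed1. Qed.
Lemma lembedN L : lembed (- L) = - lembed L.
Proof. by rewrite !lembedE /ratpoly rmorphN embedN. Qed.
Lemma lembedX : lembed 'X = var Kq.
Proof. by rewrite !lembedE /ratpoly map_polyX embedX. Qed.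
Lemma lembedq : lembed 'X%:P = const qv.
Proof. by rewrite !lembedE /ratpoly map_polyC /= map_polyX embedC. Qed.

Lemma lembed1D L1 L2 : lembed1 (L1 + L2) = lembed1 L1 + lembed1 L2.
Proof. by rewrite !lembed1E /ratpoly rmorphD at_q1D tofracD. Qed.
Lemma lembed1M L1 L2 : lembed1 (L1 * L2) = lembed1 L1 * lembed1 L2.
Proof. by rewrite !lembed1E /ratpoly rmorphM at_q1M tofracM. Qed.
Lemma lembed10 : lembed1 0 = 0.
Proof. by rewrite !lembed1E /ratpoly rmorph0 at_q1_0 tofrac0. Qed.
Lemma lembed1E1 : lembed1 1 = 1.
Proof. by rewrite !lembed1E /ratpoly rmorph1 at_q1_1 tofrac1. Qed.
Lemma lembed1N L : lembed1 (- L) = - lembed1 L.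
Proof. by rewrite !lembed1E /ratpoly rmorphN at_q1N tofracN. Qed.
Lemma lembed1X : lembed1 'X = var F.
Proof. by rewrite !lembed1E /ratpoly map_polyX at_q1X. Qed.
Lemma lembed1q : lembed1 'X%:P = 1.
Proof. by rewrite !lembed1E /ratpoly map_polyC /= map_polyX at_q1C hornerX tofrac1. Qed.

Lemma lembed_zmod : zmod_morphism lembed.
Proof. by move=> L1 L2; rewrite lembedD lembedN. Qed.
Lemma lembed_monoid : monoid_morphism lembed.
Proof. by split; [apply: lembedE1 | apply: lembedM]. Qed.
HB.instance Definition _ := GRing.isZmodMorphism.Build _ _ lembed lembed_zmod.
HB.instance Definition _ := GRing.isMonoidMorphism.Build _ _ lembed lembed_monoid.

Lemma lembed1_zmod : zmod_morphism lembed1.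
Proof. by move=> L1 L2; rewrite lembed1D lembed1N. Qed.
Lemma lembed1_monoid : monoid_morphism lembed1.
Proof. by split; [apply: lembed1E1 | apply: lembed1M]. Qed.
HB.instance Definition _ := GRing.isZmodMorphism.Build _ _ lembed1 lembed1_zmod.
HB.instance Definition _ := GRing.isMonoidMorphism.Build _ _ lembed1 lembed1_monoid.

Lemma constq_neq0 : const qv != 0.
Proof. by rewrite /const tofrac_eq0 polyC_eq0 var_neq0. Qed.

Definition laurent_q1 : KqQ -> ratfun F -> Prop :=
  laurent lembed lembed1 (var Kq) (const qv) (var F).

(** [laurent_at_q1] over any field F in place of the rational numbers. *)
Definition laurent_fraction (x : KqQ) (y : ratfun F) :=
  exists (L : {poly {poly int}}) (a b : nat),
    x = tofrac (map_poly (fun c : {poly int} =>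
                            tofrac (map_poly (fun z => z%:~R : F) c)) L)
          / (var Kq ^+ a * const qv ^+ b)
    /\ y = tofrac (map_poly (fun c : {poly int} => (c.[1])%:~R) L)
             / var F ^+ a.

Lemma laurent_fractionE x y : laurent_fraction x y <-> laurent_q1 x y.
Proof. by []. Qed.

Lemma laurent_relation : ring_relation laurent_q1.
Proof.
exact (laurent_rel lembedX lembedq lembed1X lembed1q (var_neq0 _) constq_neq0
  (var_neq0 _)).
Qed.

Lemma laurent_lembed L : laurent_q1 (lembed L) (lembed1 L).
Proof. exact (laurent_image _ _ _ _ _ L). Qed.

Lemma laurent_var : laurent_q1 (var Kq) (var F).
Proof. by have := laurent_lembed 'X; rewrite lembedX lembed1X. Qed.
Lemma laurent_q : laurent_q1 (const qv) 1.
Proof. by have := laurent_lembed 'X%:P; rewrite lembedq lembed1q. Qed.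
Lemma laurent_varV : laurent_q1 (var Kq)^-1 (var F)^-1.
Proof. exact (laurent_uV _ _ _ _ _). Qed.
Lemma laurent_qV : laurent_q1 (const qv)^-1 1.
Proof. exact (laurent_vV _ _ _ _ _). Qed.

Lemma residue_lembed L : residue_q1 (lembed L) (lembed1 L).
Proof. by rewrite lembedE lembed1E; apply: residue_embed. Qed.

(** The specialization of a Laurent polynomial is its residue, hence does not
    depend on the way in which it is written as a fraction. *)
Lemma laurent_residue x y : laurent_q1 x y -> residue_q1 x y.
Proof.
exact (laurent_place lembedX lembedq lembed1X lembed1q (var_neq0 _)
  (residue_q1_place F) residue_lembed (x := x) (y := y)).
Qed.

Lemma laurent_qvar : laurent_q1 (const qv * var Kq) (var F).
Proof.
by rewrite -[var F in X in laurent_q1 _ X]mul1r; refine (relM laurent_relation laurent_q laurent_var).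
Qed.

Section Dilation.
Variable s : {rmorphism KqQ -> KqQ}.
Hypothesis s_var : s (var Kq) = const qv * var Kq.
Hypothesis s_const : forall c, s (const c) = const c.

Lemma laurent_dilation x y : laurent_q1 x y -> laurent_q1 (s x) y.
Proof.
have sint (c : {poly int}) : s (lembed c%:P) = lembed c%:P.
  by rewrite lembedE /ratpoly map_polyC /= embedC s_const.
have R := laurent_relation.
have step L : laurent_q1 (s (lembed L)) (lembed1 L).
  elim/poly_ind: L => [|L c IH].
    by rewrite lembed0 (rmorph0 s) lembed10; exact: (rel0 R).
  rewrite (lembedD (L * 'X)) (lembedM L) lembedX (rmorphD s) (rmorphM s) s_var sint.
  rewrite (lembed1D (L * 'X)) (lembed1M L) lembed1X.
  refine (relD R _ (laurent_lembed _)).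
  refine (relM R IH _).
  exact laurent_qvar.
exact (laurent_morph s_var (s_const _) step (x := x) (y := y)).
Qed.
End Dilation.

Lemma laurent_dilate x y : laurent_q1 x y ->
  laurent_q1 (dilatation (var_neq0 F) x) y.
Proof.
apply: laurent_dilation => [|c]; rewrite dilatationE.
  exact: (dilate_var (var_neq0 F)).
exact: (dilate_const (var_neq0 F)).
Qed.
End Laurent.

Lemma laurent_q1E x y : laurent_at_q1 x y -> @laurent_q1 rat x y.
Proof. by move=> h; apply/laurent_fractionE. Qed.

Lemma laurent_at_q1E x y : @laurent_q1 rat x y -> laurent_at_q1 x y.
Proof. by move/laurent_fractionE. Qed.

(** * Masbaum's sums *)
Section Sums.
Variables (F : fieldType) (q : F).
Hypothesis q0 : q != 0.
Hypothesis qnr : forall n, (0 < n)%N -> q ^+ n != 1.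

Definition qfact (m : nat) : F := \prod_(i < m) (1 - q ^+ i.+1).

Lemma qfact_neq0 m : qfact m != 0.
Proof.
by apply/prodf_neq0 => i _; rewrite subr_eq0 eq_sym qnr.
Qed.

Lemma qfactS m : qfact m.+1 = qfact m * (1 - q ^+ m.+1).
Proof. by rewrite /qfact big_ord_recr. Qed.

Definition scaling n : F := (-1) ^+ n.+1 * q ^+ ((n * (n + 3))./2) * qfact n.

Lemma scalingS n : scaling n.+1 = - (q ^+ n.+2 * (1 - q ^+ n.+1)) * scaling n.
Proof.
rewrite /scaling qfactS (_ : (n.+1 * (n.+1 + 3))./2 = n.+2 + (n * (n + 3))./2)%N; last first.
  rewrite (_ : n.+1 * (n.+1 + 3) = n.+2.*2 + n * (n + 3))%N; last by lia.
  by rewrite halfD odd_double doubleK.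
rewrite exprS exprD; ring.
Qed.

Definition weight (p : int) (k : nat) : F :=
  (-1) ^+ k * q ^ (p * (k * k.+1)%:Z) * q ^+ ((k * k.-1)./2).

Lemma weightS p k :
  weight p k.+1 = - (((q ^+ k.+1) ^ p) ^+ 2 * q ^+ k) * weight p k.
Proof.
rewrite /weight (_ : (k.+1 * k.+1.-1)./2 = k + (k * k.-1)./2)%N; last first.
  case: k => // k; rewrite (_ : k.+2 * k.+2.-1 = k.+1.*2 + k.+1 * k.+1.-1)%N; last by rewrite /=; nia.
  by rewrite halfD odd_double doubleK.
rewrite (_ : p * (k.+1 * k.+2)%:Z =
  k.+1%:Z * p + k.+1%:Z * p + p * (k * k.+1)%:Z); last first.
  by rewrite !PoszM -[k.+2]addn2 -[k.+1]addn1 !PoszD; ring.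
rewrite !expfzDr // -!exprz_exp -!exprnP exprS exprD; ring.
Qed.

Definition kernel n k : F := (qfact (n + k).+1 * qfact (n - k))^-1.

(** The kernel is hypergeometric in n and k: both quotients of neighbours are
    rational in q^n and q^k, which is what makes the two relations below
    checkable term by term. *)
Lemma kernel_n n k : (k <= n)%N ->
  kernel n k = kernel n.+1 k * ((1 - q ^+ (n + k).+2) * (1 - q ^+ (n - k).+1)).
Proof.
move=> le_kn; rewrite /kernel subSn // (qfactS (n - k)) addSn (qfactS (n + k).+1).
have := qfact_neq0 (n + k).+1; have := qfact_neq0 (n - k).
have := qnr (ltn0Sn (n + k).+1); have := qnr (ltn0Sn (n - k)).
rewrite ![_ == 1]eq_sym -!(subr_eq0 1) => *; field; exact/and4P.
Qed.

Lemma kernel_k n k : (k < n)%N ->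
  kernel n k.+1 * (1 - q ^+ (n + k).+2) = kernel n k * (1 - q ^+ (n - k)).
Proof.
move=> lt_kn; rewrite /kernel -(subnSK lt_kn) addnS (qfactS (n + k).+1) (qfactS (n - k.+1)).
have := qfact_neq0 (n + k).+1; have := qfact_neq0 (n - k.+1).
have := qnr (ltn0Sn (n + k).+1); have := qnr (ltn0Sn (n - k.+1)).
rewrite ![_ == 1]eq_sym -!(subr_eq0 1) => *; field; exact/and4P.
Qed.

(** x B_j for x = q^k and B_j = (qx)^j - x^-j. As j varies, the sequence B_j
    satisfies the recurrence with characteristic roots qx and 1/x, vanishes at
    j = 0, and B_1 is the factor (q^(2k+1) - 1) / q^k of Masbaum's formula. *)
Definition bterm (j : int) (k : nat) : F :=
  q ^+ k * ((q ^+ k.+1) ^ j - (q ^+ k) ^ (- j)).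

Definition bsum (p j : int) (n : nat) : F :=
  scaling n * \sum_(k < n.+1) weight p k * kernel n k * bterm j k.

Lemma qn0 n : q ^+ n != 0. Proof. by rewrite expf_neq0. Qed.

Lemma bterm_rec j k : bterm (j + 1) k =
  (q ^+ k.+1 + (q ^+ k)^-1) * bterm j k - q * bterm (j - 1) k.
Proof.
rewrite /bterm !opprD opprK !expfzDr ?qn0 // !expr1z !exprN1.
have := qn0 k; have := q0; move: (q ^+ k.+1 ^ j) (q ^+ k ^ (-j)) => u v.
rewrite !exprS; move: (q ^+ k) => x q00 x0.
by field; apply/andP.
Qed.

Lemma btermN j k : bterm (- j) k = - (q ^ (- j)) * bterm j k.
Proof.
rewrite /bterm opprK exprSr !expfzMl.
have e : q ^ (- j) * q ^ j = 1 by rewrite -expfzDr // addNr.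
ring: e.
Qed.

Lemma bterm0 k : bterm 0 k = 0.
Proof. by rewrite /bterm oppr0 !expr0z subrr mulr0. Qed.

Lemma bsum_lin p n (a b c : F) j1 j2 j3 :
  a * bsum p j1 n + b * bsum p j2 n + c * bsum p j3 n = scaling n *
   \sum_(k < n.+1) weight p k * kernel n k *
      (a * bterm j1 k + b * bterm j2 k + c * bterm j3 k).
Proof.
rewrite /bsum !(mulrCA _ (scaling n)) -!mulrDr; congr (_ * _).
rewrite !mulr_sumr -!big_split /=; apply: eq_bigr => k _; ring.
Qed.

Lemma bsum0 p n : bsum p 0 n = 0.
Proof. by rewrite /bsum big1 ?mulr0 // => k _; rewrite bterm0 mulr0. Qed.

(** The parity of B_j makes p and -p symmetric, up to powers of q. *)
Lemma bsumN p j n : bsum p (- j) n = - (q ^ (- j)) * bsum p j n.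
Proof.
rewrite /bsum mulrCA; congr (_ * _); rewrite mulr_sumr.
by apply: eq_bigr => k _; rewrite btermN mulrCA.
Qed.

(** The recurrence of B_j has the coefficient qx + 1/x, which depends on k. It
    exceeds q^(-n-1) + q^(n+2) by a product of two factors that cancel against
    the kernel at n + 1 and leave the kernel at n. *)
Lemma bsum_rec p j n : bsum p (j + 1) n.+1 =
  (q ^- n.+1 + q ^+ n.+2) * bsum p j n.+1 + q * (1 - q ^+ n.+1) * bsum p j n
  - q * bsum p (j - 1) n.+1.
Proof.
suff E : bsum p (j + 1) n.+1 - (q ^- n.+1 + q ^+ n.+2) * bsum p j n.+1
    + q * bsum p (j - 1) n.+1 = q * (1 - q ^+ n.+1) * bsum p j n.
  by rewrite -E; ring.
have -> : bsum p (j + 1) n.+1 = 1 * bsum p (j + 1) n.+1 by rewrite mul1r.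
rewrite -mulNr bsum_lin scalingS.
have comb k : 1 * bterm (j + 1) k - (q ^- n.+1 + q ^+ n.+2) * bterm j k
    + q * bterm (j - 1) k =
    (q ^+ k.+1 + (q ^+ k)^-1 - (q ^- n.+1 + q ^+ n.+2)) * bterm j k.
  by rewrite bterm_rec; ring.
under eq_bigr do rewrite mulNr comb.
rewrite big_ord_recr /= (_ : q ^+ n.+2 + _ - _ = 0) ?mul0r ?mulr0 ?addr0; last by ring.
rewrite /bsum [RHS]mulrCA (mulrC (- _)) -mulrA; congr (_ * _).
rewrite !mulr_sumr; apply: eq_bigr => k _.
have le_kn : (k <= n)%N by rewrite -ltnS.
rewrite (kernel_n le_kn).
have -> : q ^+ (n - k).+1 = q * q ^+ n / q ^+ k.
  by rewrite exprS expfB_cond ?(negPf q0) // mulrA.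
rewrite !exprS exprD; have := qn0 n; have := qn0 k.
move: (bterm j k) (weight p k) (kernel _ k) (q ^+ n) (q ^+ k) => b w K x y y0 x0.
by field; rewrite q0 x0 y0.
Qed.

(** The only relation in which the twist parameter p enters. The terms of this
    combination are differences t(k + 1) - t(k), because the ratio of the
    weights at k + 1 and k is (q^(k+1))^(2p) up to sign and a power of q, which
    turns the part x^-p of B_p into its part (qx)^p at the preceding index. *)
Lemma bsum_relation p n :
  bsum p (p + 1) n - (1 + q ^+ n.+1) * bsum p p n + q ^+ n.+1 * bsum p (p - 1) n = 0.
Proof.
have -> : bsum p (p + 1) n = 1 * bsum p (p + 1) n by rewrite mul1r.
rewrite -mulNr bsum_lin.
pose t k := weight p k * kernel n k * (q ^+ k) ^ (- p) * (1 - q ^+ k)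
  * (1 - q ^+ n.+1 * q ^+ k).
pose t' k := - (weight p k * kernel n k * (q ^+ k.+1) ^ p * (1 - q ^+ k.+1)
  * (q ^+ k - q ^+ n)).
have tS k : (k < n)%N -> t k.+1 = t' k.
  move=> lt_kn; rewrite /t /t' weightS.
  have E := kernel_k lt_kn.
  have u0 : (q ^+ k.+1) ^ p != 0 by rewrite expfz_neq0 ?qn0.
  have -> : q ^+ n.+1 * q ^+ k.+1 = q ^+ (n + k).+2.
    by rewrite -exprD addSn addnS.
  have {}E : kernel n k.+1 * (1 - q ^+ (n + k).+2) = kernel n k * (1 - q ^+ n / q ^+ k).
    by rewrite E expfB_cond ?(negPf q0) // ltnW.
  rewrite -invr_expz.
  transitivity (- (((q ^+ k.+1) ^ p) ^+ 2 * q ^+ k) * weight p k * ((q ^+ k.+1) ^ p)^-1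
    * (1 - q ^+ k.+1) * (kernel n k.+1 * (1 - q ^+ (n + k).+2))); first by ring.
  rewrite E; have := qn0 k; move: u0; move: (q ^+ k.+1 ^ p) (q ^+ k.+1) => u z u0.
  move: (q ^+ k) (q ^+ n) (weight p k) (kernel n k) => x y w K x0.
  by field; apply/andP.
have tE k : weight p k * kernel n k * (1 * bterm (p + 1) k
    + - (1 + q ^+ n.+1) * bterm p k + q ^+ n.+1 * bterm (p - 1) k) = t' k - t k.
  rewrite /t /t' /bterm !opprD opprK !expfzDr ?qn0 // !expr1z !exprN1.
  have := qn0 k; have := q0; move: (q ^+ k.+1 ^ p) (q ^+ k ^ (- p)) => u v.
  rewrite !exprS; move: (weight p k * kernel n k) (q ^+ k) (q ^+ n) => w x y q00 x0.
  by field; apply/andP.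
under eq_bigr do rewrite tE.
suff -> : \sum_(k < n.+1) (t' k - t k) = 0 by rewrite mulr0.
have t'n : t' n = 0 by rewrite /t' subrr mulr0 oppr0.
have t0 : t 0%N = 0 by rewrite /t expr0 subrr mulr0 mul0r.
rewrite sumrB big_ord_recr /= t'n addr0 big_ord_recl /= t0 add0r.
apply/eqP; rewrite subr_eq0; apply/eqP; apply: eq_bigr => k _.
by rewrite /bump /= add1n tS.
Qed.

(** For p < 0 the relation is rewritten, by parity in j, in terms of b_j
    with j > 0. These are the coefficients that it then has at j = |p| + 1 and
    at j = |p| - 1. *)
Definition outer_coef (p : int) (n : nat) : F * F :=
  if 0 < p then (1, q ^+ n.+1) else (q ^+ n, q).

Lemma bsum_relation_abs p n :
  (outer_coef p n).1 * bsum p (`|p|%N%:Z + 1) n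
  - (1 + q ^+ n.+1) * bsum p `|p|%N n
  + (outer_coef p n).2 * bsum p (`|p|%N%:Z - 1) n = 0.
Proof.
have := bsum_relation p n; rewrite /outer_coef.
have [p0 | p0] := ltrP 0 p.
  by rewrite gtz0_abs //= mul1r.
have -> : `|p|%N%:Z = - p by lia.
move=> E; have -> : - p + 1 = - (p - 1) by ring.
have -> : - p - 1 = - (p + 1) by ring.
rewrite !bsumN !opprD opprK !expfzDr // exprN1 expr1z /= -[RHS](mulr0 (- (q ^ (- p)))) -E.
rewrite exprS; have qq := q0; field; exact: q0.
Qed.

(** If b_1 vanishes beyond N, then the support of b_(j+1) ends at N + j exactly,
    as long as b_1(N) is not 0: in the recurrence only the lowering term
    survives there. *)
Lemma bsum_first p N : (forall n, (N < n)%N -> bsum p 1 n = 0) ->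
  forall j, (forall n, (N + j < n)%N -> bsum p (j%:Z + 1) n = 0) /\
    bsum p (j%:Z + 1) (N + j)%N =
      (\prod_(i < j) (q * (1 - q ^+ (N + i).+1))) * bsum p 1 N.
Proof.
move=> fN; suff H j : [/\ (forall n, (N + j < n)%N -> bsum p (j%:Z + 1) n = 0),
    (forall n, (N + j < n.+1)%N -> bsum p j%:Z n = 0) &
    bsum p (j%:Z + 1) (N + j)%N =
      (\prod_(i < j) (q * (1 - q ^+ (N + i).+1))) * bsum p 1 N].
  by move=> j; have [? _ ?] := H j.
elim: j => [|j [IH1 IH2 IH3]].
  split=> [n|n _|]; rewrite ?addn0; [exact: fN | exact: bsum0 |].
  by rewrite big_ord0 mul1r.
have e : j.+1%:Z = j%:Z + 1 by lia.
have e2 : (j%:Z + 1) - 1 = j by ring.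
split=> [[//|n] lt_n|n lt_n|].
- rewrite e bsum_rec e2 IH1 ?IH1 ?IH2 ?mulr0 ?addr0 ?subrr //; lia.
- by rewrite e IH1 //; lia.
rewrite e addnS bsum_rec e2 IH1 ?IH2 ?IH3 ?mulr0 ?subr0 ?add0r; try by lia.
by rewrite big_ord_recr /= mulrA [_ * \prod_(i < _) _]mulrC.
Qed.

Lemma outer_coef1_neq0 p n : (outer_coef p n).1 != 0.
Proof. by rewrite /outer_coef; case: ifP => _ /=; rewrite ?oner_neq0 ?qn0. Qed.

Lemma bsum1_0 p : bsum p 1 0 = 1.
Proof.
rewrite /bsum big_ord1 /scaling /weight /kernel /bterm /= /qfact big_ord1 big_ord0.
have := qnr (ltn0Sn 0); rewrite eq_sym -subr_eq0 expr1 => q1.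
by rewrite !mulr0 !expr0 !expr1z expr1 exprN1 invr1; field.
Qed.

(** If the support of b_1 ended at N, then in the relation between b_(|p|+1),
    b_|p| and b_(|p|-1) at n = N + |p| only the first term would survive, so
    that b_1(N) = 0 too. Descending on N one contradicts b_1(0) = 1. For p = 0
    the support is {0}. *)
Lemma bsum1_not_finite p N : p != 0 -> ~ (forall n, (N <= n)%N -> bsum p 1 n = 0).
Proof.
move=> p0; elim: N => [|N IH] fN.
  by have /eqP := fN 0%N isT; rewrite bsum1_0 oner_eq0.
apply: IH => n; rewrite leq_eqVlt => /predU1P[<-{n}|]; last exact: fN.
have first := bsum_first fN; have [m Em] : exists m, `|p|%N = m.+1.
  by exists `|p|.-1; rewrite prednK // absz_gt0.
have := bsum_relation_abs p (N + m.+1); rewrite Em.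
have [_ ->] := first m.+1.
have -> : bsum p m.+1 (N + m.+1) = 0.
  by have [h _] := first m; rewrite -[RHS](h (N + m.+1)%N) ?addnS //; congr bsum; lia.
have -> : m.+1%:Z - 1 = m by lia.
have -> : bsum p m (N + m.+1) = 0.
  case: m first {Em} => [|m] first; first exact: bsum0.
  have [h _] := first m; rewrite -[RHS](h (N + m.+2)%N) ?addnS ?ltnS ?leqnSn //.
  by congr bsum; lia.
rewrite !mulr0 subr0 addr0 => /eqP; rewrite mulf_eq0 (negPf (outer_coef1_neq0 _ _)).
rewrite /= mulf_eq0 => /orP[/prodf_eq0[i _]|/eqP //].
rewrite mulf_eq0 (negPf q0) subr_eq0 eq_sym /= => qi.
by have := qnr (ltn0Sn (N + i)); rewrite qi.
Qed.

End Sums.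

Lemma JhatE p n : Jhat p n = bsum qv p 1 n.
Proof.
rewrite /Jhat /bsum mulr_sumr; apply: eq_bigr => k _.
rewrite -![qpoch _]/(qfact qv _) /bterm /weight /kernel /scaling !addn1.
rewrite expr1z exprN1 !expfzDr ?(var_neq0 rat) // -!exprnP.
have -> : qv ^+ (2 * k).+1 - 1 = qv ^+ k * (qv ^+ k.+1 - (qv ^+ k)^-1).
  rewrite mulrBr divff ?expf_neq0 ?(var_neq0 rat) // -exprD; congr (_ ^+ _ - _); lia.
rewrite -addSn (exprD (-1)).
move: (qfact qv n) (qfact qv (n.+1 + k) * _)^-1 => c d.
move: (qv ^+ k * (_ - _)) (qv ^+ (n * _)./2) (qv ^+ (k * _)./2) => b u v.
move: (qv ^ (p * _)) ((-1) ^+ n.+1) ((-1) ^+ k) => w s t.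
ring.
Qed.

(** * The recurrence operators *)
(** Everything is done over a field K with an endomorphism sigma and elements q
    and Q with sigma(Q) = q Q, in order to use the same formulas in A_loc and,
    with q = 1 and sigma trivial, in the commutative ring of operators at q = 1. *)
Section Operators.
Variables (K : fieldType) (sigma : {rmorphism K -> K}) (q Q : K).
Local Notation E := (shiftl sigma).

Definition Qn n := q ^+ n * Q.
Definition ycoef k := q ^- k.+1 * Q^-1 + q ^+ k.+2 * Q.
Definition zcoef k := q * (1 - Qn k.+1).

(** The operators V_k and U_k with V_k b_1 = b_(k+1)(n + k) and
    U_k b_1 = b_k(n + k): the recurrence [bsum_rec] solved for its highest index. *)
Fixpoint shift_ops k : {poly K} * {poly K} :=
  if k is k'.+1 then
    let: (V, U) := shift_ops k' in
    (ycoef k' *: E V + zcoef k' *: V - q *: E U, E V)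
  else (1, 0).

(** V_k = c_k E^k + (1 - q^k Q) N_k and U_k = d_k E^k + (1 - q^k Q) M_k, see
    [shift_ops_quotients]: all the coefficients but the top one are divisible by
    1 - q^k Q, because the lowering coefficient [zcoef] is. The quotients and
    the top coefficients are defined by their own recurrences, so that no
    division takes place in A_loc. *)
Fixpoint quotients k : {poly K} * {poly K} :=
  if k is k'.+1 then
    let: (N, M) := quotients k' in
    (ycoef k' *: E N + q *: (shift_ops k').1 - q *: E M, E N)
  else (0, 0).

Fixpoint top_coefs k : K * K :=
  if k is k'.+1 then
    let: (c, d) := top_coefs k' in
    (ycoef k' * sigma c - q * sigma d, sigma c)
  else (1, 0).

(** [outer_coef] and, below, the leading coefficient of the operator, as
    functions of q^m Q. *)
Definition outer (pos : bool) m : K * K :=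
  if pos then (1, q * Qn m) else (Qn m, q).

Definition lead (pos : bool) m : K :=
  if pos then Qn m ^- m else - (q * Qn m) ^+ m.

(** The relation [bsum_relation_abs] for |p| = k + 1, as an operator on b_1. *)
Definition relation_op pos k : {poly K} :=
  (outer pos k.+1).1 *: (shift_ops k.+1).1 - (1 + q * Qn k.+1) *: (shift_ops k.+1).2
  + (outer pos k.+1).2 *: E (shift_ops k).2.

Definition tail_op pos k : {poly K} :=
  (outer pos k.+1).1 *: (quotients k.+1).1 - (1 + q * Qn k.+1) *: (quotients k.+1).2
  + (outer pos k.+1).2 *: E (quotients k).2.

Definition monic_op pos k : {poly K} :=
  'X^(k.+1) + (lead pos k.+1)^-1 *: tail_op pos k.

Hypotheses (q0 : q != 0) (Q0 : Q != 0).
Hypotheses (sq : sigma q = q) (sQ : sigma Q = q * Q).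

Lemma Qn_neq0 n : Qn n != 0. Proof. by rewrite mulf_neq0 ?expf_neq0. Qed.

Lemma sQn n : sigma (Qn n) = Qn n.+1.
Proof. by rewrite /Qn rmorphM rmorphXn sq sQ exprSr mulrA. Qed.

Lemma ycoefE k : ycoef k = q * Qn k.+1 + (Qn k.+1)^-1.
Proof.
by rewrite /ycoef /Qn invfM addrC; congr (_ + _); rewrite exprS mulrA.
Qed.

Lemma lead_neq0 pos m : lead pos m != 0.
Proof.
have X0 := Qn_neq0 m; case: pos; rewrite /lead.
  by rewrite invr_eq0 expf_neq0.
by rewrite oppr_eq0 expf_neq0 // mulf_neq0.
Qed.

Lemma shift_opsS k : shift_ops k.+1 =
  (ycoef k *: E (shift_ops k).1 + zcoef k *: (shift_ops k).1 - q *: E (shift_ops k).2, E (shift_ops k).1).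
Proof. by rewrite /=; case: (shift_ops k). Qed.

Lemma quotientsS k : quotients k.+1 =
  (ycoef k *: E (quotients k).1 + q *: (shift_ops k).1 - q *: E (quotients k).2, E (quotients k).1).
Proof. by rewrite /=; case: (quotients k). Qed.

Lemma top_coefsS k : top_coefs k.+1 =
  (ycoef k * sigma (top_coefs k).1 - q * sigma (top_coefs k).2, sigma (top_coefs k).1).
Proof. by rewrite /=; case: (top_coefs k). Qed.

(** The top coefficients obey the recurrence of B_j with Q in the place of x:
    its characteristic roots are q q^k Q and 1 / (q^k Q). *)
Lemma top_coefs_roots k : (top_coefs k).1 - q * Qn k * (top_coefs k).2 = Qn k ^- k /\
  (top_coefs k).1 - (Qn k)^-1 * (top_coefs k).2 = (q * Qn k) ^+ k.
Proof.
elim: k => [|k [IH1 IH2]].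
  by rewrite /= !mulr0 !subr0 !expr0 invr1.
rewrite top_coefsS ycoefE /=; have := Qn_neq0 k.+1; have := sQn k.
move: (Qn k) (Qn k.+1) IH1 IH2 => X Y IH1 IH2 sX Y0.
have := congr1 sigma IH1; have := congr1 sigma IH2.
rewrite !rmorphB !rmorphM !fmorphV !rmorphXn rmorphM sq sX.
move: (sigma (top_coefs k).1) (sigma (top_coefs k).2) => c d E2 E1; split.
  by rewrite exprS invfM -E1; field.
by rewrite exprS -E2; field.
Qed.

(** The top coefficient of the relation is also divisible by 1 - q^(k+1) Q; the
    cofactor is a monomial, and this is why the monic operator has Laurent
    coefficients. *)
Lemma lead_top_coefs pos k :
  (outer pos k.+1).1 * (top_coefs k.+1).1 - (1 + q * Qn k.+1) * (top_coefs k.+1).2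
  + (outer pos k.+1).2 * sigma (top_coefs k).2 = lead pos k.+1 * (1 - Qn k.+1).
Proof.
have [h1 h2] := top_coefs_roots k.+1; have [g1 g2] := top_coefs_roots k.
rewrite /lead /outer; move: h1 h2; rewrite top_coefsS ycoefE /=.
have := Qn_neq0 k.+1; have := sQn k.
move: (Qn k) (Qn k.+1) g1 g2 => X Y g1 g2 sX Y0.
have := congr1 sigma g1; have := congr1 sigma g2.
rewrite !rmorphB !rmorphM !fmorphV !rmorphXn rmorphM sq sX.
move: (sigma (top_coefs k).1) (sigma (top_coefs k).2) => c d G2 G1 h1 h2.
case: pos; rewrite /=.
  transitivity (Y ^- k.+1 - Y ^- k); first by rewrite -h1 -G1; field.
  by rewrite exprS invfM; field; rewrite expf_neq0.
transitivity (Y * (q * Y) ^+ k.+1 - (q * Y) ^+ k.+1); last by ring.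
by rewrite -{1}h2 exprS -G2; field.
Qed.

Lemma ExpX n : E 'X^n = 'X^(n.+1).
Proof. by rewrite /shiftl map_polyXn exprS. Qed.

Lemma shift_ops_quotients k : (shift_ops k).1 = (top_coefs k).1 *: 'X^k + (1 - Qn k) *: (quotients k).1 /\
  (shift_ops k).2 = (top_coefs k).2 *: 'X^k + (1 - Qn k) *: (quotients k).2.
Proof.
elim: k => [|k [IH1 IH2]].
  by rewrite /= !scaler0 !addr0 expr0 scale1r scale0r.
rewrite shift_opsS quotientsS top_coefsS /=; split; last first.
  by rewrite IH1 shiftlD !shiftlZ ExpX rmorphB rmorph1 sQn.
rewrite {1}IH1 IH2 !shiftlD !shiftlZ ExpX rmorphB rmorph1 sQn /zcoef.
move: (E _) (E _) (shift_ops k).1 (1 - _) => N M V w; rewrite -!mul_polyC !polyCM !polyCB !polyCM.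
ring.
Qed.

Lemma relation_opE pos k : relation_op pos k = (lead pos k.+1 * (1 - Qn k.+1)) *: monic_op pos k.
Proof.
have [h1 h2] := shift_ops_quotients k.+1; have [_ h3] := shift_ops_quotients k.
rewrite /relation_op h1 h2 h3 shiftlD !shiftlZ ExpX rmorphB rmorph1 sQn.
have -> : (lead pos k.+1 * (1 - Qn k.+1)) *: monic_op pos k =
    (lead pos k.+1 * (1 - Qn k.+1)) *: 'X^(k.+1) + (1 - Qn k.+1) *: tail_op pos k.
  by rewrite /monic_op scalerDr scalerA mulrAC mulfV ?lead_neq0 // mul1r.
rewrite -lead_top_coefs.
rewrite /tail_op; move: (outer _ _).1 (outer _ _).2 (top_coefs k.+1) (top_coefs k) => u v cd1 cd2.
move: (quotients k.+1) (E (quotients k).2) (1 - _) => n1 n2 w.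
rewrite -!mul_polyC !(polyCD, polyCM, polyCN); ring.
Qed.

Lemma size_quotients k : (size (quotients k).1 <= k)%N /\ (size (quotients k).2 <= k)%N.
Proof.
have sE (R : {poly K}) n : (size R <= n)%N -> (size (E R) <= n.+1)%N.
  have [->|R0] := eqVneq R 0; first by rewrite shiftl0 size_poly0.
  by rewrite size_shiftl.
have sV j : (size (shift_ops j).1 <= j.+1)%N /\ (size (shift_ops j).2 <= j.+1)%N.
  elim: j => [|j [IH1 IH2]]; first by rewrite /= size_poly1 size_poly0.
  rewrite shift_opsS; split; last exact: sE.
  apply: leq_trans (size_polyD _ _) _; rewrite geq_max size_polyN.
  rewrite !(leq_trans (size_scale_leq _ _)) ?sE ?andbT //.
  apply: leq_trans (size_polyD _ _) _; rewrite geq_max.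
  rewrite !(leq_trans (size_scale_leq _ _)) ?sE //.
  exact: leqW.
elim: k => [|k [IH1 IH2]]; first by rewrite /= size_poly0.
rewrite quotientsS; split; last exact: sE.
apply: leq_trans (size_polyD _ _) _; rewrite geq_max size_polyN.
rewrite !(leq_trans (size_scale_leq _ _)) ?sE ?andbT //.
apply: leq_trans (size_polyD _ _) _; rewrite geq_max.
rewrite !(leq_trans (size_scale_leq _ _)) ?sE //.
by have [] := sV k.
Qed.

Lemma size_tail_op pos k : (size (tail_op pos k) <= k.+1)%N.
Proof.
have [h1 h2] := size_quotients k.+1; have [_ h3] := size_quotients k.
apply: leq_trans (size_polyD _ _) _; rewrite geq_max.
rewrite !(leq_trans (size_scale_leq _ _)) //; last first.
  have [->|R0] := eqVneq (quotients k).2 0; first by rewrite shiftl0 size_poly0.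
  by rewrite size_shiftl.
rewrite andbT; apply: leq_trans (size_polyD _ _) _; rewrite geq_max size_polyN.
by rewrite !(leq_trans (size_scale_leq _ _)).
Qed.

Lemma size_monic_op pos k : size (monic_op pos k) = k.+2.
Proof.
rewrite /monic_op size_polyDl size_polyXn // ltnS.
exact: leq_trans (size_scale_leq _ _) (size_tail_op _ _).
Qed.

Lemma monic_op_monic pos k : monic_op pos k \is monic.
Proof.
rewrite monicE /monic_op lead_coefDl ?lead_coefXn // size_polyXn ltnS.
exact: leq_trans (size_scale_leq _ _) (size_tail_op _ _).
Qed.

End Operators.

(** * The recurrence *)
Section Recurrence.
Variables (F : fieldType) (q : F).
Hypothesis q0 : q != 0.
Hypothesis qnr : forall n, (0 < n)%N -> q ^+ n != 1.
Local Notation sigma := (dilatation q0).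
Local Notation cq := (const q).
Local Notation QQ := (var F).

Lemma constM (a b : F) : const (a * b) = const a * const b.
Proof. by rewrite /const polyCM tofracM. Qed.
Lemma const1 : const (1 : F) = 1.
Proof. by rewrite /const tofrac1. Qed.
Lemma constX (a : F) n : const (a ^+ n) = const a ^+ n.
Proof. by elim: n => [|n IH]; rewrite ?const1 // !exprS constM IH. Qed.
Lemma const_neq0 (a : F) : a != 0 -> const a != 0.
Proof. by rewrite /const tofrac_eq0 polyC_eq0. Qed.
Lemma constV (a : F) : a != 0 -> const a^-1 = (const a)^-1.
Proof.
move=> a0; have ca := const_neq0 a0.
by apply: (mulfI ca); rewrite -constM !mulfV // const1.
Qed.
Let frac_aux (K : fieldType) (a b x : K) : x != 0 ->
  a * x^-1 + b * x = (a + b * x ^+ 2) / x.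
Proof. by move=> x0; field. Qed.

Definition Qpoly n : {poly F} := (q ^+ n)%:P * 'X.

Lemma QnE n : Qn cq QQ n = tofrac (Qpoly n).
Proof. by rewrite /Qn -constX /Qpoly tofracM. Qed.

Lemma Qpoly_at m n : (Qpoly m).[q ^+ n] = q ^+ (n + m).
Proof. by rewrite /Qpoly hornerCM hornerX addnC exprD. Qed.

Lemma ycoef_frac k : ycoef cq QQ k =
  tofrac ((q ^- k.+1)%:P + (q ^+ k.+2)%:P * 'X^2) / tofrac 'X.
Proof.
have e (a b : F) : tofrac (a%:P + b%:P * 'X^2) = const a + const b * QQ ^+ 2.
  by rewrite tofracD tofracM tofracXn.
rewrite /ycoef -!constX -constV ?expf_neq0 // e.
exact (frac_aux _ _ (var_neq0 F)).
Qed.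

Lemma zcoef_frac k : zcoef cq QQ k = tofrac (q%:P * (1 - Qpoly k.+1)).
Proof. by rewrite /zcoef QnE (tofracM q%:P) tofracB tofrac1. Qed.

(** The coefficients that occur are polynomials in Q or such a polynomial
    divided by Q, and Q never vanishes at q^n. *)
Lemma applies_poly (u : {poly F}) R f g g' :
  (forall n, g' n = u.[q ^+ n] * g n) -> applies q R f g ->
  applies q (tofrac u *: R) f g'.
Proof.
move=> eg; rewrite -[tofrac u]divr1 -tofrac1.
by apply: appliesZ => [|n]; rewrite ?oner_neq0 // hornerC mul1r.
Qed.

Section Sequence.
Variable p : int.
Local Notation f := (bsum q p 1).

Lemma applies_shift_ops k :
  applies q (shift_ops sigma cq QQ k).1 f (fun n => bsum q p (k%:Z + 1) (n + k)) /\
  applies q (shift_ops sigma cq QQ k).2 f (fun n => bsum q p k%:Z (n + k)).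
Proof.
elim: k => [|k [IH1 IH2]].
  split; first by apply: applies_ext (applies1 q f) => n; rewrite addn0.
  by apply: applies_ext (applies0 q f) => n /=; rewrite bsum0.
have EV : applies q (shiftl sigma (shift_ops sigma cq QQ k).1) f
    (fun n => bsum q p k.+1%:Z (n + k.+1)).
  apply: applies_ext (appliesE q0 IH1) => n.
  by rewrite addSnnS; congr bsum; lia.
have EU : applies q (shiftl sigma (shift_ops sigma cq QQ k).2) f
    (fun n => bsum q p k%:Z (n + k.+1)).
  by apply: applies_ext (appliesE q0 IH2) => n; rewrite addSnnS.
rewrite shift_opsS; split=> //=.
pose g1 n := (q ^- (n + k).+1 + q ^+ (n + k).+2) * bsum q p k.+1%:Z (n + k.+1).
pose g2 n := q * (1 - q ^+ (n + k).+1) * bsum q p (k%:Z + 1) (n + k).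
pose g3 n := - q * bsum q p k%:Z (n + k.+1).
have A1 : applies q (ycoef cq QQ k *: shiftl sigma (shift_ops sigma cq QQ k).1) f g1.
  rewrite ycoef_frac; apply: appliesZ EV => [|n]; first by rewrite polyX_eq0.
  rewrite hornerX hornerD hornerC hornerCM hornerXn /g1 mulrA; congr (_ * _).
  rewrite -!addnS !exprD; have := expf_neq0 n q0; have := expf_neq0 k.+1 q0.
  move: (q ^+ n) (q ^+ k.+1) (q ^+ k.+2) => x y z y0 x0.
  by field; apply/andP.
have A2 : applies q (zcoef cq QQ k *: (shift_ops sigma cq QQ k).1) f g2.
  rewrite zcoef_frac; apply: applies_poly IH1 => n.
  by rewrite hornerCM hornerD hornerN hornerC Qpoly_at addnS.
have A3 : applies q (- cq *: shiftl sigma (shift_ops sigma cq QQ k).2) f g3.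
  rewrite /const -tofracN; apply: applies_poly EU => n.
  by rewrite hornerN hornerC.
rewrite -scaleNr; apply: applies_ext (appliesD (appliesD A1 A2) A3) => n.
rewrite /g1 /g2 /g3 addnS; have -> : k.+1%:Z = k%:Z + 1 by lia.
rewrite (bsum_rec q0 qnr p (k%:Z + 1)); have -> : k%:Z + 1 - 1 = k by ring.
ring.
Qed.

Lemma kills_monic_op k : `|p|%N = k.+1 -> kills q (monic_op sigma cq QQ (0 < p) k) f.
Proof.
move=> pk; have cq0 := const_neq0 q0; have Q0 := (var_neq0 F).
have sq : sigma cq = cq by rewrite dilatationE dilate_const.
have sQ : sigma QQ = cq * QQ by rewrite dilatationE dilate_var.
have [V1 U1] := applies_shift_ops k.+1; have [_ U2] := applies_shift_ops k.
have outer1 : exists u, (outer cq QQ (0 < p) k.+1).1 = tofrac u /\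
    forall n, u.[q ^+ n] = (outer_coef q p (n + k.+1)).1.
  rewrite /outer /outer_coef; case: ifP => _; last first.
    by exists (Qpoly k.+1); rewrite QnE; split=> // n; rewrite Qpoly_at.
  by exists 1; rewrite tofrac1; split=> // n; rewrite hornerC.
have outer2 : exists u, (outer cq QQ (0 < p) k.+1).2 = tofrac u /\
    forall n, u.[q ^+ n] = (outer_coef q p (n + k.+1)).2.
  rewrite /outer /outer_coef; case: ifP => _; last first.
    by exists q%:P; split=> // n; rewrite hornerC.
  exists (q%:P * Qpoly k.+1); rewrite QnE (tofracM q%:P); split=> // n.
  by rewrite hornerCM Qpoly_at exprS.
have [u1 [E1 ev1]] := outer1; have [u2 [E2 ev2]] := outer2.
have kS : kills q (relation_op sigma cq QQ (0 < p) k) f.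
  pose g1 n := (outer_coef q p (n + k.+1)).1 * bsum q p (k.+1%:Z + 1) (n + k.+1).
  pose g2 n := - (1 + q ^+ (n + k.+1).+1) * bsum q p k.+1%:Z (n + k.+1).
  pose g3 n := (outer_coef q p (n + k.+1)).2 * bsum q p k%:Z (n + k.+1).
  rewrite /relation_op -scaleNr E1 E2.
  have A1 : applies q (tofrac u1 *: (shift_ops sigma cq QQ k.+1).1) f g1.
    by apply: applies_poly V1 => n; rewrite ev1.
  have A2 : applies q (- (1 + cq * Qn cq QQ k.+1) *: (shift_ops sigma cq QQ k.+1).2) f g2.
    have -> : - (1 + cq * Qn cq QQ k.+1) = tofrac (- (1 + q%:P * Qpoly k.+1)).
      by rewrite QnE tofracN tofracD (tofracM q%:P) tofrac1.
    apply: applies_poly U1 => n.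
    by rewrite hornerN hornerD hornerCM hornerC Qpoly_at -exprS.
  have A3 : applies q (tofrac u2 *: shiftl sigma (shift_ops sigma cq QQ k).2) f g3.
    by apply: applies_poly (appliesE q0 U2) => n; rewrite ev2 addSnnS.
  apply: applies_ext (appliesD (appliesD A1 A2) A3) => n.
  have := bsum_relation_abs q0 qnr p (n + k.+1); rewrite pk => <-.
  rewrite /g1 /g2 /g3 mulNr (_ : k.+1%:Z - 1 = k%:Z) //; lia.
have nz : lead cq QQ (0 < p) k.+1 * (1 - Qn cq QQ k.+1) != 0.
  have E : 1 - Qn cq QQ k.+1 = tofrac (1 - Qpoly k.+1) by rewrite QnE tofracB tofrac1.
  refine (mulf_neq0 (lead_neq0 cq0 Q0 _ _) _).
  rewrite E tofrac_eq0 subr_eq0; apply/eqP => /(congr1 (fun P : {poly F} => P`_0)).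
  by rewrite coef1 /Qpoly coefCM coefX mulr0; move/eqP; rewrite oner_eq0.
have := killsZ (lead cq QQ (0 < p) k.+1 * (1 - Qn cq QQ k.+1))^-1 kS.
by rewrite (relation_opE cq0 Q0 sq sQ) scalerA mulVf // scale1r.
Qed.

(** If c(Q) f = 0, then f(n) = 0 unless q^n is one of the finitely many roots of
    c, so that f would have finite support. *)
Lemma not_kills1 : p != 0 -> ~ kills q 1 f.
Proof.
move=> p0 /kills_annihilator[B [c [c0 EB Bf]]].
have cf n : c.[q ^+ n] * f n = 0.
  have EBc : B = c%:P.
    apply/map_tofrac_inj; rewrite [LHS]EB map_polyC /=.
    by rewrite -[1 in LHS]polyC1 -mul_polyC -polyCM mulr1.
  rewrite -[RHS](Bf n) EBc (@actE _ q 1) ?size_polyC_leq1 // big_ord1.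
  by rewrite coefC addn0.
have [N hN] : exists N, forall n, (N <= n)%N -> c.[q ^+ n] != 0.
  have qinj : injective (fun n => q ^+ n).
    have aux a b : (a < b)%N -> q ^+ a != q ^+ b.
      move=> lt; rewrite -(subnKC (ltnW lt)) exprD -[X in X == _]mulr1.
      by rewrite (inj_eq (mulfI (expf_neq0 a q0))) eq_sym qnr // subn_gt0.
    move=> a b /= E; case: (ltngtP a b) => // lt; have := aux _ _ lt;
    by rewrite E eqxx.
  (* the powers of q leave every finite set *)
  have fin (s : seq F) : exists N, forall n, (N <= n)%N -> q ^+ n \notin s.
    elim: s => [|a s [N hN]]; first by exists 0%N.
    have [[m Em]|no] := boolp.pselect (exists m, q ^+ m = a).
      exists (maxn N m.+1) => n; rewrite geq_max => /andP[le1 lt2].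
      rewrite inE negb_or hN // andbT -Em (inj_eq qinj).
      by rewrite neq_ltn lt2 orbT.
    exists N => n le; rewrite inE negb_or hN // andbT; apply/eqP => E.
    by apply: no; exists n.
  (* a finite set that contains the roots of c *)
  have [s hs] : exists s : seq F, forall x, c.[x] = 0 -> x \in s.
    have [m] := ubnP (size c); elim: m c c0 {cf EB} => // m IH c' c'0 le.
    have [[x rx]|no] := boolp.pselect (exists x, root c' x); last first.
      by exists [::] => x cx; case: no; exists x; apply/eqP.
    have /factor_theorem[d Ed] := rx.
    have d0 : d != 0 by apply: contraNneq c'0 => d0; rewrite Ed d0 mul0r.
    have [|s hs] := IH d d0.
      by move: le; rewrite Ed size_Mmonic ?monicXsubC // size_XsubC addn2.
    exists (x :: s) => y; rewrite Ed hornerM hornerXsubC => /eqP.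
    rewrite mulf_eq0 subr_eq0 inE => /orP[/eqP/hs->|->] //; exact: orbT.
  have [N hN] := fin s; exists N => n /hN; apply: contra => /eqP; exact: hs.
apply: (bsum1_not_finite q0 qnr (N := N) p0) => n /hN.
by have /eqP := cf n; rewrite mulf_eq0 => /orP[->|/eqP].
Qed.

End Sequence.
End Recurrence.

(** * An irreducibility criterion *)
(** Polynomials in Q (outer variable) over K[E] (inner variable); [sizeY] is one
    more than the degree in E. *)
Section Content.
Variable K : closedFieldType.
Implicit Types (c : {poly K}) (Phi G H : {poly {poly K}}).

Lemma sizeYM G H : G != 0 -> H != 0 -> sizeY (G * H) = (sizeY G + sizeY H).-1.
Proof.
by move=> G0 H0; rewrite !sizeYE rmorphM size_mul ?swapXY_eq0.
Qed.

Lemma sizeY_XsubC r : sizeY ('X - r%:P%:P : {poly {poly K}}) = 1%N.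
Proof.
have e : swapXY ('X - r%:P%:P) = ('X - r%:P)%:P.
  by rewrite raddfB /= swapXY_X swapXY_polyC map_polyC polyCB.
by rewrite sizeYE e size_polyC -size_poly_eq0 size_XsubC.
Qed.

Lemma XsubCC_neq0 r : 'X - r%:P%:P != 0 :> {poly {poly K}}.
Proof. by rewrite -size_poly_eq0 size_XsubC. Qed.

Lemma divide_content_root r G : G.[r%:P] = 0 -> G != 0 ->
  exists2 G1, G = G1 * ('X - r%:P%:P) & sizeY G1 = sizeY G.
Proof.
move=> /eqP/factor_theorem[G1 E] G0; exists G1 => //.
have G10 : G1 != 0 by apply: contraNneq G0 => G10; rewrite E G10 mul0r.
by rewrite E sizeYM ?XsubCC_neq0 // sizeY_XsubC addn1.
Qed.

(** Gauss's lemma for the content c(E): over a closed field c has a root r, and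
    then E - r divides one of the factors. *)
Lemma gauss_content c Phi G H : c != 0 -> Phi != 0 -> c^:P * Phi = G * H ->
  exists G1 H1, [/\ Phi = G1 * H1, sizeY G1 = sizeY G & sizeY H1 = sizeY H].
Proof.
move=> c0 Phi0; have [n] := ubnP (size c); elim: n c c0 G H => // n IH c c0 G H lec E.
have cP0 : c^:P != 0 by rewrite map_polyC_eq0.
have GH0 : G * H != 0 by rewrite -E mulf_neq0.
have G0 : G != 0 by apply: contraNneq GH0 => ->; rewrite mul0r.
have H0 : H != 0 by apply: contraNneq GH0 => ->; rewrite mulr0.
have [/eqP/size_poly1P[a a0 Ec]|c1] := eqVneq (size c) 1%N.
  exists (a^-1%:P *: G), H; split=> //.
    by rewrite -scalerAl -E Ec map_polyC mul_polyC scalerA /= -polyCM mulVf // scale1r.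
  rewrite -mul_polyC sizeYM //; last by rewrite !polyC_eq0 invr_eq0.
  by rewrite sizeYE swapXY_polyC map_polyC size_polyC polyC_eq0 invr_eq0 a0.
have [r rc] := closed_rootP c c1.
have [c2 Ec] := factor_theorem c r rc.
have c20 : c2 != 0 by apply: contraNneq c0 => c20; rewrite Ec c20 mul0r.
have lt_c2 : (size c2 < n)%N.
  by move: lec; rewrite Ec size_Mmonic ?monicXsubC // size_XsubC addn2.
have EcP : c^:P = c2^:P * ('X - r%:P%:P).
  by rewrite Ec rmorphM rmorphB /= map_polyX map_polyC.
have /eqP : (G * H).[r%:P] = 0 by rewrite -E EcP !hornerM hornerXsubC subrr mulr0 mul0r.
rewrite hornerM mulf_eq0 => /orP[]/eqP.
  move=> /divide_content_root/(_ G0)[G1 EG sG].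
  have [|G2 [H2 [E2 s1 s2]]] := IH c2 c20 G1 H lt_c2.
    by apply: (mulIf (XsubCC_neq0 r)); rewrite mulrAC -EcP E EG mulrAC.
  by exists G2, H2; rewrite s1 sG.
move=> /divide_content_root/(_ H0)[H1 EH sH].
have [|G2 [H2 [E2 s1 s2]]] := IH c2 c20 G H1 lt_c2.
  by apply: (mulIf (XsubCC_neq0 r)); rewrite mulrAC -EcP E EH mulrA.
by exists G2, H2; rewrite s2 sH.
Qed.

Lemma divisor_linear_power (u v : {poly K}) (a l : K) n : l != 0 ->
  u * v = l *: ('X - a%:P) ^+ n -> forall b, u.[b] = 0 -> b = a.
Proof.
move=> l0 E b ub; have := congr1 (horner^~ b) E.
rewrite hornerM ub mul0r hornerZ horner_exp hornerXsubC => /esym/eqP.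
by rewrite mulf_eq0 (negPf l0) expf_eq0 subr_eq0 /= => /andP[_ /eqP].
Qed.

Lemma no_root_size1 (u : {poly K}) : (forall b, u.[b] != 0) -> size u = 1%N.
Proof.
move=> nr; apply/eqP; apply: contraT => /closed_rootP[b]; rewrite /root.
by rewrite (negPf (nr b)).
Qed.

(** The coefficient L(Q) of the top power of E in G divides a power of Q, and
    L(0) is not 0 because G(0) has full degree in E; so L is constant. As the
    leading coefficient of G in Q has full degree in E too, G has degree 0 in Q.
    Then G divides both a power of E and a power of E - a, hence is constant. *)
Lemma full_factor_trivial G H (s i j : nat) (a l l' l'' : K) :
  l != 0 -> l' != 0 -> l'' != 0 -> a != 0 ->
  lead_coef (G * H) = l *: ('X - a%:P) ^+ j ->
  (G * H).[0] = l' *: 'X^i ->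
  lead_coef (swapXY (G * H)) = l'' *: 'X^s ->
  size (lead_coef G) = sizeY G -> size G.[0] = sizeY G -> (sizeY G <= 1)%N.
Proof.
move=> l0 l'0 l''0 a0; rewrite lead_coefM hornerM rmorphM lead_coefM => E1 E2 E3 s1 s2.
have GY0 : (0 < sizeY G)%N.
  rewrite lt0n sizeY_eq0; apply: contra_eq_neq E1 => ->.
  by rewrite lead_coef0 mul0r eq_sym scaler_eq0 (negPf l0) expf_eq0 polyXsubC_eq0 andbF.
pose L := lead_coef (swapXY G).
have LE : L = (swapXY G)`_(sizeY G).-1 by rewrite /L lead_coefE -sizeYE.
have L00 : L.[0] != 0.
  rewrite horner_coef0 LE coef_swapXY -horner_coef0 -s2 -lead_coefE lead_coef_eq0.
  by rewrite -size_poly_gt0 s2.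
have X0 n : 'X^n = ('X - 0%:P) ^+ n :> {poly K} by rewrite subr0.
have Lnr b : L.[b] != 0.
  apply/negP => /eqP Lb; rewrite X0 in E3.
  have b0 := divisor_linear_power l''0 E3 Lb.
  by rewrite b0 in Lb; rewrite Lb eqxx in L00.
have sG : size G = 1%N.
  have h : L`_(size G).-1 != 0.
    rewrite LE coef_swapXY -lead_coefE -s1 -lead_coefE lead_coef_eq0 lead_coef_eq0.
    by rewrite -sizeY_eq0 -lt0n.
  apply/eqP; rewrite eqn_leq size_poly_gt0 -sizeY_eq0 -lt0n GY0 andbT.
  rewrite leqNgt; apply: contra h => lt; rewrite nth_default // (no_root_size1 Lnr).
  by rewrite -ltnS prednK // (leq_trans _ lt).
have /size_poly1P[g g0 EG] : size G == 1%N by rewrite sG.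
move: E1 E2; rewrite {}EG lead_coefC hornerC => E1 E2.
rewrite sizeYE swapXY_polyC size_map_polyC (no_root_size1 (u := g)) // => b.
apply/negP => /eqP gb; rewrite X0 in E2.
have := divisor_linear_power l'0 E2 gb; rewrite (divisor_linear_power l0 E1 gb).
by move/eqP; rewrite (negPf a0).
Qed.

(** Let d be the degree in E. The degrees i and j of the two extreme
    coefficients in Q add up to at least 2d - 1, so at most one of the four
    extreme coefficients of G and H falls short of full degree in E, and one of
    the two factors is full at both ends. The multiplier c allows for factors
    with denominators. *)
Lemma irreducible_criterion c Phi G H (s i j : nat) (a l l' l'' : K) :
  c != 0 -> c^:P * Phi = G * H ->
  l != 0 -> l' != 0 -> l'' != 0 -> a != 0 ->
  lead_coef Phi = l *: ('X - a%:P) ^+ j ->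
  Phi.[0] = l' *: 'X^i ->
  lead_coef (swapXY Phi) = l'' *: 'X^s ->
  ((sizeY Phi).*2 <= i + j + 3)%N ->
  (sizeY G <= 1)%N \/ (sizeY H <= 1)%N.
Proof.
move=> c0 E l0 l'0 l''0 a0 E1 E2 E3 sz.
have Phi0 : Phi != 0.
  apply: contra_eq_neq E1 => ->; rewrite lead_coef0 eq_sym.
  by rewrite scaler_eq0 (negPf l0) expf_eq0 polyXsubC_eq0 andbF.
have [G1 [H1 [EPhi <- <-]]] := gauss_content c0 Phi0 E.
have [G0 H0] : G1 != 0 /\ H1 != 0.
  by apply/andP; rewrite -negb_or -mulf_eq0 -EPhi.
have sPhi : sizeY Phi = (sizeY G1 + sizeY H1).-1 by rewrite EPhi sizeYM.
have [G00 H00] : G1.[0] != 0 /\ H1.[0] != 0.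
  apply/andP; rewrite -negb_or -mulf_eq0 -hornerM -EPhi E2.
  by rewrite scaler_eq0 (negPf l'0) -size_poly_eq0 size_polyXn.
have sl : (size (lead_coef G1) + size (lead_coef H1)).-1 = j.+1.
  by rewrite -size_mul ?lead_coef_eq0 // -lead_coefM -EPhi E1 size_scale // size_exp_XsubC.
have s0 : (size G1.[0] + size H1.[0]).-1 = i.+1.
  by rewrite -size_mul // -hornerM -EPhi E2 size_scale // size_polyXn.
have := max_size_lead_coefXY G1; have := max_size_lead_coefXY H1.
have := max_size_evalC G1 0; have := max_size_evalC H1 0; rewrite polyC0 => b1 b2 b3 b4.
rewrite EPhi in E1 E2 E3.
have [[e1 e2]|[e1 e2]] : (size (lead_coef G1) = sizeY G1 /\ size G1.[0] = sizeY G1) \/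
    (size (lead_coef H1) = sizeY H1 /\ size H1.[0] = sizeY H1).
- move: sl s0 sPhi sz b1 b2 b3 b4; move: (sizeY Phi) (sizeY G1) (sizeY H1).
  move: (size (lead_coef G1)) (size (lead_coef H1)) (size G1.[0]) (size H1.[0]).
  by clear => *; lia.
- by left; apply: full_factor_trivial l0 l'0 l''0 a0 E1 E2 E3 e1 e2.
right; rewrite mulrC in E1 E2 E3.
exact: full_factor_trivial l0 l'0 l''0 a0 E1 E2 E3 e1 e2.
Qed.

End Content.

(** * The operators at q = 1 *)
Section Classical.
Variables (k : fieldType) (Q : k).
Hypotheses (Q0 : Q != 0) (Q1 : 1 - Q != 0).
Local Notation id1 := (idfun : {rmorphism k -> k}).

Definition Cpol pos m : {poly k} := monic_op id1 1 Q pos m.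
Local Arguments shift_ops : simpl never.
Local Notation shift_ops1 := (shift_ops id1 1 Q).
Local Notation S1 pos m := (relation_op id1 1 Q pos m).

Lemma Qn1 n : Qn 1 Q n = Q. Proof. by rewrite /Qn expr1n mul1r. Qed.

Lemma shift_id (R : {poly k}) : shiftl id1 R = 'X * R.
Proof. by rewrite /shiftl map_poly_id. Qed.

Definition char_sum : {poly k} := (Q - Q ^+ 2)%:P + 'X + (Q ^+ 2)%:P * 'X.

Let QV := (Q^-1)%:P.

Lemma QVK : Q%:P * QV = 1 :> {poly k}. Proof. by rewrite -polyCM divff. Qed.

Lemma shift_ops1_0 : shift_ops1 0 = (1, 0). Proof. by []. Qed.

Lemma char_sumE : QV * char_sum = (ycoef 1 Q 0)%:P * 'X + (1 - Q)%:P.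
Proof.
rewrite /char_sum /ycoef !expr1n invr1 !mul1r !(polyC_exp, polyCD, polyCN) -!/QV.
 have e := QVK; ring: e.
Qed.

(** At q = 1 the coefficients of the recurrence no longer depend on k, and E
    commutes with them. *)
Lemma shift_ops1S m : shift_ops1 m.+1 =
  (QV * char_sum * (shift_ops1 m).1 - 'X * (shift_ops1 m).2, 'X * (shift_ops1 m).1).
Proof.
rewrite shift_opsS !shift_id char_sumE /zcoef Qn1 mul1r -!mul_polyC polyC1.
have -> : ycoef 1 Q m = ycoef 1 Q 0 by rewrite /ycoef !expr1n.
by congr pair; ring.
Qed.

(** The relation is a combination of V_k and U_k with coefficients that do not
    depend on k any more, so it inherits their recurrence. *)
Lemma relation_op1_rec pos m : S1 pos m.+2 = QV * char_sum * S1 pos m.+1 - 'X^2 * S1 pos m.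
Proof.
rewrite /relation_op !Qn1 /outer; case: pos; rewrite /= ?Qn1 -!mul_polyC !shift_id !shift_ops1S /=;
  by rewrite ?shift_ops1S /=; ring.
Qed.

Lemma relation_op1E pos m : S1 pos m = (lead 1 Q pos m.+1 * (1 - Q)) *: Cpol pos m.
Proof.
have := @relation_opE k id1 1 Q (oner_neq0 _) Q0 (erefl _) _ pos m; rewrite Qn1; apply.
by rewrite mul1r.
Qed.

Lemma lead1E pos m : lead 1 Q pos m = if pos then Q ^- m else - Q ^+ m.
Proof. by rewrite /lead Qn1 mul1r. Qed.

Lemma lead1_neq0 pos m : lead 1 Q pos m * (1 - Q) != 0.
Proof.
by rewrite mulf_neq0 // lead1E; case: pos; rewrite ?oppr_eq0 ?invr_eq0 expf_neq0.
Qed.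

Lemma CpolE pos m : Cpol pos m = (lead 1 Q pos m.+1 * (1 - Q))^-1 *: S1 pos m.
Proof. by rewrite relation_op1E scalerA mulVf ?lead1_neq0 // scale1r. Qed.

(** The monic normalization divides by [lead], which changes by a factor Q^-1 or
    Q from one order to the next. *)
Lemma Cpol_rec_pos m :
  Cpol true m.+2 = char_sum * Cpol true m.+1 - (Q ^+ 2)%:P * 'X^2 * Cpol true m.
Proof.
rewrite !CpolE relation_op1_rec !lead1E; set s2 := S1 _ _; set s1 := S1 _ _.
have -> : (Q ^- m.+3 * (1 - Q))^-1 = Q ^+ 2 * (Q ^- m.+1 * (1 - Q))^-1.
  by rewrite !exprS; field; rewrite !(oppr_eq0, mulf_eq0, expf_eq0, negPf Q0, negPf Q1, andbF).
have -> : (Q ^- m.+2 * (1 - Q))^-1 = Q * (Q ^- m.+1 * (1 - Q))^-1.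
  by rewrite !exprS; field; rewrite !(oppr_eq0, mulf_eq0, expf_eq0, negPf Q0, negPf Q1, andbF).
move: (_^-1) => c; rewrite -!mul_polyC (polyCM (Q ^+ 2)) !polyC_exp (polyCM Q).
have e := QVK; ring: e.
Qed.

Lemma Cpol_rec_neg m :
  Cpol false m.+2 = char_sum * (Q ^- 2)%:P * Cpol false m.+1
                    - 'X^2 * (Q ^- 2)%:P * Cpol false m.
Proof.
rewrite !CpolE relation_op1_rec !lead1E; set s2 := S1 _ _; set s1 := S1 _ _.
have -> : (- Q ^+ m.+3 * (1 - Q))^-1 = Q^-1 ^+ 2 * (- Q ^+ m.+1 * (1 - Q))^-1.
  by rewrite !exprS; field; rewrite !(oppr_eq0, mulf_eq0, expf_eq0, negPf Q0, negPf Q1, andbF).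
have -> : (- Q ^+ m.+2 * (1 - Q))^-1 = Q^-1 * (- Q ^+ m.+1 * (1 - Q))^-1.
  by rewrite !exprS; field; rewrite !(oppr_eq0, mulf_eq0, expf_eq0, negPf Q0, negPf Q1, andbF).
rewrite -exprVn; move: (_ * (1 - Q))^-1 => c; rewrite -!mul_polyC (polyCM (Q^-1 ^+ 2)) !polyC_exp (polyCM Q^-1) -/QV.
ring.
Qed.

Lemma Cpol_pos0 : Cpol true 0 = Q%:P + 'X.
Proof.
rewrite CpolE lead1E /relation_op /outer !shift_ops1S shift_ops1_0 /= !Qn1 !shift_id -!mul_polyC.
rewrite !(mulr0, mulr1, subr0, addr0, mul1r, polyC1, expr1).
apply: (mulfI (x := (Q^-1 * (1 - Q))%:P)); first by rewrite polyC_eq0 mulf_neq0 ?invr_eq0.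
rewrite mulrA -polyCM mulfV ?mulf_neq0 ?invr_eq0 // polyC1 mul1r.
rewrite /char_sum !(polyC_exp, polyCD, polyCN) (polyCM Q^-1) polyCB polyC1 -!/QV.
have e := QVK; ring: e.
Qed.

Lemma Cpol_neg0 : Cpol false 0 = -1 + 'X.
Proof.
rewrite CpolE lead1E /relation_op /outer !shift_ops1S shift_ops1_0 /= !Qn1 !shift_id -!mul_polyC.
rewrite !(mulr0, mulr1, subr0, addr0, mul1r, polyC1, expr1).
apply: (mulfI (x := (- Q * (1 - Q))%:P)); first by rewrite polyC_eq0 mulf_neq0 ?oppr_eq0.
rewrite mulrA -polyCM mulfV ?mulf_neq0 ?oppr_eq0 // polyC1 mul1r.
rewrite /char_sum !(polyC_exp, polyCD, polyCN) (polyCM (- Q)) polyCB polyCN polyC1.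
have e := QVK; ring: e.
Qed.

Lemma Cpol_pos1 : Cpol true 1 = char_sum * Cpol true 0 - (Q ^+ 2)%:P * 'X^2.
Proof.
rewrite !CpolE !lead1E; have Eb : S1 true 1 = QV * char_sum * S1 true 0 - 'X^2 * (1 - Q)%:P.
  rewrite /relation_op /outer !shift_ops1S shift_ops1_0 /= !Qn1 !shift_id -!mul_polyC.
  rewrite !(mulr0, mulr1, subr0, addr0, mul1r, polyC1, expr1) polyCB polyCD polyC1.
  ring.
rewrite Eb; set s1 := S1 _ _.
have -> : (Q ^- 2 * (1 - Q))^-1 = Q * (Q ^- 1 * (1 - Q))^-1.
  by field; rewrite Q0 Q1.
have e1 : Q ^+ 2 = Q * (Q ^- 1 * (1 - Q))^-1 * (1 - Q).
  by field; rewrite Q0 Q1.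
rewrite [in RHS]e1; move: (_ * (1 - Q))^-1 => c; rewrite -!mul_polyC.
rewrite (polyCM (Q * c)) (polyCM Q); have e := QVK; ring: e.
Qed.

Lemma Cpol_neg1 :
  Cpol false 1 = char_sum * (Q ^- 2)%:P * Cpol false 0 - 'X^2 * (Q ^- 2)%:P.
Proof.
have -> : char_sum * (Q ^- 2)%:P * Cpol false 0 - 'X^2 * (Q ^- 2)%:P =
  (Q ^- 2)%:P * (char_sum * Cpol false 0 - 'X^2).
  by rewrite mulrBr mulrA [_ * char_sum]mulrC ['X^2 * _]mulrC.
rewrite !CpolE !lead1E; have Eb : S1 false 1 = QV * char_sum * S1 false 0 + 'X^2 * (1 - Q)%:P.
  rewrite /relation_op /outer !shift_ops1S shift_ops1_0 /= !Qn1 !shift_id -!mul_polyC.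
  rewrite !(mulr0, mulr1, subr0, addr0, mul1r, polyC1, expr1) polyCB polyCD polyC1.
  ring.
rewrite Eb; set s1 := S1 _ _.
have -> : (- Q ^+ 2 * (1 - Q))^-1 = Q^-1 * (- Q ^+ 1 * (1 - Q))^-1.
  by field; rewrite !(oppr_eq0, mulf_eq0, expf_eq0, negPf Q0, negPf Q1, andbF).
have e1 : Q ^- 2 = - (Q^-1 * (- Q ^+ 1 * (1 - Q))^-1 * (1 - Q)).
  by field; rewrite !(oppr_eq0, mulf_eq0, expf_eq0, negPf Q0, negPf Q1, andbF).
have e2 : Q ^- 2 = Q^-1 * Q^-1 by rewrite -exprVn expr2.
rewrite [RHS]mulrBr [in X in _ = _ - X]e1 e2; move: (_ * (1 - Q))^-1 => c; rewrite -!mul_polyC.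
rewrite polyCN (polyCM (_ * c)) !(polyCM Q^-1) -/QV; ring.
Qed.
End Classical.

(** * The numerators of the C-polynomials *)
Section Numerator.
Variable R : fieldType.
Local Notation "''Y'" := ('X%:P) : ring_scope.

(** [Cpol] without its denominator, a power of Q, and with Q as the outer
    variable, so that its coefficients in Q can be read off. [trace_poly] is the
    factor of the middle term in the recurrence of the theorem. *)
Definition trace_poly : {poly {poly R}} := ('X - 1)%:P * 'X^2 + 'X + 'Y.

Definition Phi_step (u : {poly {poly R}} * {poly {poly R}}) :=
  (u.2, trace_poly * u.2 - 'X^2 * 'Y ^+ 2 * u.1).

(** For p < 0 the recurrence is cleared of its factors Q^-2 by scaling with
    Q^(2m); the constant C_0 then has the scale Q^-2, which cancels the X^2 of
    the first step. *)
Definition Phi_start (pos : bool) : {poly {poly R}} * {poly {poly R}} :=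
  if pos then ('X + 'Y, trace_poly * ('X + 'Y) - 'X^2 * 'Y ^+ 2)
  else (('X - 1)%:P, trace_poly * ('X - 1)%:P - 'Y ^+ 2).

Definition Phi pos m := (iter m Phi_step (Phi_start pos)).1.

Lemma Phi0 pos : Phi pos 0 = (Phi_start pos).1. Proof. by []. Qed.
Lemma Phi1 pos : Phi pos 1 = (Phi_start pos).2. Proof. by []. Qed.
Lemma PhiSS pos m :
  Phi pos m.+2 = trace_poly * Phi pos m.+1 - 'X^2 * 'Y ^+ 2 * Phi pos m.
Proof. by []. Qed.

Lemma nat_ind2 (P : nat -> Prop) : P 0%N -> P 1%N ->
  (forall m, P m -> P m.+1 -> P m.+2) -> forall m, P m.
Proof.
move=> P0 P1 PS m; suff [] : P m /\ P m.+1 by [].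
by elim: m => // m [IH1 IH2]; split=> //; apply: PS.
Qed.

Lemma Y1_neq0 : ('X - 1)%:P != 0 :> {poly {poly R}}.
Proof. by rewrite polyC_eq0 polyXsubC_eq0. Qed.

Lemma size_trace : size trace_poly = 3 /\ lead_coef trace_poly = 'X - 1.
Proof.
have c1 : 'X - 1 != 0 :> {poly R} by rewrite polyXsubC_eq0.
have s1 : size (('X - 1)%:P * 'X^2 : {poly {poly R}}) = 3.
  by rewrite mul_polyC size_scale // size_polyXn.
have lt : (size ('X + 'Y : {poly {poly R}})%R < size (('X - 1)%:P * 'X^2 : {poly {poly R}})%R)%N.
  by rewrite s1 size_XaddC.
rewrite /trace_poly -addrA; split; first by rewrite size_polyDl // s1.
by rewrite lead_coefDl // mul_polyC lead_coefZ lead_coefXn mulr1.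
Qed.

Lemma size_step (B D : {poly {poly R}}) : B != 0 ->
  (size D < (size B).+2)%N ->
  size (trace_poly * B - D) = (size B).+2 /\
  lead_coef (trace_poly * B - D) = ('X - 1) * lead_coef B.
Proof.
move=> B0 lt; have [s l] := size_trace.
have T0 : trace_poly != 0 by rewrite -size_poly_eq0 s.
have sTB : size (trace_poly * B) = (size B).+2 by rewrite size_mul // s.
have lt' : (size (- D)%R < size (trace_poly * B)%R)%N by rewrite size_polyN sTB.
by rewrite size_polyDl // lead_coefDl // sTB lead_coefM l.
Qed.

Lemma size_X2Y2 (A : {poly {poly R}}) : size ('X^2 * 'Y ^+ 2 * A) = if A == 0 then 0%N else (size A).+2.
Proof.
have [->|A0] := eqVneq A 0; first by rewrite mulr0 size_poly0.
rewrite mulrAC -polyC_exp mulrC mul_polyC size_scale; last first.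
  by rewrite -size_poly_eq0 size_polyXn.
by rewrite mulrC size_mulXn.
Qed.

Lemma lead_Phi_aux pos m :
  [/\ lead_coef (Phi pos m) = ('X - 1) ^+ (if pos then m else m.+1),
    lead_coef (Phi pos m.+1) = ('X - 1) ^+ (if pos then m.+1 else m.+2)
    & (size (Phi pos m) < size (Phi pos m.+1))%N].
Proof.
elim: m => [|m [IH1 IH2 IHs]]; last first.
  have B0 : Phi pos m.+1 != 0.
    by rewrite -size_poly_gt0 (leq_ltn_trans _ IHs).
  have [|E1 E2] := @size_step (Phi pos m.+1) ('X^2 * 'Y ^+ 2 * Phi pos m) B0.
    by rewrite size_X2Y2; case: ifP.
  by rewrite PhiSS; split=> //; rewrite ?E1 // E2 IH2 -exprS; case: (pos).
have sX1 : size ('X - 1 : {poly R}) = 2 by rewrite -polyC1 size_XsubC.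
case: pos; rewrite Phi0 Phi1 /=.
  have lXY : lead_coef ('X + 'Y : {poly {poly R}}) = 1.
    by rewrite lead_coefDl ?lead_coefX // size_polyX (leq_ltn_trans (size_polyC_leq1 _)).
  have XY0 : 'X + 'Y != 0 :> {poly {poly R}} by rewrite -size_poly_eq0 size_XaddC.
  have [|E1 E2] := @size_step ('X + 'Y) ('X^2 * 'Y ^+ 2) XY0.
    by rewrite -['X^2 * _]mulr1 size_X2Y2 oner_eq0 size_poly1 size_XaddC.
  by rewrite E1 E2 lXY size_XaddC mulr1.
have [|E1 E2] := @size_step ('X - 1)%:P ('Y ^+ 2) Y1_neq0.
  by rewrite -polyC_exp (leq_ltn_trans (size_polyC_leq1 _)).
by rewrite E1 E2 lead_coefC expr1 size_polyC expr2.
Qed.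

Lemma lead_Phi pos m :
  lead_coef (Phi pos m) = ('X - 1) ^+ (if pos then m else m.+1).
Proof. by have [] := lead_Phi_aux pos m. Qed.

Lemma Phi_at0 pos m :
  (Phi pos m.+1).[0] = (if pos then 'X else -1) * 'X^(m.+1).
Proof.
pose hE := (hornerD, hornerN, hornerM, hornerXn, hornerX, hornerC, horner_exp).
have T0 : trace_poly.[0] = 'X by rewrite /trace_poly !hE; ring.
elim/nat_ind2: m => [||m _ IH].
- by case: pos; rewrite Phi1 /= !hE ?T0; ring.
- case: pos; rewrite PhiSS Phi1 Phi0 /= !hE ?T0; ring.
rewrite PhiSS hornerD hornerN (hornerM trace_poly) T0 IH (hornerM _ (Phi pos m.+1)).
by rewrite (hornerM 'X^2) hornerXn expr0n !mul0r subr0 [in RHS]exprS mulrCA.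
Qed.

(** At Q = 1 the characteristic equation of the recurrence has the double root
    E. *)
Lemma Phi_at1 pos m : (Phi pos m).[1] =
  'X^(m.+1) + (if pos then m.+1%:R else - m.+1%:R) * 'X^m.
Proof.
pose hE := (hornerD, hornerN, hornerM, hornerXn, hornerX, hornerC, horner_exp).
have T1 : trace_poly.[1] = 'X + 'X by rewrite /trace_poly !hE; ring.
elim/nat_ind2: m => [||m IH1 IH2].
- by case: pos; rewrite Phi0 /= !hE ?expr1 expr0 mulr1n; ring.
- by case: pos; rewrite Phi1 /= !hE ?T1; ring.
rewrite PhiSS hornerD hornerN (hornerM trace_poly) T1 IH2 (hornerM _ (Phi pos m)) IH1.
rewrite (hornerM 'X^2) hornerXn expr1n -polyC_exp hornerC !exprS.
have -> : m.+3%:R = m%:R + 3%:R :> {poly R} by rewrite -natrD addn3.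
have -> : m.+2%:R = m%:R + 2%:R :> {poly R} by rewrite -natrD addn2.
have -> : m.+1%:R = m%:R + 1 :> {poly R} by rewrite -natr1.
by case: pos IH1 IH2 => _ _; ring.
Qed.

End Numerator.

Lemma Phi_map (R S : fieldType) (f : {rmorphism R -> S}) pos m :
  map_poly (map_poly f) (Phi R pos m) = Phi S pos m.
Proof.
pose g : {rmorphism {poly {poly R}} -> {poly {poly S}}} := map_poly (map_poly f).
rewrite -[LHS]/(g _).
have gX : g 'X = 'X by apply: map_polyX.
have gY : g 'X%:P = 'X%:P by rewrite [LHS]map_polyC /= map_polyX.
have gY1 : g ('X - 1)%:P = ('X - 1)%:P.
  by rewrite [LHS]map_polyC /= rmorphB rmorph1 /= map_polyX.
clearbody g; have T : g (trace_poly R) = trace_poly S.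
  by rewrite /trace_poly (rmorphD g) (rmorphD g) (rmorphM g) (rmorphXn g) gX gY gY1.
elim/nat_ind2: m => [||m IH1 IH2].
- by case: pos; rewrite !Phi0 /= ?gY1 // (rmorphD g) gX gY.
- case: pos; rewrite !Phi1 /= (rmorphB g) (rmorphM g (trace_poly R)) T.
    by rewrite (rmorphM g 'X^2) !(rmorphXn g) (rmorphD g) gX gY.
  by rewrite (rmorphXn g) gY gY1.
rewrite !PhiSS -IH1 -IH2 (rmorphB g) (rmorphM g (trace_poly R)) T.
by rewrite (rmorphM g _ (Phi R pos m)) (rmorphM g 'X^2) !(rmorphXn g) gX gY.
Qed.

Definition denom_exp (pos : bool) m := if pos then 0%N else m.*2.

Section PhiCpol.
Variables (R k : fieldType) (Q : k) (g : {rmorphism {poly {poly R}} -> {poly k}}).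
Hypotheses (Q0 : Q != 0) (Q1 : 1 - Q != 0) (gX : g 'X = Q%:P) (gY : g 'X%:P = 'X).

Lemma Phi_Cpol_morph pos m :
  g (Phi R pos m) = (Q ^+ denom_exp pos m) *: Cpol Q pos m.
Proof.
have gY1 : g ('X - 1)%:P = 'X - 1 by rewrite polyCB rmorphB gY polyC1 rmorph1.
have T : g (trace_poly R) = char_sum Q.
  rewrite /trace_poly rmorphD rmorphD rmorphM rmorphXn gX gY gY1.
  by rewrite /char_sum polyCB !polyC_exp; ring.
elim/nat_ind2: m => [||m IH1 IH2].
- case: pos; rewrite Phi0 /= expr0 scale1r.
    by rewrite Cpol_pos0 // rmorphD gX gY.
  by rewrite Cpol_neg0 // gY1 addrC.
- case: pos; rewrite Phi1 /= rmorphB (rmorphM g (trace_poly R)) T.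
    rewrite expr0 scale1r Cpol_pos1 // Cpol_pos0 //.
    by rewrite (rmorphM g 'X^2) !(rmorphXn g) (rmorphD g) gX gY polyC_exp.
  rewrite Cpol_neg1 // Cpol_neg0 // (rmorphXn g) gY gY1.
  have -> : char_sum Q * (Q ^- 2)%:P * (-1 + 'X) - 'X^2 * (Q ^- 2)%:P =
    (Q ^- 2)%:P * (char_sum Q * ('X - 1) - 'X^2) by ring.
  by rewrite mul_polyC scalerA mulfV ?expf_neq0 // scale1r.
rewrite PhiSS rmorphB (rmorphM g (trace_poly R)) T.
rewrite (rmorphM g _ (Phi R pos m)) (rmorphM g 'X^2) !(rmorphXn g) gX gY IH1 IH2.
case: pos {IH1 IH2} => /=.
  by rewrite !expr0 !scale1r Cpol_rec_pos // polyC_exp.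
rewrite Cpol_rec_neg // scalerBr.
have e2 : Q ^+ 2 * Q ^- 2 = 1 by rewrite mulfV // expf_neq0.
have {}e2 : Q%:P ^+ 2 * (Q ^- 2)%:P = 1 :> {poly k} by rewrite -polyC_exp -polyCM e2.
rewrite !doubleS -!mul_polyC !polyC_exp; move: (Q ^- 2)%:P e2 => v e2.
rewrite !exprS in e2 *; ring: e2.
Qed.
End PhiCpol.

(** * Irreducibility of the C-polynomials *)
Section Irreducible.
Variable F : fieldType.
Local Notation Q := (var F).

Lemma var_neq1 : 1 - Q != 0.
Proof.
have -> : 1 - Q = tofrac (1 - 'X) by rewrite tofracB tofrac1.
by rewrite tofrac_eq0 -oppr_eq0 opprB polyXsubC_eq0.
Qed.

Lemma Phi_Cpol pos m : map_poly (@tofrac _) (swapXY (Phi F pos m)) =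
  (Q ^+ denom_exp pos m) *: Cpol Q pos m.
Proof.
pose g : {rmorphism {poly {poly F}} -> {poly ratfun F}} :=
  map_poly (@tofrac {poly F}) \o swapXY.
rewrite -[LHS]/(g _).
have gX : g 'X = Q%:P by rewrite /= swapXY_X map_polyC.
have gY : g 'X%:P = 'X by rewrite /= swapXY_Y map_polyX.
exact (Phi_Cpol_morph (var_neq0 F) var_neq1 gX gY pos m).
Qed.

Lemma size_Cpol pos m : size (Cpol Q pos m) = m.+2.
Proof. exact: size_monic_op. Qed.

Lemma lead_swap_Phi pos m : lead_coef (swapXY (Phi F pos m)) = 'X^(denom_exp pos m) /\
  sizeY (Phi F pos m) = m.+2.
Proof.
have E := Phi_Cpol pos m; have nz : Q ^+ denom_exp pos m != 0.
  by rewrite expf_neq0 // (var_neq0 F).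
have inj : injective (@tofrac {poly F}) by move=> x y /eqP; rewrite tofrac_eq => /eqP.
split.
  apply: (inj); have := congr1 lead_coef E; rewrite lead_coefZ.
  rewrite (monicP (monic_op_monic _ _ _ _ _)) mulr1 (lead_coef_map_inj inj) ?tofrac0 //.
  by move=> ->; rewrite tofracXn.
by rewrite sizeYE -(size_map_inj_poly inj) ?tofrac0 // E size_scale // size_Cpol.
Qed.

End Irreducible.

Lemma scale_aux (k : fieldType) (x a b : k) (C1 C2 : {poly k}) :
  (a * b)%:P * (x *: (C1 * C2)) = (x *: (a *: C1)) * (b *: C2).
Proof. by rewrite -!mul_polyC polyCM; ring. Qed.

(** The numerator of [Cpol] satisfies the criterion: its extreme coefficients in
    Q are a power of E - 1 and a monomial in E, and its top coefficient in E is
    a power of Q because [Cpol] is monic. For m = 0 the degree is 1. *)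
Lemma Cpol_factor (F : fieldType) (K : closedFieldType) (f : {rmorphism F -> K})
    pos m (C1 C2 : {poly ratfun F}) :
  Cpol (var F) pos m = C1 * C2 -> (size C1 <= 1)%N \/ (size C2 <= 1)%N.
Proof.
have sC := size_Cpol F pos m => E.
have C0 : Cpol (var F) pos m != 0 by rewrite -size_poly_eq0 sC.
have C10 : C1 != 0 by apply: contraNneq C0 => C10; rewrite E C10 mul0r.
have C20 : C2 != 0 by apply: contraNneq C0 => C20; rewrite E C20 mulr0.
case: m => [|m] in sC E C0 *.
  move: sC; rewrite E size_mul //; move: (size C1) (size C2) => a b; lia.
have [d1 [L1 [d10 E1]]] := clear_denominators C1.
have [d2 [L2 [d20 E2]]] := clear_denominators C2.
have inj : injective (@tofrac {poly F}) by move=> x y /eqP; rewrite tofrac_eq => /eqP.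
have sL (L : {poly {poly F}}) (d : {poly F}) (C : {poly ratfun F}) : d != 0 ->
    map_poly (@tofrac _) L = tofrac d *: C -> size L = size C.
  move=> d0 EL; rewrite -(size_map_inj_poly inj) ?tofrac0 // EL size_scale //.
  by rewrite tofrac_eq0.
pose s := denom_exp pos m.+1.
pose G := swapXY ('X^s *: L1); pose H := swapXY L2.
have EG : (d1 * d2)^:P * Phi _ pos m.+1 = G * H.
  apply: (can_inj swapXYK); rewrite [LHS]rmorphM [RHS]rmorphM /= swapXY_map_polyC !swapXYK.
  apply: map_tofrac_inj; rewrite [LHS]rmorphM [RHS]rmorphM /= map_polyC Phi_Cpol.
  rewrite map_polyZ E1 E2 E.
  have := scale_aux (tofrac 'X^s) (tofrac d1) (tofrac d2) C1 C2.
  have e : tofrac 'X^s = var F ^+ s by rewrite tofracXn.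
  by rewrite -tofracM {1}e => h; refine h.
pose f1 : {rmorphism {poly F} -> {poly K}} := map_poly f.
have sf (U : {poly {poly F}}) : sizeY (map_poly f1 U) = sizeY U.
  by rewrite !sizeYE swapXY_map size_map_inj_poly ?rmorph0 //; exact: map_poly_inj.
have sPhi := (lead_swap_Phi K pos m.+1).2.
have lPhi := (lead_swap_Phi K pos m.+1).1.
have [||||||||||h|h] := @irreducible_criterion K (f1 (d1 * d2)) (Phi K pos m.+1)
  (map_poly f1 G) (map_poly f1 H) s
  (if pos then m.+2 else m.+1) (if pos then m.+1 else m.+2) 1 1
  (if pos then 1 else -1) 1.
- by rewrite map_poly_eq0 mulf_neq0.
- rewrite -(Phi_map f) -(rmorphM (map_poly f1)) -EG [RHS]rmorphM; congr (_ * _).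
  by apply/polyP => i; rewrite !coef_map [RHS]map_polyC.
- exact: oner_neq0.
- by case: (pos); rewrite ?oppr_eq0 oner_neq0.
- exact: oner_neq0.
- exact: oner_neq0.
- by rewrite scale1r lead_Phi; case: (pos).
- by rewrite Phi_at0; case: (pos); rewrite ?scale1r ?exprS // scaleN1r mulN1r.
- by rewrite scale1r.
- by rewrite sPhi; case: (pos); lia.
- left; move: h; rewrite sf sizeYE /G swapXYK size_scale ?(sL _ _ _ d10 E1) //.
  by rewrite -size_poly_eq0 size_polyXn.
by right; move: h; rewrite sf sizeYE /H swapXYK (sL _ _ _ d20 E2).
Qed.

(** * The Alexander polynomials of twist knots *)
Section Arcs.
Variable p : int.
Local Notation n := (`|p|%N).
Local Notation N := (2 * n)%N.
Local Notation pos := (p <= 0).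
Local Notation over i := (odd i (+) pos).
Local Notation D := (twist_knot p).

Definition pass1 := [seq (i, over i) | i <- iota 0 N].
Definition pass2 := [seq (i, ~~ over i) | i <- rev (iota 0 N)].
Definition clasp1 := [:: (N, true); (N.+1, false)].
Definition clasp2 := [:: (N.+1, true); (N, false)].

Lemma gaussE : gauss D = pass1 ++ clasp1 ++ pass2 ++ clasp2.
Proof. by []. Qed.

Lemma count_parity b m :
  count (fun i => odd i (+) b) (iota 0 m) = if b then uphalf m else m./2.
Proof.
elim: m => [|m IH]; first by case: b.
rewrite -addn1 iotaD count_cat IH /= add0n addn0 addn1.
by case: b {IH}; case: (boolP (odd m)) => odd_m; rewrite /=; lia.
Qed.

Lemma pass2E : pass2 = [seq (N.-1 - i, ~~ over (N.-1 - i)) | i <- iota 0 N]%N.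
Proof.
rewrite /pass2 (_ : rev (iota 0 N) = [seq (N.-1 - i)%N | i <- iota 0 N]); last first.
  apply: (@eq_from_nth _ 0%N); rewrite ?size_rev ?size_map // => i.
  rewrite size_iota => lt_i; rewrite nth_rev ?size_iota // (nth_map 0%N) ?size_iota //.
  by rewrite !nth_iota //; lia.
by rewrite -map_comp.
Qed.

Definition unders (s : seq (nat * bool)) := count (fun x : nat * bool => ~~ x.2) s.

Lemma unders_cat s t : unders (s ++ t) = (unders s + unders t)%N.
Proof. exact: count_cat. Qed.

Lemma unders_cons x s : unders (x :: s) = (~~ x.2 + unders s)%N.
Proof. by []. Qed.

Lemma unders_pass1 m : (m <= N)%N ->
  unders (take m pass1) = if pos then m./2 else uphalf m.
Proof.
move=> le_m; rewrite /pass1 -map_take take_iota (minn_idPl le_m) /unders count_map.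
rewrite (eq_count (a2 := fun i => odd i (+) ~~ pos)); last first.
  by move=> i /=; case: (odd i); case: pos.
by rewrite count_parity; case: pos.
Qed.

Lemma unders_pass2 m : (m <= N)%N ->
  unders (take m pass2) = if pos then m./2 else uphalf m.
Proof.
move=> le_m; rewrite pass2E -map_take take_iota (minn_idPl le_m) /unders count_map.
rewrite (@eq_in_count _ _ (fun i => odd i (+) ~~ pos)); last first.
  move=> i; rewrite mem_iota add0n => /andP[_ lt_i] /=; rewrite negbK.
  rewrite oddB; last by lia.
  have -> : odd N.-1 = true.
    by case: (n) lt_i le_m => [|k] //=; rewrite ?mulnS /= ?oddM //; lia.
  by case: (odd i); case: pos.
by rewrite count_parity; case: pos.
Qed.

Lemma size_pass1 : size pass1 = N. Proof. by rewrite size_map size_iota. Qed.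
Lemma size_pass2 : size pass2 = N. Proof. by rewrite size_map size_rev size_iota. Qed.

Lemma index_iota0 c m : (c < m)%N -> index c (iota 0 m) = c.
Proof.
move=> lt_c; have e : nth 0%N (iota 0 m) c = c by rewrite nth_iota.
by rewrite -{1}e index_uniq ?iota_uniq ?size_iota.
Qed.

Lemma index_pass1 c : (c < N)%N -> index (c, over c) (gauss D) = c.
Proof.
move=> lt_c; have mem : (c, over c) \in pass1.
  by apply/mapP; exists c; rewrite ?mem_iota.
rewrite gaussE index_cat mem /pass1.
have inj : injective (fun i => (i, over i)) by move=> i j [].
by rewrite (index_map inj) index_iota0.
Qed.

Lemma index_pass2 c : (c < N)%N ->
  index (c, ~~ over c) (gauss D) = (N + 2 + (N.-1 - c))%N.
Proof.
move=> lt_c; rewrite gaussE index_cat size_pass1.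
have -> : ((c, ~~ over c) \in pass1) = false.
  by apply/negP => /mapP[i _ [->]]; case: (over i).
rewrite index_cat /= !inE !xpair_eqE !(ltn_eqF lt_c) !(ltn_eqF (leqW lt_c)) /=.
have mem : (c, ~~ over c) \in pass2.
  by apply/mapP; exists c; rewrite ?mem_rev ?mem_iota.
rewrite index_cat mem pass2E addnA; congr (_ + _)%N.
have inj : {in iota 0 N &, injective (fun i => (N.-1 - i, ~~ over (N.-1 - i)))%N}.
  by move=> i j; rewrite !mem_iota => hi hj [] ; lia.
have e : ((N.-1 - (N.-1 - c)) = c)%N by lia.
pose f i := ((N.-1 - i)%N, ~~ over (N.-1 - i)).
have e' : nth (0%N, true) [seq f i | i <- iota 0 N] (N.-1 - c) = (c, ~~ over c).
  by rewrite (nth_map 0%N) ?size_iota ?nth_iota ?add0n /f ?e //; lia.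
rewrite -{1}e' index_uniq ?size_map ?size_iota ?(map_inj_in_uniq inj) ?iota_uniq //.
lia.
Qed.

(** The arcs of the two passages at the crossing c of the twist region, on the
    first and on the second strand. *)
Definition arc1 c := if pos then c./2 else uphalf c.
Definition arc2 c := (n.+1 + if pos then (N.-1 - c)./2 else uphalf (N.-1 - c))%N.

Lemma arc_index1 c : (c < N)%N -> Defs.arc D (index (c, over c) (gauss D)) = arc1 c.
Proof.
move=> lt_c; rewrite /Defs.arc -/(unders _) index_pass1 // gaussE takel_cat; last first.
  by rewrite size_pass1 ltnW.
rewrite unders_pass1 ?(ltnW lt_c) // modn_small // /arc1 /=.
by case: pos; lia.
Qed.

Lemma unders_pass1_all : unders pass1 = n.
Proof.
by rewrite -[pass1]take_size size_pass1 unders_pass1 //; case: pos; lia.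
Qed.

Lemma unders_pass2_all : unders pass2 = n.
Proof.
by rewrite -[pass2]take_size size_pass2 unders_pass2 //; case: pos; lia.
Qed.

Lemma arc_index2 c : (c < N)%N -> Defs.arc D (index (c, ~~ over c) (gauss D)) = arc2 c.
Proof.
move=> lt_c; rewrite /Defs.arc -/(unders _) index_pass2 // gaussE.
rewrite take_cat size_pass1 ltnNge -addnA leq_addr /= addKn.
rewrite add2n /= takel_cat; last by rewrite size_pass2; lia.
rewrite unders_cat !unders_cons unders_pass1_all unders_pass2 /=; last by lia.
rewrite modn_small /arc2; case: pos; lia.
Qed.

Lemma notin_pass1 x b : (N <= x)%N -> ((x, b) \in pass1) = false.
Proof.
by move=> le_x; apply/negP => /mapP[i]; rewrite mem_iota => lt_i [E _]; lia.
Qed.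

Lemma notin_pass2 x b : (N <= x)%N -> ((x, b) \in pass2) = false.
Proof.
by move=> le_x; apply/negP => /mapP[i]; rewrite mem_rev mem_iota => lt_i [E _]; lia.
Qed.

Lemma take_pass1_cat m s : take (N + m) (pass1 ++ s) = pass1 ++ take m s.
Proof. by rewrite take_cat size_pass1 ltnNge leq_addr addKn. Qed.

Lemma take_pass2_cat m s : take (N + m) (pass2 ++ s) = pass2 ++ take m s.
Proof. by rewrite take_cat size_pass2 ltnNge leq_addr addKn. Qed.

Let N1 : ((N.+1 == N) = false) * ((N == N.+1) = false).
Proof. by split; [rewrite gtn_eqF | rewrite ltn_eqF]. Qed.

Lemma arc_N_over : Defs.arc D (index (N, true) (gauss D)) = n.
Proof.
rewrite gaussE index_cat notin_pass1 // size_pass1 /= eqxx /Defs.arc -/(unders _).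
rewrite gaussE take_pass1_cat take0 cats0 unders_pass1_all modn_small //=; lia.
Qed.

Lemma arc_N_under : Defs.arc D (index (N, false) (gauss D)) = N.+1.
Proof.
rewrite gaussE index_cat notin_pass1 // size_pass1 /= !xpair_eqE ?N1 ?eqxx ?andbF /=.
rewrite index_cat notin_pass2 // size_pass2 /= !xpair_eqE ?N1 ?eqxx ?andbF /=.
rewrite /Defs.arc -/(unders _) gaussE.
rewrite take_pass1_cat /= take_pass2_cat unders_cat !unders_cons unders_cat.
rewrite unders_pass1_all unders_pass2_all /= ?unders_cons modn_small /=; lia.
Qed.

End Arcs.

Section Determinants.
Variable R : comNzRingType.

(** Adding to the first column the other ones with the factors s j does not
    change the determinant and turns this column into r times the last basis
    vector. *)
Lemma det_known_solution M (A : 'M[R]_(M.+1)) (s : 'I_M.+1 -> R) (r : R) :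
  s ord0 = 1 ->
  (forall i, \sum_j A i j * s j = if i == ord_max then r else 0) ->
  \det A = r * ((-1) ^+ M * \det (row' ord_max (col' ord0 A))).
Proof.
move=> s0 As; pose B : 'M[R]_(M.+1) :=
  \matrix_(i, j) if j == ord0 then s i else (i == j)%:R.
have detB : \det B = 1.
  rewrite det_trig; last first.
    apply/is_trig_mxP => i j lt_ij; rewrite mxE.
    have -> : (j == ord0) = false by apply/negbTE; rewrite -lt0n (leq_ltn_trans _ lt_ij).
    by have -> : (i == j) = false by apply/negbTE; rewrite neq_ltn lt_ij.
  apply: big1 => i _; rewrite mxE eqxx; by case: eqP => // ->.
have ABE i j : (A *m B) i j = if j == ord0 then if i == ord_max then r else 0 else A i j.
  rewrite mxE; have [->|j0] := eqVneq j ord0.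
    by rewrite -As; apply: eq_bigr => k _; rewrite mxE eqxx.
  rewrite (bigD1 j) //= mxE (negPf j0) eqxx mulr1 big1 ?addr0 // => k kj.
  by rewrite mxE (negPf j0) (negPf kj) mulr0.
have -> : \det A = \det (A *m B) by rewrite det_mulmx detB mulr1.
rewrite (expand_det_col _ ord0) (bigD1 ord_max) //=.
rewrite big1 ?addr0 => [|i im]; last by rewrite ABE eqxx (negPf im) mul0r.
rewrite ABE !eqxx /cofactor /= addn0; congr (r * ((-1) ^+ M * _)).
congr (\det _).
apply/matrixP => i j; rewrite [RHS]mxE [RHS]mxE.
transitivity ((A *m B) (lift ord_max i) (lift ord0 j)); first by rewrite 2!mxE.
by rewrite ABE.
Qed.

Lemma det_permuted_triangular M (A : 'M[R]_M) (f : 'I_M -> 'I_M) :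
  injective f -> (forall i j : 'I_M, (i < j)%N -> A i (f j) = 0) ->
  exists e : bool, \det A = (-1) ^+ e * \prod_i A i (f i).
Proof.
move=> inj tri; pose s := perm inj; exists (s : bool).
have : \det (col_perm s A) = \prod_i A i (f i).
  rewrite det_trig; first by apply: eq_bigr => i _; rewrite mxE permE.
  by apply/is_trig_mxP => i j lt_ij; rewrite mxE permE tri.
rewrite col_permE det_mulmx det_perm odd_permV => <-.
by rewrite mulrCA -signr_addb addbb expr0 mulr1.
Qed.

Lemma sum_delta M (k : R) x (s : nat -> R) :
  \sum_(j < M) (k *+ (nat_of_ord j == x)) * s j = if (x < M)%N then k * s x else 0.
Proof.
case: ltnP => le.
  rewrite (bigD1 (Ordinal le)) //= eqxx big1 ?addr0 // => j jx.
  have -> : (nat_of_ord j == x) = false by apply/negbTE; apply: contraNneq jx => e; apply/eqP/val_inj.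
  by rewrite mul0r.
rewrite big1 // => j _; have -> : (nat_of_ord j == x) = false.
  by apply/negbTE; rewrite neq_ltn (leq_trans (ltn_ord j) le).
by rewrite mul0r.
Qed.

End Determinants.

Lemma symmetrize1 (F : fieldType) n (c t : F) : t != 0 ->
  1 + (t - 2 + t^-1) * c = t ^ (- n.+1%:Z) * (t ^+ n * (t + (1 - t) ^+ 2 * c)).
Proof.
move=> t0; rewrite -exprnN exprS; have := expf_neq0 n t0; move: (t ^+ n) => u u0.
by field; rewrite t0 u0.
Qed.

Lemma symmetrize2 (F : fieldType) n (c t : F) : t != 0 ->
  t^-1 ^ (- n.+1%:Z) * (t^-1 ^+ n * (t^-1 + (1 - t^-1) ^+ 2 * c)) =
  1 + (t - 2 + t^-1) * c.
Proof.
move=> t0; rewrite -exprnN exprS exprVn; have := expf_neq0 n t0; move: (t ^+ n) => u u0.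
by field; rewrite t0 u0 oner_neq0.
Qed.

Section Alexander.
Variable p : int.
Local Notation n := (`|p|%N).
Local Notation N := (2 * n)%N.
Local Notation pos := (p <= 0).
Local Notation over i := (odd i (+) pos).
Local Notation D := (twist_knot p).

Definition rel3 (u v w : {poly int}) (x b a : nat) (j : nat) : {poly int} :=
  u *+ (j == x) + v *+ (j == b) + w *+ (j == a).

Lemma arcs_even i : (i < n)%N ->
  arc1 p (2 * i) = i /\ arc2 p (2 * i) = (if pos then N - i else N.+1 - i)%N.
Proof. by move=> lt_i; rewrite /arc1 /arc2; case: pos; lia. Qed.

Lemma arcs_odd i : (i < n)%N ->
  arc1 p (2 * i).+1 = (if pos then i else i.+1) /\ arc2 p (2 * i).+1 = (N - i)%N.
Proof. by move=> lt_i; rewrite /arc1 /arc2; case: pos; lia. Qed.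

Lemma entry_even i j : (i < n)%N -> alexander_entry D (2 * i) j =
  if pos then rel3 (1 - 'X) 'X (-1) i (N.+1 - i) (N - i) j
  else rel3 (1 - 'X) (-1) 'X (N.+1 - i) i.+1 i j.
Proof.
move=> lt_i; have lt_c : (2 * i < N)%N by lia.
have i1 := arc_index1 lt_c; have i2 := arc_index2 lt_c; have [a1 a2] := arcs_even lt_i.
rewrite /alexander_entry /rel3 [positive D _]/= lt_c andbT; move: i1 i2.
rewrite a1 a2 mul2n odd_double -mul2n; case: pos => /= -> ->; rewrite modn_small ?subSn //; lia.
Qed.

Lemma entry_odd i j : (i < n)%N -> alexander_entry D (2 * i).+1 j =
  if pos then rel3 (1 - 'X) 'X (-1) (N - i) i.+1 i j
  else rel3 (1 - 'X) (-1) 'X i.+1 (N.+1 - i) (N - i) j.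
Proof.
move=> lt_i; have lt_c : ((2 * i).+1 < N)%N by lia.
have i1 := arc_index1 lt_c; have i2 := arc_index2 lt_c; have [a1 a2] := arcs_odd lt_i.
rewrite /alexander_entry /rel3 [positive D _]/= lt_c andbT; move: i1 i2.
rewrite a1 a2 /= mul2n odd_double -mul2n; case: pos => /= -> ->; rewrite modn_small ?subSn //; lia.
Qed.

Lemma entry_last j : alexander_entry D N j = rel3 (1 - 'X) (-1) 'X n 0 N.+1 j.
Proof.
rewrite /alexander_entry /rel3 arc_N_over arc_N_under [positive D _]/= ltnn andbF.
by rewrite [crossings D]/= modnn.
Qed.

Definition slope : {poly int} := if pos then 1 - 'X else 'X - 1.

(** The solution of the relations with value 1 on the arc 0 and 0 on the last
    arc. Along each strand of the twist region it is affine, with slope 1 - t or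
    t - 1 according to the sign of the crossings; this satisfies all the
    relations in the twist region, and the relation of the clasp that is kept
    fails by [residual]. *)
Definition sol (j : nat) : {poly int} :=
  if (j <= n)%N then 1 + slope *+ j else slope *+ (N.+1 - j).

Lemma sol_first i : (i <= n)%N -> sol i = 1 + slope *+ i.
Proof. by rewrite /sol => ->. Qed.

Lemma sol_second i : (i <= n)%N -> sol (N.+1 - i) = slope *+ i.
Proof. by move=> le; rewrite /sol ifN ?subKn //; lia. Qed.

Lemma row_sum u v w x b a : (x <= N.+1)%N -> (b <= N.+1)%N -> (a <= N.+1)%N ->
  \sum_(j < N.+1) rel3 u v w x b a j * sol j = u * sol x + v * sol b + w * sol a.
Proof.
have solN : sol N.+1 = 0 by have := @sol_second 0 (leq0n _); rewrite subn0 mulr0n.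
have aux k y : (y <= N.+1)%N ->
    \sum_(j < N.+1) (k *+ (nat_of_ord j == y)) * sol j = k * sol y.
  rewrite leq_eqVlt sum_delta => /predU1P[->|->] //; by rewrite ltnn solN mulr0.
move=> lx lb la; rewrite -!aux // -!big_split; apply: eq_bigr => j _ /=.
by rewrite /rel3 !mulrDl.
Qed.

Definition residual : {poly int} := (1 - 'X) * (1 + slope *+ n) - 1.

Lemma row_relations (i : 'I_N.+1) :
  \sum_(j < N.+1) alexander_entry D i j * sol j = if i == ord_max then residual else 0.
Proof.
have [->|im] := eqVneq i ord_max.
  under eq_bigr do rewrite entry_last.
  rewrite row_sum //; last by lia.
  rewrite sol_first // sol_first // -[X in 'X * sol X]subn0 sol_second //.
  by rewrite /residual !mulr0n; ring.
have lt_i : (i < N)%N.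
  by rewrite ltn_neqAle -ltnS ltn_ord andbT; apply: contraNneq im => e; apply/eqP/val_inj.
move: (nat_of_ord i) lt_i => c lt_c {i im}.
have [k lt_k] : exists2 k, (k < n)%N & c = (2 * k)%N \/ c = (2 * k).+1.
  by exists c./2; lia.
have s1 : sol k = 1 + slope *+ k by apply: sol_first; lia.
have s2 : sol k.+1 = 1 + slope *+ k.+1 by apply: sol_first.
have s3 : sol (N.+1 - k) = slope *+ k by apply: sol_second; lia.
have s4 : sol (N - k) = slope *+ k.+1 by rewrite -subSS sol_second.
case=> ->.
  under eq_bigr do rewrite entry_even //.
  move: s1 s2 s3 s4; rewrite /slope; case: pos => s1 s2 s3 s4.
    by rewrite row_sum ?s1 ?s2 ?s3 ?s4 ?mulrS; [ring | lia..].
  by rewrite row_sum ?s1 ?s2 ?s3 ?s4 ?mulrS; [ring | lia..].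
under eq_bigr do rewrite entry_odd //.
move: s1 s2 s3 s4; rewrite /slope; case: pos => s1 s2 s3 s4.
  by rewrite row_sum ?s1 ?s2 ?s3 ?s4 ?mulrS; [ring | lia..].
by rewrite row_sum ?s1 ?s2 ?s3 ?s4 ?mulrS; [ring | lia..].
Qed.

(** The relation of the crossing c determines the value on an arc that occurs in
    no earlier relation. Its column is shifted by one, as the first column is
    removed. *)
Definition pivot (c : nat) : nat := if over c then (N.-1 - c./2)%N else c./2.

Lemma pivot_lt c : (c < N)%N -> (pivot c < N)%N.
Proof. by rewrite /pivot; case: ifP; lia. Qed.

Lemma pivot_even i : (i < n)%N -> pivot (2 * i) = if pos then (N.-1 - i)%N else i.
Proof.
move=> lt_i; rewrite /pivot (_ : (2 * i)./2 = i); last by lia.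
by rewrite (_ : odd (2 * i) = false) ?mul2n ?odd_double //; case: pos.
Qed.

Lemma pivot_odd i : (i < n)%N -> pivot (2 * i).+1 = if pos then i else (N.-1 - i)%N.
Proof.
move=> lt_i; rewrite /pivot (_ : (2 * i).+1./2 = i); last by lia.
by rewrite (_ : odd (2 * i).+1 = true) /= ?mul2n ?odd_double //; case: pos.
Qed.

Lemma pivot_inj c c' : (c < N)%N -> (c' < N)%N -> pivot c = pivot c' -> c = c'.
Proof.
rewrite /pivot; case: pos; rewrite ?addbT ?addbF;
  case: (boolP (odd c)) => o; case: (boolP (odd c')) => o' /=; lia.
Qed.

Lemma rel3_0 u v w x b a j : j != x -> j != b -> j != a -> rel3 u v w x b a j = 0.
Proof. by rewrite /rel3 => /negPf-> /negPf-> /negPf->; rewrite !mulr0n !addr0. Qed.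

Lemma entry_pivot c c' : (c < c')%N -> (c' < N)%N ->
  alexander_entry D c (pivot c').+1 = 0.
Proof.
have half c0 : (c0 < N)%N -> exists2 k, (k < n)%N & c0 = (2 * k)%N \/ c0 = (2 * k).+1.
  by move=> lt; exists c0./2; lia.
move=> lt lt'; have [k lt_k Ek] := half c (ltn_trans lt lt').
have [k' lt_k' Ek'] := half c' lt'.
by case: Ek Ek' lt => -> [] ->; rewrite ?entry_even ?entry_odd ?pivot_even ?pivot_odd //;
  case: pos => lt; rewrite rel3_0 //; lia.
Qed.

Lemma entry_pivot_diag c : (c < N)%N ->
  alexander_entry D c (pivot c).+1 = if odd c then 'X else -1.
Proof.
move=> lt; have [k lt_k Ek] : exists2 k, (k < n)%N & c = (2 * k)%N \/ c = (2 * k).+1.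
  by exists c./2; lia.
have rE u v w (x b a j : nat) : rel3 u v w x b a j =
  (if j == x then u else 0) + (if j == b then v else 0) + (if j == a then w else 0).
  by rewrite /rel3; do 3 case: (_ == _).
have o : odd (2 * k) = false by rewrite mul2n odd_double.
case: Ek => ->; rewrite ?entry_even ?entry_odd ?pivot_even ?pivot_odd //= o /=.
  by case: pos; rewrite rE; case: eqP => h1; case: eqP => h2; case: eqP => h3;
    rewrite ?add0r ?addr0 //; exfalso; lia.
by case: pos; rewrite rE; case: eqP => h1; case: eqP => h2; case: eqP => h3;
  rewrite ?add0r ?addr0 //; exfalso; lia.
Qed.

(** Up to sign, the minor is the residual of the known solution times the
    determinant of a matrix that is triangular after a permutation of its
    columns, with diagonal entries -1 and t. *)
Lemma alexander_minor_twist : exists e : bool,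
  alexander_minor D = (-1) ^+ e * 'X^n * residual.
Proof.
rewrite /alexander_minor /=; set A := (\matrix_(i, j) _).
rewrite (@det_known_solution _ N A (fun j => sol j) residual); first last.
- by move=> i; rewrite -row_relations; apply: eq_bigr => j _; rewrite mxE.
- by rewrite sol_first // mulr0n addr0.
pose f (c : 'I_N) : 'I_N := Ordinal (pivot_lt (ltn_ord c)).
have AE (i j : 'I_N) : row' ord_max (col' ord0 A) i (f j) = alexander_entry D i (pivot j).+1.
  by rewrite !mxE lift_max.
have [|i j lt_ij|e ->] := @det_permuted_triangular _ N (row' ord_max (col' ord0 A)) f.
- by move=> i j [] /(pivot_inj (ltn_ord i) (ltn_ord j)) /val_inj.
- by rewrite AE entry_pivot.
have -> : \prod_(i < N) row' ord_max (col' ord0 A) i (f i) = (-1) ^+ n * 'X^n.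
  rewrite (eq_bigr (fun i : 'I_N => if odd i then 'X else -1)) => [|i _]; last first.
    by rewrite AE entry_pivot_diag.
  elim: (n) => [|k IH]; first by rewrite big_ord0 !expr0 mulr1.
  rewrite mulnS 2!big_ord_recr /= IH mul2n odd_double /= !exprS; ring.
exists (e (+) odd n); rewrite signr_addb signr_odd.
have -> : (-1) ^+ N = 1 :> {poly int} by rewrite exprM sqrrN !expr1n.
by ring.
Qed.

Lemma residualE : residual = - ('X + (1 - 'X) ^+ 2 *~ p).
Proof.
have e (x : {poly int}) : x *~ p = if pos then - (x *+ n) else x *+ n.
  case: lerP => p0; first by rewrite pmulrn -mulrNz; congr (_ *~ _); lia.
  by rewrite pmulrn; congr (_ *~ _); lia.
rewrite /residual /slope e -(mulr_natr ((1 - 'X) ^+ 2) n).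
by case: pos; rewrite -(mulr_natr _ n); ring.
Qed.

Lemma is_alexander_poly_twist :
  is_alexander_poly D (1 + (var rat - 2 + (var rat)^-1) * p%:~R).
Proof.
have [e E] := alexander_minor_twist; exists (~~ e), (- n.+1%:Z) => d.
have Ed : d = 'X^n * ('X + (1 - 'X) ^+ 2 *~ p).
  by rewrite /d E residualE mulrN -[RHS]mul1r -(sqrr_sign _ e); case: (e) => /=; ring.
have ev (F : fieldType) (x : F) : eval_int d x = x ^+ n * (x + (1 - x) ^+ 2 * p%:~R).
  rewrite Ed /eval_int !(rmorphM, rmorphD, rmorphB, rmorphXn, rmorphMz, rmorph1) /=.
  rewrite !rmorphN /= !map_polyX hornerM hornerXn hornerD hornerX -mulrzr !hornerM.
  rewrite hornerD hornerN hornerX hornerC -(rmorph_int polyC) hornerC; ring.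
have t0 : var rat != 0 by rewrite /var tofrac_eq0 polyX_eq0.
split.
- by rewrite ev; refine (symmetrize1 n _ t0).
- by rewrite ev; refine (symmetrize2 n _ t0).
rewrite Ed hornerM hornerXn expr1n hornerD hornerX -mulrzr hornerM horner_exp.
by rewrite hornerD hornerN hornerX hornerC subrr expr0n mul0r addr0 mulr1.
Qed.

End Alexander.

(** * The C-polynomials *)
Section Specialization.
Variables (K k : fieldType) (sp : K -> k -> Prop) (sigma : {rmorphism K -> K}).
Variables (q Q : K) (Q' : k).
Hypothesis Rsp : ring_relation sp.
Hypothesis sp_sigma : forall x y, sp x y -> sp (sigma x) y.
Hypotheses (sq : sp q 1) (sqV : sp q^-1 1) (sQ : sp Q Q') (sQV : sp Q^-1 Q'^-1).
Local Notation id1 := (idfun : {rmorphism k -> k}).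

Lemma specializes_monic_op pos m :
  specializes sp (monic_op sigma q Q pos m) (monic_op id1 1 Q' pos m).
Proof.
have sqV' : sp q^-1 1^-1 by rewrite invr1.
have D := relD Rsp; have M := relM Rsp; have X := relX Rsp; have o := rel1 Rsp.
have XV n x y : sp x^-1 y^-1 -> sp (x ^- n) (y ^- n).
  by move=> h; rewrite -!exprVn; apply: X.
have sE P C := @specializes_shiftl _ _ _ Rsp sigma id1 sp_sigma P C.
have SD := specializesD Rsp; have SZ := specializesZ Rsp; have SB := specializesB Rsp.
have Xn n : sp (Qn q Q n) (Qn 1 Q' n) by apply: M => //; apply: X.
have XnV n : sp (Qn q Q n)^-1 (Qn 1 Q' n)^-1.
  by rewrite /Qn !invfM; apply: M => //; apply: XV.
have y n : sp (ycoef q Q n) (ycoef 1 Q' n).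
  by apply: D; apply: M => //; [apply: XV | apply: X].
have z n : sp (zcoef q Q n) (zcoef 1 Q' n).
  by apply: M => //; apply: relB => //.
have V n : specializes sp (shift_ops sigma q Q n).1 (shift_ops id1 1 Q' n).1 /\
    specializes sp (shift_ops sigma q Q n).2 (shift_ops id1 1 Q' n).2.
  elim: n => [|n [IH1 IH2]].
    by split; [rewrite /= -!polyC1; apply: (specializesC Rsp) | apply: (specializes0 Rsp)].
  rewrite !shift_opsS; split; last exact: sE.
  by apply: SB; [apply: SD | ]; apply: SZ => //; apply: sE.
have NN n : specializes sp (quotients sigma q Q n).1 (quotients id1 1 Q' n).1 /\
    specializes sp (quotients sigma q Q n).2 (quotients id1 1 Q' n).2.
  elim: n => [|n [IH1 IH2]]; first by split; apply: (specializes0 Rsp).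
  rewrite !quotientsS; split; last exact: sE.
  have [V1 _] := V n.
  by apply: SB; [apply: SD | ]; apply: SZ => //; apply: sE.
have leadV : sp (lead q Q pos m.+1)^-1 (lead 1 Q' pos m.+1)^-1.
  rewrite /lead; case: (pos); rewrite ?invrK; first exact: X.
  rewrite !invrN; apply: relN => //; apply: XV; rewrite (invfM q) (invfM 1); exact: M.
have o1 : sp (outer q Q pos m.+1).1 (outer 1 Q' pos m.+1).1.
  by rewrite /outer; case: (pos) => /=.
have o2 : sp (outer q Q pos m.+1).2 (outer 1 Q' pos m.+1).2.
  by rewrite /outer; case: (pos) => //=; apply: M.
have [N1 M1] := NN m.+1; have [_ M0] := NN m.
apply: (SD); first exact: specializesXn.
apply: (SZ) => //; apply: (SD); last by apply: (SZ) => //; apply: sE.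
apply: (SB); apply: (SZ) => //; apply: (D) => //; exact: M.
Qed.

End Specialization.

Section CharacteristicPolynomial.
Variables (F : fieldType) (Kbar : closedFieldType) (f : {rmorphism F -> Kbar}).
Local Notation Kq := (ratfun F).
Local Notation q := (var F).
Local Notation q0 := (var_neq0 F).

Lemma var_exp_inj : injective (fun n => q ^+ n).
Proof.
move=> m n /=; rewrite -!tofracXn => /eqP; rewrite tofrac_eq => /eqP E.
by have := congr1 (fun p : {poly F} => size p) E; rewrite /= !size_polyXn => -[].
Qed.

Lemma var_not_root1 n : (0 < n)%N -> q ^+ n != 1.
Proof. by move=> n0; rewrite -(expr0 q) (inj_eq var_exp_inj) -lt0n. Qed.

Definition char_op pos m : Aloc Kq :=
  monic_op (dilatation q0) (const q) (var Kq) pos m.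

Lemma char_op_laurent pos m :
  specializes (@laurent_q1 F) (char_op pos m) (Cpol q pos m).
Proof.
refine (specializes_monic_op (laurent_relation F) (@laurent_dilate F) _ _ _ _ pos m).
- exact: laurent_q.
- exact: laurent_qV.
- exact: laurent_var.
exact: laurent_varV.
Qed.

Lemma char_op_residue pos m :
  specializes (@residue_q1 F) (char_op pos m) (Cpol q pos m).
Proof. by move=> i; apply/laurent_residue/char_op_laurent. Qed.

Lemma size_char_op pos m : size (char_op pos m) = m.+2.
Proof. exact: size_monic_op. Qed.

(** By Gauss's lemma at the place q = 1, a factorization would give one of
    [Cpol]. *)
Lemma char_op_irreducible pos m S R :
  char_op pos m = skewp (dilatation q0) S R -> (1 < size R)%N ->
  (size (char_op pos m) <= size R)%N.
Proof.
move=> E gt1; have sC := size_Cpol F pos m; have sP := size_char_op pos m.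
have C0 : Cpol q pos m != 0 by rewrite -size_poly_eq0 sC.
have [S1 [R1 [EC lS lR]]] := gauss_skewp (residue_q1_place F) (@residue_dilate F) E
  (char_op_residue pos m) C0.
have P0 : char_op pos m != 0 by rewrite -size_poly_eq0 sP.
have S0 : S != 0 by apply: contraNneq P0 => S0; rewrite E S0 skewp0l.
have R0 : R != 0 by apply: contraNneq P0 => R0; rewrite E R0 skewp0r.
have S10 : S1 != 0 by apply: contraNneq C0 => S10; rewrite EC S10 mul0r.
have R10 : R1 != 0 by apply: contraNneq C0 => R10; rewrite EC R10 mulr0.
have e1 : size (char_op pos m) = (size S + size R).-1 by rewrite {1}E size_skewp.
have e2 : size (Cpol q pos m) = (size S1 + size R1).-1 by rewrite {1}EC size_mul.
have := Cpol_factor f EC; move: e1 e2 lS lR gt1; rewrite sC sP.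
move: (size S) (size R) (size S1) (size R1) => a b c d; lia.
Qed.

Lemma char_op_char_poly p m : `|p|%N = m.+1 ->
  is_char_poly q (bsum q p 1) (char_op (0 < p) m).
Proof.
move=> pm; have kP := kills_monic_op q0 var_not_root1 pm.
refine (is_char_poly_minimal q0 _ kP _).
  by rewrite -size_poly_eq0 size_char_op.
refine (minimal_of_irreducible kP _ _).
  apply: (not_kills1 q0 var_not_root1).
  by rewrite -absz_eq0 pm.
exact (@char_op_irreducible _ _).
Qed.

(** For p = 0 the relation [bsum_relation] involves b_1 and b_(-1) only, and
    parity turns it into (1 - q^n) b_1 = 0. *)
Lemma bsum_0 n : (0 < n)%N -> bsum q 0 1 n = 0.
Proof.
move=> n0; have := bsum_relation_abs q0 var_not_root1 0 n.
rewrite /outer_coef ltxx absz0 /= bsum0 mulr0 subr0 add0r sub0r (bsumN q0).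
have -> : q * (- (q ^ (- 1)) * bsum q 0 1 n) = - bsum q 0 1 n.
  by rewrite exprN1 mulNr mulrN mulrA mulfV ?q0 // mul1r.
move/eqP; rewrite -mulN1r -mulrDl mulf_eq0 subr_eq0 (negPf (var_not_root1 n0)).
by move/eqP.
Qed.

(** This function is supported at 0, hence killed by Q - 1, a unit of A_loc. *)
Lemma char_poly_0 : is_char_poly q (bsum q 0 1) 1.
Proof.
apply: (is_char_poly_minimal q0) => [||R R0 _]; first exact: oner_neq0.
  have nz : 'X - 1 != 0 :> {poly Kq} by rewrite polyXsubC_eq0.
  exists ('X - 1)%:P, ('X - 1); split=> //.
    by rewrite /A_to_Aloc map_polyC /= -mul_polyC mulr1.
  move=> n; rewrite mulr0 (@actE _ q 1) ?size_polyC_leq1 // big_ord1 coefC addn0 /=.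
  rewrite hornerD hornerN hornerX hornerC.
  by case: n => [|n]; rewrite ?expr0 ?subrr ?mul0r // bsum_0 // mulr0.
by rewrite size_poly1 size_poly_gt0.
Qed.

End CharacteristicPolynomial.

(** * Evaluation at Q = 1 *)
Section EvaluationAtOne.
Variable F : fieldType.
Local Notation Q := (var F).

Lemma ratfun_at_div (a : F) (u v : {poly F}) : v.[a] != 0 ->
  ratfun_at a (tofrac u / tofrac v) = u.[a] / v.[a].
Proof.
move=> va; apply: classical_sets.xget_unique; first by exists u, v.
have nz (w : {poly F}) : w.[a] != 0 -> tofrac w != 0 :> ratfun F.
  by rewrite tofrac_eq0; apply: contraNneq => ->; rewrite horner0.
move=> y [u' [v' [va' /eqP E ->]]]; apply/eqP; rewrite eqr_div //.
move: E; rewrite eqr_div ?nz // -!tofracM tofrac_eq => /eqP E.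
by rewrite -!hornerM E.
Qed.

Lemma ratfun_at_tofrac (a : F) (u : {poly F}) : ratfun_at a (tofrac u) = u.[a].
Proof.
have := @ratfun_at_div a u 1; rewrite tofrac1 divr1 hornerC divr1 => -> //.
exact: oner_neq0.
Qed.

Lemma const0 : const (0 : F) = 0. Proof. by rewrite /const tofrac0. Qed.

Definition eval1 (c : ratfun F) : ratfun F := const (ratfun_at 1 c).

Lemma eval1_0 : eval1 0 = 0.
Proof. by rewrite /eval1 -tofrac0 ratfun_at_tofrac horner0 const0. Qed.

Lemma coef_Cpol_at1 pos m j : ratfun_at 1 (Cpol Q pos m)`_j = (Phi F pos m).[1]`_j.
Proof.
have := congr1 (fun P : {poly ratfun F} => P`_j) (Phi_Cpol F pos m).
rewrite coef_map coefZ /= => E; set s := denom_exp pos m in E.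
have nz : tofrac 'X^s != 0 :> ratfun F by rewrite tofrac_eq0 -size_poly_eq0 size_polyXn.
have -> : (Cpol Q pos m)`_j = tofrac (swapXY (Phi F pos m))`_j / tofrac 'X^s.
  by apply: (mulIf nz); rewrite divfK // E tofracXn mulrC.
rewrite ratfun_at_div hornerXn expr1n ?oner_neq0 // divr1.
have := horner_swapXY (swapXY (Phi F pos m)) 1; rewrite swapXYK polyC1 => ->.
by rewrite coef_map.
Qed.

Lemma coef_op_poly (R : nzRingType) (P : {poly R}) i :
  (op_poly P)`_i = if (i < size P)%N then P`_((size P).-1 - i) else 0.
Proof.
rewrite /op_poly coef_sum; case: ltnP => [lt_i|le_i].
  have lt_k : ((size P).-1 - i < size P)%N by move: lt_i; clear; move: (size P) => b; lia.
  rewrite (bigD1 (Ordinal lt_k)) //= coefZ coefXn subKn ?eqxx ?mulr1; last first.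
    by move: lt_i; clear; move: (size P) => b; lia.
  rewrite big1 ?addr0 // => j jk; rewrite coefZ coefXn.
  have -> : (i == (size P).-1 - j)%N = false; last by rewrite mulr0.
  apply/negP => /eqP e; case/negP: jk; apply/eqP/val_inj => /=.
  by move: (nat_of_ord j) (ltn_ord j) e lt_i => a; move: (size P) => b *; lia.
rewrite big1 // => j _; rewrite coefZ coefXn.
have -> : (i == (size P).-1 - j)%N = false; last by rewrite mulr0.
apply/negP => /eqP e; move: (nat_of_ord j) (ltn_ord j) e le_i => a.
by move: (size P) => b *; lia.
Qed.

Lemma op_Cpol_at1 pos m (z : ratfun F) :
  (map_poly eval1 (op_poly (Cpol Q pos m))).[z] =
  1 + z * (if pos then m.+1%:R else - m.+1%:R).
Proof.
set c := (if pos then m.+1%:R else - m.+1%:R).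
pose d : F := if pos then m.+1%:R else - m.+1%:R.
have dc : const d = c.
  rewrite /d /c /const; case: (pos); first by rewrite polyC_natr rmorph_nat.
  by rewrite polyCN tofracN polyC_natr rmorph_nat.
have -> : map_poly eval1 (op_poly (Cpol Q pos m)) = 1 + c *: 'X.
  apply/polyP => i; rewrite coef_map_id0 ?eval1_0 // coef_op_poly size_Cpol.
  rewrite (coefD 1) coef1 (coefZ c) coefX.
  have [lt_i|le_i] := ltnP i m.+2; last first.
    by rewrite eval1_0 !gtn_eqF ?mulr0 ?addr0 //; lia.
  rewrite /eval1 coef_Cpol_at1 Phi_at1 coefD coefXn.
  have -> : (if pos then m.+1%:R else - m.+1%:R) * 'X^m = d *: 'X^m :> {poly F}.
    by rewrite -mul_polyC /d; case: (pos); rewrite ?polyCN ?polyC_natr.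
  rewrite coefZ coefXn.
  case: i lt_i => [|[|i]] lt_i; rewrite ?subn0 ?subn1 /=.
  - by rewrite eqxx gtn_eqF // mulr0 !addr0 mulr0 addr0 /const tofrac1.
  - by rewrite ltn_eqF // eqxx mulr1 add0r mulr1 add0r dc.
  have -> : (m.+1 - i.+2 == m.+1)%N = false by apply/negP => /eqP; lia.
  have -> : (m.+1 - i.+2 == m)%N = false by apply/negP => /eqP; lia.
  by rewrite !(mulr0, addr0, const0).
by rewrite hornerD hornerC hornerZ hornerX mulrC.
Qed.

Lemma op_1_at1 : map_poly eval1 (op_poly 1) = 1.
Proof.
apply/polyP => i; rewrite coef_map_id0 ?eval1_0 // coef_op_poly size_poly1 !coef1.
case: i => [|i] /=; last exact: eval1_0.
by rewrite /eval1 -tofrac1 ratfun_at_tofrac hornerC.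
Qed.

End EvaluationAtOne.

(** * The C-polynomials of twist knots *)
Lemma Jhat_bsum p : Jhat p = bsum qv p 1.
Proof. by apply/boolp.funext => n; apply: JhatE. Qed.

(** Monic characteristic polynomials are unique, and so are residues at q = 1. *)
Lemma C_twist_unique p (P : Aloc Kq) C : is_char_poly qv (Jhat p) P ->
  P \is monic -> specializes (@laurent_q1 rat) P C -> C_twist p = C.
Proof.
move=> cP mP PC; rewrite /C_twist; apply: classical_sets.xget_unique.
  by exists P; split=> // j; exact (laurent_at_q1E (PC j)).
move=> C' [P' [cP' mP' PC']].
have E := is_char_poly_uniq (var_neq0 rat) mP' mP cP' cP.
refine (specializes_fun (residue_q1_place rat) (P := P) _ _) => j.
  by rewrite -E; refine (laurent_residue (laurent_q1E (PC' j))).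
exact (laurent_residue (PC j)).
Qed.

Lemma C_twist_nonzero p m : `|p|%N = m.+1 -> C_twist p = Cpol (var rat) (0 < p) m.
Proof.
move=> pm; refine (@C_twist_unique p (char_op rat (0 < p) m) _ _ _ _).
- by rewrite Jhat_bsum; refine (@char_op_char_poly rat algC ratr p m pm).
- exact: monic_op_monic.
exact: char_op_laurent.
Qed.

Lemma C_twist_0 : C_twist 0 = 1.
Proof.
refine (@C_twist_unique 0 1 1 _ (monic1 _) _).
  by rewrite Jhat_bsum; exact: (@char_poly_0 rat).
move=> j; rewrite !coef1; case: (j == 0%N); first exact: (rel1 (laurent_relation rat)).
exact: (rel0 (laurent_relation rat)).
Qed.

Theorem theorem2 :
  let Q : ratfun rat := var rat in
  let M : ratfun rat := var rat in
  let S : {poly (ratfun rat)} :=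
    (Q - Q ^+ 2)%:P + 'X + (Q ^+ 2)%:P * 'X in
  (* (a) *)
  ((forall p : int, 0 <= p ->
      C_twist (p + 2) =
        S * C_twist (p + 1) - (Q ^+ 2)%:P * 'X^2 * C_twist p)
   /\ C_twist 0 = 1
   /\ C_twist 1 = Q%:P + 'X
   /\ (forall p : int, p <= 0 ->
        C_twist (p - 2) =
          S * (Q ^- 2)%:P * C_twist (p - 1)
          - 'X^2 * (Q ^- 2)%:P * C_twist p)
   /\ C_twist (-1) = -1 + 'X)
  /\
  (* (b) *)
  (forall p : int,
     is_alexander_poly (twist_knot p)
       (map_poly (fun c => const (ratfun_at 1 c)) (op_poly (C_twist p))).[M - 2 + M^-1]).
Proof.
move=> Q M S.
have Q0 : Q != 0 := var_neq0 rat.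
have Q1 : 1 - Q != 0 := var_neq1 rat.
have C_pos (p : int) m : p = m.+1%:Z -> C_twist p = Cpol Q true m.
  by move=> ->; rewrite (@C_twist_nonzero _ m).
have C_neg (p : int) m : p = - m.+1%:Z -> C_twist p = Cpol Q false m.
  by move=> ->; rewrite (@C_twist_nonzero _ m) ?abszN // ltNge oppr_le0.
split; first (split; [|split; [|split; [|split]]]).
- case=> [[|m]|//] _.
    rewrite (C_pos _ 1) // (C_pos _ 0) // C_twist_0 mulr1.
    exact (Cpol_pos1 Q0 Q1).
  rewrite (C_pos (m.+1%:Z + 2) m.+2) ?(C_pos (m.+1%:Z + 1) m.+1) ?(C_pos m.+1 m) //; try lia.
  exact (Cpol_rec_pos Q0 Q1 m).
- exact: C_twist_0.
- rewrite (C_pos _ 0%N) //; exact (Cpol_pos0 Q0 Q1).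
- move=> p p0; have [m ->] : exists m, p = - m%:Z by exists `|p|%N; lia.
  case: m => [|m].
    rewrite (C_neg (- 0%:Z - 2) 1%N) // (C_neg (- 0%:Z - 1) 0%N) //.
    have -> : C_twist (- 0%:Z) = 1 := C_twist_0.
    rewrite (mulr1 ('X^2 * _)); exact (Cpol_neg1 Q0 Q1).
  rewrite (C_neg (- m.+1%:Z - 2) m.+2) ?(C_neg (- m.+1%:Z - 1) m.+1) ?(C_neg (- m.+1%:Z) m) //; try lia.
  exact (Cpol_rec_neg Q0 Q1 m).
- rewrite (C_neg _ 0%N) //; exact (Cpol_neg0 Q0 Q1).
move=> p; pose z : ratfun rat := M - 2 + M^-1.
suff -> : (map_poly (@eval1 rat) (op_poly (C_twist p))).[z] = 1 + z * p%:~R.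
  exact: is_alexander_poly_twist.
case: p => [[|m]|m].
- rewrite C_twist_0 mulr0 addr0; by rewrite op_1_at1 hornerC.
- rewrite (C_pos _ m) //; exact: op_Cpol_at1.
rewrite NegzE (C_neg _ m) // op_Cpol_at1.
by rewrite rmorphN.
Qed.
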